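(* There is a $1$-regular curve $\Gamma\subset\mathbb{H}^1$ (that is, a $1$-regular set which is the image of a continuous curve) with $\Gamma\notin\mathrm{GLem}(\beta_{1,\mathcal{V}_1},2)$ and $\Gamma\in\mathrm{GLem}(\widehat{\beta}_{1,\mathcal{V}_1},4)$.
   Context: **Heisenberg group.** $\mathbb{H}^1$ is $\mathbb{R}^{2}\times\mathbb{R}$ with product $(z,t)\cdot(z',t')=(z+z',t+t'+\frac12(z_1z_2'-z_2z_1'))$. The Korányi norm is $\|(z,t)\|=\sqrt[4]{|z|^4+16t^2}$ and the Korányi distance is $d(x,y)=\|y^{-1}\cdot x\|$. $B(x,r)$ is the closed $d$-ball; $\mathrm{diam}$, $d(x,A)=\inf_{a\in A}d(x,a)$ and the Hausdorff measure $\mathcal{H}^1$ are taken with respect to $d$. Set $\pi(z,t)=z$; $d_{\mathrm{Eucl}}$ denotes Euclidean distance in $\mathbb{R}^2$. $\mathcal{V}_1$ is the family of (affine) horizontal lines: sets $x\cdot(\ell\times\{0\})$ with $x\in\mathbb{H}^1$ and $\ell\subset\mathbb{R}^2$ a line through the origin. **Regular sets.** $E\subset\mathbb{H}^1$ is $1$-regular if it is closed and there is $C_E>1$ with $C_E^{-1}r\le\mathcal{H}^1(E\cap B(x,r))\le C_Er$ for all $x\in E$, $0<r\le\mathrm{diam}(E)$, $r<\infty$. **Dyadic systems.** A dyadic system on a $1$-regular set $E$ is a collection $\mathcal{D}=\bigcup_{j\in\mathbb{J}}\mathcal{D}_j$, with each $\mathcal{D}_j$ a family of pairwise disjoint Borel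 sets, together with constants $\varrho\in(0,1)$, $D\in(1,\infty)$ (such systems exist with $\varrho,D$ depending only on $C_E$) such that: (1) $E=\bigcup_{Q\in\mathcal{D}_j}Q$ for each $j\in\mathbb{J}$; (2) if $Q_1,Q_2\in\mathcal{D}$ intersect, one contains the other; (3) $D^{-1}\varrho^j\le\mathrm{diam}(Q)\le D\varrho^j$ and $D^{-1}\varrho^{j}\le\mathcal{H}^1(Q)\le D\varrho^{j}$ for $Q\in\mathcal{D}_j$; (4) for each $Q\in\mathcal{D}_j$ there is $x_Q\in E$ with $B(x_Q,D^{-1}\varrho^j)\cap E\subset Q$; (5) $\mathcal{H}^1(\{x\in Q:d(x,E\setminus Q)\le\eta\varrho^j\})\le D\eta^{1/D}\mathcal{H}^1(Q)$ for all $Q\in\mathcal{D}_j$, $\eta>0$. Here $\mathbb{J}=\mathbb{Z}$ if $E$ is unbounded, and $\mathbb{J}=\{j\in\mathbb{Z}:j\ge J_0\}$ with $\varrho^{J_0+1}\le\mathrm{diam}(E)<\varrho^{J_0}$ otherwise. $\mathcal{D}_{Q_0}=\{Q\in\mathcal{D}:Q\subset Q_0\}$, and $\lambda Q=\{x\in E:d(x,Q)\le(\lambda-1)\mathrm{diam}(Q)\}$ for $\lambda>1$. **Coefficients.** With $\langle f\rangle_{\lambda Q}=\frac{1}{\mathcal{H}^1(\lambda Q)}\int_{\lambda Q}f\,d\mathcal{H}^1$, $$\beta_{1,\mathcal{V}_1}(\lambda Q)=\inf_{V\in\mathcal{V}_1}\left\langle\frac{d(\cdot,V)}{\mathrm{diam}(\lambda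 Q)}\right\rangle_{\lambda Q},\qquad\widehat{\beta}_{1,\mathcal{V}_1}(\lambda Q)=\inf_{V\in\mathcal{V}_1}\left(\left\langle\frac{d_{\mathrm{Eucl}}(\pi(\cdot),\pi(V))}{\mathrm{diam}(\lambda Q)}\right\rangle_{\lambda Q}^{2}+\left\langle\frac{d(\cdot,V)}{\mathrm{diam}(\lambda Q)}\right\rangle_{\lambda Q}^{4}\right)^{1/4}.$$ **Geometric lemma.** $E\in\mathrm{GLem}(h,q)$ means: for a dyadic system $\mathcal{D}$ on $E$ and $\lambda>1$ there is $C$ such that $\sum_{Q\in\mathcal{D}_{Q_0}}h(\lambda Q)^q\mathcal{H}^1(Q)\le C\mathcal{H}^1(Q_0)$ for all $Q_0\in\mathcal{D}$ (the validity does not depend on the choice of $\mathcal{D}$ and $\lambda$). *)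

(* Defs.v *)
From HB Require Import structures.
From mathcomp Require Import all_boot all_order all_algebra.
From mathcomp Require Import all_classical all_reals all_analysis.
From mathcomp Require Import ring lra.

Set Implicit Arguments.
Unset Strict Implicit.
Unset Printing Implicit Defensive.
Import Order.TTheory GRing.Theory Num.Theory.
Import numFieldNormedType.Exports.

Local Open Scope classical_set_scope.
Local Open Scope ring_scope.

Section metric_sets.
Context {R : realType} {T : metricType R}.
Implicit Types (A E Q : set T) (x : T).

(* [diam set0 = 0]: the supremum is taken over a set containing 0. *)
Definition diam A : \bar R :=
  ereal_sup (0%E |` [set (mdist x y)%:E | x in A & y in A]).

(* Extended-real valued, so that the distance to [set0] is [+oo]. *)
Definition dist_set x A : \bar R := ereal_inf [set (mdist x a)%:E | a in A].

(* Closed balls in the metric sense; the library's [closed_ball] is the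
   closure of the open ball. *)
Definition cball x (r : R) : set T := [set y | mdist x y <= r].

Definition dilate (lambda : R) E Q : set T :=
  [set x | E x /\ (dist_set x Q <= (lambda - 1)%:E * diam Q)%E].

Definition borel : set (set T) := <<s @open T >>.

End metric_sets.

Section hausdorff_measure.
Context {R : realType} {T : metricType R}.
Implicit Types (A : set T) (F : nat -> set T) (delta : R).
Local Open Scope ereal_scope.

Definition hausdorff_cover delta A F :=
  A `<=` \bigcup_k F k /\ forall k, diam (F k) <= delta%:E.

Definition hausdorff_content delta A : \bar R :=
  ereal_inf [set \sum_(k <oo) diam (F k) | F in hausdorff_cover delta A].

(* The supremum over [delta > 0] is the limit as [delta] tends to 0. *)
Definition hausdorff1 A : \bar R :=
  ereal_sup [set hausdorff_content delta A | delta in [set d : R | (0 < d)%R]].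

Lemma diam_ge0 A : 0 <= diam A.
Proof. by apply: ereal_sup_ubound; left. Qed.

Lemma diam0 : diam (set0 : set T) = 0.
Proof.
rewrite /diam (_ : [set _ | _ in _ & _ in _] = set0) ?setU0 ?ereal_sup1//.
by apply/seteqP; split => // y [].
Qed.

Lemma hausdorff_content_ge0 delta A : 0 <= hausdorff_content delta A.
Proof.
apply: le_ereal_inf_tmp => _ [F _ <-].
by apply: nneseries_ge0 => *; exact: diam_ge0.
Qed.

Lemma hausdorff_content0 delta : (0 < delta)%R ->
  hausdorff_content delta set0 = 0.
Proof.
move=> d0; apply/eqP; rewrite eq_le hausdorff_content_ge0 andbT.
apply: ereal_inf_lbound; exists (fun=> set0).
  by split => // k; rewrite diam0 lee_fin ltW.
by rewrite eseries0// => k _ _; rewrite diam0.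
Qed.

Lemma le_hausdorff_content delta :
  {homo hausdorff_content delta : A B / A `<=` B >-> A <= B}.
Proof.
move=> A B AB; apply/ereal_inf_le_tmp => _ [F [BF dF] <-].
by exists F => //; split => //; exact: subset_trans BF.
Qed.

Lemma hausdorff_content_sigma_subadditive delta :
  sigma_subadditive (hausdorff_content delta).
Proof.
set mu := hausdorff_content delta.
have mu_ge0 := hausdorff_content_ge0 delta.
move=> A; have [[i ioo]|] := pselect (exists i, mu (A i) = +oo).
  rewrite (eseries_pinfty _ _ ioo) ?leey// => n _.
  by rewrite -ltNye (lt_le_trans _ (mu_ge0 _)).
rewrite -forallNE => Aoo.
suff add2e (e : {posnum R}) :
    mu (\bigcup_n A n) <= \sum_(i <oo) mu (A i) + e%:num%:E.
  by apply/lee_addgt0Pr => _/posnumP[].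
rewrite (le_trans _ (epsilon_trick _ _ _))//.
pose P n (B : nat -> set T) := hausdorff_cover delta (A n) B /\
  \sum_(k <oo) diam (B k) <= mu (A n) + (e%:num / (2 ^ n.+1)%:R)%:E.
have [G PG] : {G : nat -> nat -> set T & forall n, P n (G n)}.
  apply: (@choice _ _ P) => n; rewrite /P.
  have fmu : mu (A n) \is a fin_num.
    by rewrite ge0_fin_numE// ltey; exact/eqP/Aoo.
  have en1 : (0 < e%:num / (2 ^ n.+1)%:R :> R)%R by [].
  have [x [B cB <-] xS] := lb_ereal_inf_adherent en1 fmu.
  by exists B; split => //; exact/ltW.
have dG_ge0 x : 0 <= (diam \o uncurry G) x by exact: diam_ge0.
apply: (@le_trans _ _ (\esum_(i in setT) (diam \o uncurry G) i)).
  apply: ereal_inf_lbound => /=.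
  have /card_esym/ppcard_eqP[f] := card_nat2.
  exists (uncurry G \o f).
    split; last first.
      by move=> k /=; case: (f k) => a b /=; exact: (PG a).1.2.
    move=> t [i _] /((PG i).1.1) [j _ Gijt].
    by exists (f^-1%FUN (i, j)) => //=; rewrite invK ?inE.
  rewrite -(esum_pred_image (diam \o uncurry G) _ xpredT) ?[fun=> _]set_true//.
  by rewrite image_eq.
rewrite (_ : esum _ _ = \sum_(i <oo) \sum_(j <oo ) diam (G i j)); last first.
  pose J : nat -> set (nat * nat) := fun i => [set (i, j) | j in setT].
  rewrite (_ : setT = \bigcup_k J k); last first.
    by rewrite predeqE => -[a b]; split => // _; exists a => //; exists b.
  rewrite esum_bigcupT /=; last 2 first.
    - apply/trivIsetP => i j _ _ ij.
      rewrite predeqE => -[n m] /=; split => //= -[] [_] _ [<-{n} _].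
      by move=> [m' _] [] /esym/eqP; rewrite (negbTE ij).
    - by move=> /= [n m]; exact: diam_ge0.
  rewrite -(image_id [set: nat]) -fun_true esum_pred_image//; last first.
    by move=> n _; apply: esum_ge0 => *; exact: diam_ge0.
  apply: eq_eseriesr => /= j _.
  rewrite -(esum_pred_image (diam \o uncurry G) (pair j) predT)//=; last 2 first.
    by move=> *; exact: diam_ge0.
    by move=> ? ? _ _; exact: (@can_inj _ _ _ snd).
  by congr esum; rewrite predeqE => -[a b]; split; move=> [i _ <-]; exists i.
apply: lee_lim.
- apply: is_cvg_nneseries => n *.
  by apply: nneseries_ge0 => m *; exact: (dG_ge0 (n, m)).
- by apply: is_cvg_nneseries => n *; apply: adde_ge0 => //; exact: mu_ge0.
- by near=> n; apply: lee_sum => i _; exact: (PG i).2.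
Unshelve. all: by end_near. Qed.

Let hausdorff1_0 : hausdorff1 set0 = 0.
Proof.
apply/eqP; rewrite eq_le; apply/andP; split.
  by apply: ge_ereal_sup => _ [d /= d0 <-]; rewrite hausdorff_content0.
apply: (le_trans (hausdorff_content_ge0 1 set0)).
by apply: ereal_sup_ubound; exists 1%R => /=.
Qed.

Let hausdorff1_ge0 A : 0 <= hausdorff1 A.
Proof.
apply: (le_trans (hausdorff_content_ge0 1 A)).
by apply: ereal_sup_ubound; exists 1%R => /=.
Qed.

Let le_hausdorff1 : {homo hausdorff1 : A B / A `<=` B >-> A <= B}.
Proof.
move=> A B AB; apply: ge_ereal_sup => _ [d d0 <-].
apply: (le_trans (@le_hausdorff_content d _ _ AB)).
by apply: ereal_sup_ubound; exists d.
Qed.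

Let hausdorff1_sigma_subadditive : sigma_subadditive hausdorff1.
Proof.
move=> A; apply: ge_ereal_sup => _ [d d0 <-].
apply: (le_trans (@hausdorff_content_sigma_subadditive d A)).
apply: lee_nneseries => [k _ _|k _]; first exact: hausdorff_content_ge0.
by apply: ereal_sup_ubound; exists d.
Qed.

HB.instance Definition _ := isOuterMeasure.Build R T hausdorff1
  hausdorff1_0 hausdorff1_ge0 le_hausdorff1 hausdorff1_sigma_subadditive.

End hausdorff_measure.

Section regular_sets.
Context {R : realType} {T : metricType R}.
Implicit Types (E Q : set T).

Definition regular1 E := closed E /\ exists2 C : R, 1 < C &
  forall x (r : R), E x -> 0 < r -> (r%:E <= diam E)%E ->
    ((C^-1 * r)%:E <= hausdorff1 (E `&` cball x r) <= (C * r)%:E)%E.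

(* The parameter interval is arbitrary: a regular curve may be unbounded. *)
Definition curve E := exists (I : set R) (gamma : R -> T),
  [/\ is_interval I, {within I, continuous gamma} & E = gamma @` I].

(* [J] is the set of admissible generations. If [diam E = 0] there is none,
   hence no dyadic system on [E]. *)
Definition generations (rho : R) E (J : set int) :=
  (diam E = +oo%E /\ J = setT) \/
  exists J0 : int, [/\ ((rho ^ (J0 + 1))%:E <= diam E)%E,
    (diam E < (rho ^ J0)%:E)%E & J = [set j : int | J0 <= j]].

(* Only the families [dy_gen j] with [dy_J j] are part of the system. *)
Record dyadic_system E := DyadicSystem {
  dy_rho : R;
  dy_D : R;
  dy_J : set int;
  dy_gen : int -> set (set T);
  dy_rho_itv : 0 < dy_rho < 1;
  dy_D_gt1 : 1 < dy_D;
  dy_JE : generations dy_rho E dy_J;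
  dy_borel : forall j Q, dy_J j -> dy_gen j Q -> borel Q;
  dy_disj : forall j, dy_J j -> trivIset (dy_gen j) id;
  dy_cover : forall j, dy_J j -> E = \bigcup_(Q in dy_gen j) Q;
  dy_nested : forall i j Q1 Q2, dy_J i -> dy_J j ->
    dy_gen i Q1 -> dy_gen j Q2 -> Q1 `&` Q2 !=set0 ->
    Q1 `<=` Q2 \/ Q2 `<=` Q1;
  dy_diam : forall j Q, dy_J j -> dy_gen j Q ->
    ((dy_D^-1 * dy_rho ^ j)%:E <= diam Q <= (dy_D * dy_rho ^ j)%:E)%E;
  dy_meas : forall j Q, dy_J j -> dy_gen j Q ->
    ((dy_D^-1 * dy_rho ^ j)%:E <= hausdorff1 Q <= (dy_D * dy_rho ^ j)%:E)%E;
  dy_center : forall j Q, dy_J j -> dy_gen j Q ->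
    exists2 x, E x & cball x (dy_D^-1 * dy_rho ^ j) `&` E `<=` Q;
  dy_boundary : forall j Q (eta : R), dy_J j -> dy_gen j Q -> 0 < eta ->
    (hausdorff1 [set x | Q x /\
                         (dist_set x (E `\` Q) <= (eta * dy_rho ^ j)%:E)%E]
     <= (dy_D * eta `^ dy_D^-1)%:E * hausdorff1 Q)%E
}.

Definition dy_cubes E (S : dyadic_system E) : set (set T) :=
  \bigcup_(j in dy_J S) dy_gen S j.

(* The sum ranges over sets, so a set belonging to several generations is
   counted once. The quantification over systems and over [lambda] is
   universal; the choice is immaterial for the coefficients below. *)
Definition GLem (h : set T -> \bar R) (q : R) E :=
  forall (S : dyadic_system E) (lambda : R), 1 < lambda ->
  exists C : R, forall Q0, dy_cubes S Q0 ->
    (\esum_(Q in [set Q | dy_cubes S Q /\ Q `<=` Q0])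
        (h (dilate lambda E Q) `^ q * hausdorff1 Q) <=
     C%:E * hausdorff1 Q0)%E.

End regular_sets.

Section plane.
Context {R : realType}.
Implicit Types z w : R * R.

Definition enorm z : R := Num.sqrt (z.1 ^+ 2 + z.2 ^+ 2).

Lemma enorm_ge0 z : 0 <= enorm z.
Proof. exact: sqrtr_ge0. Qed.

Lemma sqr_enorm z : enorm z ^+ 2 = z.1 ^+ 2 + z.2 ^+ 2.
Proof. by rewrite sqr_sqrtr// addr_ge0 ?sqr_ge0. Qed.

Lemma enormD z w : enorm (z + w) <= enorm z + enorm w.
Proof.
rewrite -ler_sqr ?nnegrE ?addr_ge0 ?enorm_ge0// sqrrD !sqr_enorm /=.
have CS : z.1 * w.1 + z.2 * w.2 <= enorm z * enorm w.
  apply: le_trans (ler_norm _) _.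
  rewrite -ler_sqr ?nnegrE ?mulr_ge0 ?enorm_ge0//.
  rewrite real_normK ?num_real// exprMn !sqr_enorm.
  by have := sqr_ge0 (z.1 * w.2 - z.2 * w.1); nra.
by rewrite mulr2n; nra.
Qed.

End plane.

Record heisenberg (R : realType) :=
  Heisenberg { heis_z : R * R; heis_t : R }.
Arguments Heisenberg {R} heis_z heis_t.

Section heisenberg_group.
Context {R : realType}.
Local Notation H := (heisenberg R).
Implicit Types x y : H.

Let pair_of x := (heis_z x, heis_t x).
Let of_pair (p : (R * R) * R) : H := Heisenberg p.1 p.2.
Let pair_ofK : cancel pair_of of_pair. Proof. by case. Qed.

HB.instance Definition _ := Choice.copy H (can_type pair_ofK).
HB.instance Definition _ := isPointed.Build H (Heisenberg 0 0).

Lemma heisP x y : (heis_z x).1 = (heis_z y).1 ->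
  (heis_z x).2 = (heis_z y).2 -> heis_t x = heis_t y -> x = y.
Proof. by case: x y => [[? ?] ?] [[? ?] ?] /= -> -> ->. Qed.

Definition heis_mul x y : H :=
  let z := heis_z x in let w := heis_z y in
  Heisenberg (z + w) (heis_t x + heis_t y + 2^-1 * (z.1 * w.2 - z.2 * w.1)).

Definition heis_one : H := Heisenberg 0 0.

Definition heis_inv x : H := Heisenberg (- heis_z x) (- heis_t x).

Let heis_mulA : associative heis_mul.
Proof. by move=> x y z; apply: heisP => /=; ring. Qed.
Let heis_mul1 : left_id heis_one heis_mul.
Proof. by move=> x; apply: heisP => /=; ring. Qed.
Let heis_mulr1 : right_id heis_one heis_mul.
Proof. by move=> x; apply: heisP => /=; ring. Qed.
Let heis_mulV : left_inverse heis_one heis_inv heis_mul.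
Proof. by move=> x; apply: heisP => /=; ring. Qed.
Let heis_mulrV : right_inverse heis_one heis_inv heis_mul.
Proof. by move=> x; apply: heisP => /=; ring. Qed.

HB.instance Definition _ := isGroup.Build H
  heis_mulA heis_mul1 heis_mulr1 heis_mulV heis_mulrV.

Definition koranyi x : R :=
  (enorm (heis_z x) ^+ 4 + 16 * heis_t x ^+ 2) `^ 4^-1.

Lemma koranyi_ge0 x : 0 <= koranyi x.
Proof. exact: powR_ge0. Qed.

Lemma sqr_koranyi x :
  koranyi x ^+ 2 = enorm (enorm (heis_z x) ^+ 2, 4 * heis_t x).
Proof.
rewrite /koranyi -powR_mulrn ?powR_ge0// -powRrM.
rewrite (_ : 4^-1 * 2 = 2^-1); last by field.
rewrite powR12_sqrt; last first.
  by rewrite addr_ge0// ?exprn_ge0 ?enorm_ge0// mulr_ge0 ?ler0n ?sqr_ge0.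
by rewrite /enorm /=; congr Num.sqrt; ring.
Qed.

Lemma koranyiM x y : koranyi (x * y)%g <= koranyi x + koranyi y.
Proof.
have [a0 b0] := (koranyi_ge0 x, koranyi_ge0 y).
rewrite -ler_sqr ?nnegrE ?addr_ge0 ?koranyi_ge0// sqrrD.
have le_z u : enorm (heis_z u) <= koranyi u.
  rewrite -ler_sqr ?nnegrE ?enorm_ge0 ?koranyi_ge0// sqr_koranyi.
  rewrite -ler_sqr ?nnegrE ?enorm_ge0 ?exprn_ge0 ?enorm_ge0//.
  by rewrite [leRHS]sqr_enorm /= lerDl sqr_ge0.
rewrite sqr_koranyi; set z := heis_z x; set w := heis_z y.
pose m : R * R := (2 * (z.1 * w.1 + z.2 * w.2), 2 * (z.1 * w.2 - z.2 * w.1)).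
have -> : (enorm (heis_z (x * y)%g) ^+ 2, 4 * heis_t (x * y)%g) =
    (enorm z ^+ 2, 4 * heis_t x) + (enorm w ^+ 2, 4 * heis_t y) + m.
  by rewrite !sqr_enorm; congr pair => /=; rewrite -/z -/w; field.
apply: (le_trans (enormD _ _)).
apply: (le_trans (lerD (enormD _ _) (lexx _))).
rewrite -!sqr_koranyi.
have -> : enorm m = 2 * (enorm z * enorm w).
  apply/eqP; rewrite -(@eqrXn2 _ 2) ?mulr_ge0 ?enorm_ge0//.
  by rewrite sqr_enorm !exprMn !sqr_enorm /=; apply/eqP; ring.
have := ler_pM (enorm_ge0 z) (enorm_ge0 w) (le_z x) (le_z y).
by rewrite mulr2n; lra.
Qed.

Let heis_dist x y := koranyi (y^-1 * x)%g.

Let heis_distxx x : heis_dist x x = 0.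
Proof.
rewrite /heis_dist mulVg /koranyi /enorm /= expr0n/= addr0 sqrtr0.
by rewrite !expr0n/= mulr0 addr0 powR0.
Qed.

Let koranyi_eq0 x : koranyi x = 0 -> x = 1%g.
Proof.
move=> x0; have := sqr_koranyi x; rewrite x0 expr0n/= => /esym/(congr1 (@GRing.exp R ^~ 2)).
rewrite sqr_enorm /= expr0n/= sqr_enorm => /eqP.
rewrite paddr_eq0 ?sqr_ge0// !sqrf_eq0 paddr_eq0 ?sqr_ge0// !sqrf_eq0.
rewrite mulf_eq0 pnatr_eq0/= => /andP[/andP[/eqP z1 /eqP z2] /eqP t0].
exact: heisP.
Qed.

Let heis_dist_positivity x y : heis_dist x y = 0 -> x = y.
Proof.
by move=> /koranyi_eq0/(congr1 (fun u => y * u)%g); rewrite mulVKg mulg1.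
Qed.

Let koranyiV x : koranyi x^-1%g = koranyi x.
Proof. by rewrite /koranyi /enorm /= !sqrrN. Qed.

Let heis_dist_sym x y : heis_dist x y = heis_dist y x.
Proof. by rewrite /heis_dist -koranyiV invgM invgK. Qed.

Let heis_dist_triangle y x z :
  heis_dist x z <= heis_dist x y + heis_dist y z.
Proof.
rewrite addrC; apply: le_trans (koranyiM _ _).
by rewrite /heis_dist -mulgA mulVKg.
Qed.

HB.instance Definition _ := isMetric.Build R H
  heis_distxx heis_dist_positivity heis_dist_sym heis_dist_triangle.

Lemma heis_mdistE x y : mdist x y = koranyi (y^-1 * x)%g.
Proof. by []. Qed.

End heisenberg_group.

Section beta_coefficients.
Context {R : realType}.
Local Notation H := (heisenberg R).
Implicit Types (A V : set H).

Local Notation hausdorff1_type :=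
  (caratheodory_type (@hausdorff1 R H : {outer_measure set H -> \bar R})).

(* [hausdorff1] as a measure on its Caratheodory sets, which include the Borel
   sets since it is a metric outer measure. *)
Definition hausdorff1_measure : set hausdorff1_type -> \bar R :=
  @hausdorff1 R H.

Let hausdorff1_measure0 : hausdorff1_measure set0 = 0%E.
Proof. exact: (outer_measure0 (@hausdorff1 R H)). Qed.

Let hausdorff1_measure_ge0 (A : set hausdorff1_type) :
  (0 <= hausdorff1_measure A)%E.
Proof. exact: (outer_measure_ge0 (@hausdorff1 R H)). Qed.

Let hausdorff1_measure_semi_sigma_additive :
  semi_sigma_additive hausdorff1_measure.
Proof.
by move=> F mF tF mUF; exact: (caratheodory_measure_sigma_additive mF tF mUF).
Qed.

HB.instance Definition _ := isMeasure.Build _ _ _ hausdorff1_measure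
  hausdorff1_measure0 hausdorff1_measure_ge0
  hausdorff1_measure_semi_sigma_additive.

Definition average A (f : H -> \bar R) : \bar R :=
  ((hausdorff1 A)^-1 * \int[hausdorff1_measure]_(x in A) f x)%E.

(* The line through the origin spanned by [v], when [v != 0]. *)
Definition line0 (v : R * R) : set (R * R) :=
  [set (s * v.1, s * v.2) | s in setT].

Definition horizontal_lines : set (set H) :=
  [set V | exists (x : H) (v : R * R), v != 0 /\
    V = [set (x * Heisenberg z 0)%g | z in line0 v]].

Definition edist_plane (z : R * R) (B : set (R * R)) : \bar R :=
  ereal_inf [set (enorm (z - w))%:E | w in B].

Definition avg_dist A V : \bar R :=
  average A (fun x => dist_set x V / diam A)%E.

Definition avg_edist A V : \bar R :=
  average A (fun x => edist_plane (heis_z x) (@heis_z R @` V) / diam A)%E.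

Definition beta A : \bar R :=
  ereal_inf [set avg_dist A V | V in horizontal_lines].

Definition beta_hat A : \bar R :=
  ereal_inf [set (avg_edist A V ^+ 2 + avg_dist A V ^+ 4) `^ 4^-1 |
             V in horizontal_lines]%E.

End beta_coefficients.

(* Main.v *)
Require Import Defs.
From HB Require Import structures.
From mathcomp Require Import all_boot all_order all_algebra.
From mathcomp Require Import all_classical all_reals all_analysis.
From mathcomp Require Import ring lra.

Set Implicit Arguments.
Unset Strict Implicit.
Unset Printing Implicit Defensive.
Import Order.TTheory GRing.Theory Num.Theory.
Import numFieldNormedType.Exports.

Local Open Scope classical_set_scope.
Local Open Scope ring_scope.

(** A curve of the form [(x, f x, x * f x / 2 - G x)] with [G' = f] is
    horizontal. When the graph of [f] deviates from a line by [e * r] at scale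
    [r], the deviation of [G] from the primitive of that line is [O(e * r ^ 2)],
    so the Koranyi distance from the curve to the horizontal line over the line
    is of order [e ^ (1/2) * r]: the vertical deviation dominates. Hence
    [beta ^ 2] is of order [e] at the places where [f] oscillates, whereas
    [beta_hat ^ 4] is at most of order [e ^ 2]. It remains to find a Lipschitz
    [f] whose oscillation is about [e_n = 1 / (n + 1)] on many intervals of each
    generation [n] and nowhere larger: the sum of [e_n ^ 2] over the generations
    converges and the sum of [e_n] diverges.

    The series [f] of bumps of height [e_n * B ^ - n] on the cells of length
    [B ^ - n] with constant coefficients has unbounded slope, since the [e_n] are
    not summable. The coefficients are therefore taken from the Riesz product
    of the factors [1 + i * e_n * w_n], up to a small constant, where [w_n] is the
    slope of the unit bumps of generation [n]. The modulus of such a product stays in a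
    compact subinterval of [(0, +oo)] because the [e_n] are square summable: an
    imaginary relative increment changes the modulus to second order only. Its
    real and imaginary parts are the slopes of two Lipschitz functions, and at
    each cell at least one of the two coefficients is of order [e_n]
    ([riesz_norm], [riesz_coefficients]). So the coefficients [beta] of the two
    curves together violate the Carleson condition, and one of the two curves is
    the desired one.

    Upper bounds: [profile_tangent_modulus] gives the uniform deviation
    [O(r / (1 + |ln r|))] at scale [r]. It yields a bi-Lipschitz
    parametrization ([lift_lip], [lift_expanding]), hence regularity, and it
    bounds [beta_hat ^ 4] by a multiple of [(1 + |ln r|) ^ - 2]
    ([beta_hat_le]), which is summable along any geometric sequence of scales;
    [packing] turns this into the geometric lemma for every dyadic system.

    Lower bounds: along a horizontal line [G] is a quadratic polynomial, up to
    the square of the distance to the line ([height_over_line]). A third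
    difference of [G] removes the polynomial ([third_near_line]), and it is of
    order [e_n * B ^ (- 2 n)] on a cell with a large coefficient
    ([third_prim_ge]). This bounds [beta] from below for the dyadic system of
    images of [b]-adic intervals ([beta_cell_ge], [GLem_beta_sum]).

    On the measure-theoretic side, [hausdorff1] is a metric outer measure, so
    Borel sets are Caratheodory measurable ([caratheodory_closed]). *)

(** * Hausdorff measure in a metric space *)

Section metric_sets.
Context {R : realType} {T : metricType R}.
Implicit Types (A B V : set T) (x y : T) (r c : R).
Local Open Scope ereal_scope.

Lemma dist_set_le x A a : A a -> dist_set x A <= (mdist x a)%:E.
Proof. by move=> Aa; apply: ereal_inf_lbound; exists a. Qed.

Lemma dist_set_ge0 x A : 0 <= dist_set x A.
Proof. by apply: le_ereal_inf_tmp => _ [a _ <-]; rewrite lee_fin mdist_ge0. Qed.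

Lemma dist_set_lt x A r : dist_set x A < r%:E ->
  exists2 a, A a & (mdist x a < r)%R.
Proof.
by move=> /ereal_inf_lt[_ [a Aa <-]]; rewrite lte_fin => ?; exists a.
Qed.

Lemma dist_set_in x A : A x -> dist_set x A = 0.
Proof.
move=> Ax; apply/eqP; rewrite eq_le dist_set_ge0 andbT.
by rewrite (le_trans (dist_set_le x Ax))// mdistxx.
Qed.

Lemma dist_set_triangle x y A :
  dist_set x A <= (mdist x y)%:E + dist_set y A.
Proof.
rewrite -leeBlDl//; apply: le_ereal_inf_tmp => _ [a Aa <-].
rewrite leeBlDl//; apply: (le_trans (dist_set_le x Aa)).
by rewrite -EFinD lee_fin metric_triangle.
Qed.

Lemma mdist_le_diam A x y : A x -> A y -> (mdist x y)%:E <= diam A.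
Proof. by move=> Ax Ay; apply: ereal_sup_ubound; right; exists x => //; exists y. Qed.

Lemma diam_le A c : (0 <= c)%R -> (forall x y, A x -> A y -> (mdist x y <= c)%R) ->
  diam A <= c%:E.
Proof.
move=> c0 h; apply: ge_ereal_sup => _ [->|[x Ax [y Ay <-]]]; rewrite lee_fin//.
exact: h.
Qed.

Lemma le_diam A B : A `<=` B -> diam A <= diam B.
Proof.
move=> AB; apply: ereal_sup_le => _ [->|[x Ax [y Ay <-]]]; first by left.
by right; exists x; [exact: AB|exists y => //; exact: AB].
Qed.

Lemma closed_dist_set_ge V c : closed [set x | c%:E <= dist_set x V].
Proof.
rewrite -[X in closed X]setCK; apply: open_closedC.
rewrite openE => x /= /negP; rewrite -ltNge => /dist_set_lt[a Va xa].
apply/nbhs_ballP; exists (c - mdist x a)%R => /=; first by rewrite subr_gt0.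
move=> y; rewrite ballEmdist/= => xy; apply/negP; rewrite -ltNge.
apply: (le_lt_trans (dist_set_le y Va)); rewrite lte_fin.
apply: (le_lt_trans (metric_triangle y x a)); rewrite metric_sym; lra.
Qed.

End metric_sets.

Section hausdorff_measure.
Context {R : realType} {T : metricType R}.
Implicit Types (A B X F : set T) (delta : R).
Local Open Scope ereal_scope.

Lemma hausdorff1_ge0 A : 0 <= hausdorff1 A.
Proof. exact: (outer_measure_ge0 (@hausdorff1 R T)). Qed.

Lemma le_hausdorff1 A B : A `<=` B -> hausdorff1 A <= hausdorff1 B.
Proof. exact: (le_outer_measure (@hausdorff1 R T)). Qed.

Lemma hausdorff1_0 : hausdorff1 (@set0 T) = 0.
Proof. exact: (outer_measure0 (@hausdorff1 R T)). Qed.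

Lemma hausdorff1U A B : hausdorff1 (A `|` B) <= hausdorff1 A + hausdorff1 B.
Proof. exact: (outer_measureU2 (@hausdorff1 R T)). Qed.

Lemma content_le_hausdorff1 delta A : (0 < delta)%R ->
  hausdorff_content delta A <= hausdorff1 A.
Proof. by move=> d0; apply: ereal_sup_ubound; exists delta. Qed.

Lemma le_delta_content (d1 d2 : R) A : (d1 <= d2)%R ->
  hausdorff_content d2 A <= hausdorff_content d1 A.
Proof.
move=> d12; apply: ereal_inf_le_tmp => _ [F [AF dF] <-]; exists F => //.
by split => // k; rewrite (le_trans (dF k))// lee_fin.
Qed.

(** No set of diameter less than [e] meets both [A] and [B], so restricting a fine
    cover to [A] and to [B] does not increase the total diameter. *)
Lemma content_separated (e delta : R) A B : (delta < e)%R ->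
  (forall a b, A a -> B b -> (e <= mdist a b)%R) ->
  hausdorff_content delta A + hausdorff_content delta B <=
  hausdorff_content delta (A `|` B).
Proof.
move=> de sep; apply: le_ereal_inf_tmp => _ [F [ABF dF] <-].
have cov C : C `<=` A `|` B ->
    hausdorff_content delta C <= \sum_(k <oo) diam (F k `&` C).
  move=> CAB; apply: ereal_inf_lbound; exists (fun k => F k `&` C) => //; split.
    by move=> x Cx; have [k _ Fx] := ABF _ (CAB _ Cx); exists k.
  by move=> k; apply: le_trans (dF k); apply: le_diam; exact: subIsetl.
apply: (le_trans (leeD (cov A (@subsetUl _ _ _)) (cov B (@subsetUr _ _ _)))).
rewrite -nneseriesD; [|by move=> *; exact: diam_ge0..].
apply: lee_nneseries => [k _ _|k _]; first by rewrite adde_ge0 ?diam_ge0.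
have [[a [Fa Aa]]|nA] := pselect (exists a, (F k `&` A) a).
  rewrite [X in _ + diam X](_ : _ = set0) ?diam0 ?adde0; last first.
    apply/seteqP; split => // b [Fb Bb].
    have := le_trans (mdist_le_diam Fa Fb) (dF k).
    by rewrite lee_fin leNgt (lt_le_trans de (sep _ _ Aa Bb)).
  by apply: le_diam; exact: subIsetl.
rewrite [X in diam X + _](_ : _ = set0) ?diam0 ?add0e; last first.
  by apply/seteqP; split => // a Fa; apply: nA; exists a.
by apply: le_diam; exact: subIsetl.
Qed.

(** [hausdorff1] is a metric outer measure: at scales below the gap the contents
    of separated sets add up. *)
Lemma hausdorff1_separated (e : R) A B : (0 < e)%R ->
  (forall a b, A a -> B b -> (e <= mdist a b)%R) ->
  hausdorff1 A + hausdorff1 B <= hausdorff1 (A `|` B).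
Proof.
move=> e0 sep.
have key (d1 d2 : R) : (0 < d1)%R -> (0 < d2)%R ->
    hausdorff_content d1 A + hausdorff_content d2 B <= hausdorff1 (A `|` B).
  move=> d10 d20; pose d : R := (Num.min d1 (Num.min d2 (e / 2)))%R.
  have d0 : (0 < d)%R by rewrite !lt_min d10 d20 divr_gt0.
  apply: (@le_trans _ _ (hausdorff_content d A + hausdorff_content d B)).
    by apply: leeD; apply: le_delta_content; rewrite !ge_min lexx ?orbT.
  apply: le_trans (content_le_hausdorff1 _ d0).
  apply: (@content_separated e) => //.
  by rewrite !gt_min; apply/orP; right; apply/orP; right; lra.
have [->|ABoo] := eqVneq (hausdorff1 (A `|` B)) +oo; first by rewrite leey.
have fin C : C `<=` A `|` B -> hausdorff1 C \is a fin_num.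
  move=> CAB; rewrite ge0_fin_numE ?hausdorff1_ge0//.
  by rewrite (le_lt_trans (le_hausdorff1 CAB))// ltey.
have fA := fin A (@subsetUl _ _ _); have fB := fin B (@subsetUr _ _ _).
apply/lee_addgt0Pr => t t0.
have t20 : (0 < t / 2)%R by rewrite divr_gt0.
have [_ [d1 /= d10 <-] h1] := ub_ereal_sup_adherent t20 fA.
have [_ [d2 /= d20 <-] h2] := ub_ereal_sup_adherent t20 fB.
rewrite -/(hausdorff1 A) in h1; rewrite -/(hausdorff1 B) in h2.
apply: (le_trans _ (leeD (key _ _ d10 d20) (lexx _))).
rewrite (splitr t) EFinD addeACA.
by apply: leeD; rewrite -leeBlDr// ltW.
Qed.

(** The shells of [X] between distances [1/(i+2)] and [1/(i+1)] from [F] with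
    indices of the same parity are separated, so their measures have a finite
    sum; the part of [X] outside [F] but close to [F] is a tail of it. *)
Lemma caratheodory_closed F : closed F ->
  (@hausdorff1 R T : {outer_measure set T -> \bar R}).-caratheodory F.
Proof.
move=> cF; apply: le_caratheodory_measurable => X /=.
change (hausdorff1 (X `&` F) + hausdorff1 (X `&` ~` F) <= hausdorff1 X).
have [->|Xoo] := eqVneq (hausdorff1 X) +oo; first by rewrite leey.
have fX : hausdorff1 X \is a fin_num.
  by rewrite ge0_fin_numE ?hausdorff1_ge0// ltey.
pose far k := X `&` [set x | (k.+1%:R^-1)%:E <= dist_set x F].
pose shell i := X `&` [set x | (i.+2%:R^-1)%:E <= dist_set x F < (i.+1%:R^-1)%:E].
have inv_le (i j : nat) : (i <= j)%N -> (j.+1%:R^-1 <= i.+1%:R^-1 :> R)%R.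
  by move=> ij; rewrite lef_pV2 ?posrE// ler_nat.
have gap i : (0 < i.+2%:R^-1 - i.+3%:R^-1 :> R)%R.
  by rewrite subr_gt0 ltf_pV2 ?posrE// ltr_nat.
(* The union stays away from the next shell of the same parity. *)
have alt (e : nat) n : \sum_(0 <= i < n) hausdorff1 (shell (e + i.*2)%N) <=
    hausdorff1 (X `&` \bigcup_(i < n) shell (e + i.*2)%N).
  elim: n => [|n IH]; first by rewrite big_nil hausdorff1_ge0.
  rewrite big_nat_recr//=; apply: (le_trans (leeD IH (lexx _))).
  have [->|n0] := posnP n.
    rewrite bigcup_mkord big_ord0 setI0 hausdorff1_0 add0e.
    by apply: le_hausdorff1 => x sx; split; [case: sx|exists 0%N].
  pose m := (e + n.-1.*2)%N.
  apply: le_trans (hausdorff1_separated (gap m) _) _; last first.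
    apply: le_hausdorff1 => x [[Xx [i /= ni si]]|sx].
      by split => //; exists i => //=; exact: (ltn_trans ni).
    by split; [case: sx|exists n => /=].
  move=> a b [Xa [i /= ni sa]] sb.
  have mn : (m.+2 <= e + n.*2)%N by rewrite /m -{2}(prednK n0) doubleS !addnS.
  have im : (e + i.*2 <= m)%N.
    by rewrite leq_add2l leq_double -ltnS prednK.
  have [_ /= /andP[ia _]] := sa; have [_ /= /andP[_ /ltW bj]] := sb.
  have := le_trans ia (dist_set_triangle a b F).
  move=> /le_trans/(_ (leeD (lexx _) bj)); rewrite -EFinD lee_fin.
  move=> h; rewrite lerBlDr (le_trans (inv_le (e + i.*2).+1 m.+1 im))//.
  by rewrite (le_trans h)// lerD2l; exact: inv_le mn.
have half e n : \sum_(0 <= i < n) hausdorff1 (shell (e + i.*2)%N) <= hausdorff1 X.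
  by apply: (le_trans (alt e n)); apply: le_hausdorff1; exact: subIsetl.
have sum_shell n : \sum_(0 <= i < n.*2) hausdorff1 (shell i) =
    \sum_(0 <= i < n) hausdorff1 (shell (0 + i.*2)%N) +
    \sum_(0 <= i < n) hausdorff1 (shell (1 + i.*2)%N).
  elim: n => [|n IH]; first by rewrite !big_nil adde0.
  rewrite doubleS !big_nat_recr//= IH add0n add1n -!addeA; congr (_ + _).
  by rewrite addeCA.
have sum_fin : \sum_(0 <= i <oo) hausdorff1 (shell i) < +oo.
  apply: (@le_lt_trans _ _ (hausdorff1 X + hausdorff1 X)); last first.
    by rewrite ltey_eq fin_numD fX.
  apply: lime_le; first by apply: is_cvg_nneseries => *; exact: hausdorff1_ge0.
  apply: nearW => n.
  apply: (@le_trans _ _ (\sum_(0 <= i < n.*2) hausdorff1 (shell i))).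
    apply: lee_sum_nneg_natr => [*|]; first exact: hausdorff1_ge0.
    by rewrite -addnn leq_addr.
  by rewrite sum_shell leeD.
have cover k : X `&` ~` F `<=` far k `|` \bigcup_(i in [set i | (k <= i)%N]) shell i.
  move=> x [Xx Fx].
  have [d d0 xd] : exists2 d : R, (0 < d)%R & d%:E <= dist_set x F.
    have : nbhs x (~` F) by apply: open_nbhs_nbhs; split => //; exact: closed_openC.
    move=> /nbhs_ballP[d /= d0 dF]; exists d => //.
    apply: le_ereal_inf_tmp => _ [a Fa <-]; rewrite lee_fin leNgt.
    by apply/negP => xa; apply: (dF a _ Fa); rewrite ballEmdist.
  have [m] : exists m, (m.+1%:R^-1)%:E <= dist_set x F.
    exists (Num.trunc d^-1); apply: le_trans xd; rewrite lee_fin.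
    by rewrite invf_ple ?posrE//; apply/ltW; exact: truncnS_gt.
  elim: m => [|m IH] hm.
    by left; split => //=; apply: le_trans hm; rewrite lee_fin inv_le.
  have [hm'|hm'] := leP (m.+1%:R^-1)%:E (dist_set x F); first exact: IH.
  have [km|mk] := leqP k m; first by right; exists m => //; split => //=; rewrite hm.
  by left; split => //=; apply: le_trans hm; rewrite lee_fin inv_le.
have bound k : hausdorff1 (X `&` F) + hausdorff1 (X `&` ~` F) <=
    hausdorff1 X + \sum_(k <= i <oo) hausdorff1 (shell i).
  apply: (@le_trans _ _ (hausdorff1 (X `&` F) + (hausdorff1 (far k) +
      \sum_(k <= i <oo) hausdorff1 (shell i)))).
    apply: leeD => //; apply: (le_trans (le_hausdorff1 (cover k))).
    apply: (le_trans (hausdorff1U _ _)); apply: leeD => //.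
    rewrite -nneseries_addn; last by move=> ?; exact: hausdorff1_ge0.
    rewrite (_ : \bigcup_(i in _) _ = \bigcup_i shell (i + k)%N).
      exact: (outer_measure_sigma_subadditive (@hausdorff1 R T)
        (fun i => shell (i + k)%N)).
    apply/seteqP; split => [x [i /= ki si]|x [i _ si]].
      by exists (i - k)%N => //; rewrite subnK.
    by exists (i + k)%N => //=; rewrite leq_addl.
  rewrite addeA; apply: leeD => //.
  apply: (le_trans (hausdorff1_separated (_ : 0 < k.+1%:R^-1 :> R)%R _)) => //.
    move=> a b [_ Fa] [_ /= hb].
    by have := le_trans hb (dist_set_le b Fa); rewrite lee_fin metric_sym.
  by apply: le_hausdorff1 => x [[]|[]].
have tail := nneseries_tail_cvg sum_fin (fun k _ => hausdorff1_ge0 (shell k)).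
have lim : hausdorff1 X + \sum_(k <= i <oo) hausdorff1 (shell i) @[k --> \oo]
    --> hausdorff1 X.
  rewrite -[X in _ --> X]adde0; apply: cvgeD tail; last exact: cvg_cst.
  exact: fin_num_adde_defr.
rewrite -(cvg_lim _ lim)//; apply: lime_ge; first by apply/cvg_ex; eexists; exact: lim.
by apply: nearW.
Qed.

Lemma caratheodory_borel A : borel A ->
  (@hausdorff1 R T : {outer_measure set T -> \bar R}).-caratheodory A.
Proof.
move=> bA; apply: bA; split; last first.
  move=> U oU; rewrite -[U]setCK; apply: caratheodory_measurable_setC.
  exact: caratheodory_closed (open_closedC oU).
split; first exact: caratheodory_measurable_set0.
  by move=> B mB; rewrite setTD; exact: caratheodory_measurable_setC.
exact: caratheodory_measurable_bigcup.
Qed.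

End hausdorff_measure.
Section lipschitz_comparison.
Context {R : realType} {T : metricType R}.
Local Open Scope ereal_scope.

(** A cover of [U] projects under [g] to a cover of [g @` U] by intervals of
    comparable length, and finitely many translates of these cover [[a, b]].
    The factor [2] comes from replacing a set of diameter [d] by an interval of
    radius [d] around one of its points. *)
Lemma hausdorff1_ge_lipschitz (g : T -> R) (U : set T) (N : nat)
    (tau : nat -> R) (a b : R) :
  (forall x y, (`|g x - g y| <= mdist x y)%R) -> (0 < N)%N ->
  (forall s, (a <= s <= b)%R -> 
    exists2 i, (i < N)%N & exists2 u, U u & g u = (s + tau i)%R) ->
  ((b - a) / (2 * N%:R))%:E <= hausdorff1 U.
Proof.
move=> lg N0 cov; have N0' : (0 < 2 * N%:R :> R)%R by rewrite mulr_gt0// ltr0n.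
apply: le_trans (content_le_hausdorff1 _ (ltr01 : (0 < 1 :> R)%R)).
apply: le_ereal_inf_tmp => _ [F [UF dF] <-].
have fd k : (fine (diam (F k)))%:E = diam (F k).
  by rewrite fineK// ge0_fin_numE ?diam_ge0// (le_lt_trans (dF k))// ltry.
have [c hc] : {c : nat -> R & forall k x, F k x ->
    (`|g x - c k| <= fine (diam (F k)))%R}.
  apply: (@choice _ _ (fun k (c : R) => forall x, F k x ->
    (`|g x - c| <= fine (diam (F k)))%R)) => k.
  have [[x0 Fx0]|nF] := pselect (exists x, F k x).
    exists (g x0) => x Fx; apply: (le_trans (lg _ _)).
    by rewrite -lee_fin fd; exact: mdist_le_diam.
  by exists 0%R => x Fx; exfalso; apply: nF; exists x.
pose I k (i : nat) : set R :=
  [set` `[(c k - fine (diam (F k)) - tau i)%R, (c k + fine (diam (F k)) - tau i)%R]].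
pose A k : set R := \big[setU/set0]_(i < N) I k i.
have mI k i : measurable (I k i) by exact: measurable_itv.
have mA k : measurable (A k) by apply: bigsetU_measurable => i _; exact: mI.
have lI k i : lebesgue_measure (I k i) = (2 * fine (diam (F k)))%:E.
  rewrite lebesgue_measure_itv/= lte_fin; case: ltP => h.
    by rewrite -EFinD; congr EFin; ring.
  have d0 : (0 <= fine (diam (F k)))%R by rewrite fine_ge0// diam_ge0.
  by congr EFin; lra.
have lA k : lebesgue_measure (A k) <= (2 * N%:R)%:E * diam (F k).
  apply: le_trans (Boole_inequality _ _) _ => [i _|]; first exact: mI.
  rewrite (eq_bigr (fun=> (2 * fine (diam (F k)))%:E)) => [|i _]; last exact: lI.
  rewrite sumEFin -fd -EFinM lee_fin sumr_const card_ord -mulr_natr.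
  by rewrite le_eqVlt; apply/orP; left; apply/eqP; ring.
have lab : (b - a)%:E <= lebesgue_measure [set` `[a, b]].
  by rewrite lebesgue_measure_itv/= lte_fin; case: ltP => h; rewrite -?EFinD lee_fin; lra.
have sub : [set` `[a, b]] `<=` \bigcup_k A k.
  move=> s /=; rewrite in_itv/= => sab.
  have [i iN [u Uu gu]] := cov s sab.
  have [k _ Fu] := UF u Uu; exists k => //.
  rewrite /A -bigcup_mkord; exists i => //; rewrite /I /= in_itv/=.
  have := hc k u Fu; rewrite ler_norml gu => /andP[h1 h2].
  by apply/andP; split; lra.
have lsub := measure_sigma_subadditive lebesgue_measure mA (measurable_itv _) sub.
have lsum : \sum_(k <oo) lebesgue_measure (A k) <=
    \sum_(k <oo) (2 * N%:R)%:E * diam (F k).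
  by apply: lee_nneseries => [k _ _|k _]; [exact: measure_ge0|exact: lA].
have := le_trans lab (le_trans lsub lsum).
rewrite nneseriesZl; last by move=> *; exact: diam_ge0.
by rewrite muleC -lee_pdivrMr// => h; rewrite EFinM.
Qed.

(** Cut the interval into pieces whose images have diameter at most [delta]. *)
Lemma hausdorff1_lipschitz_itv (gamma : R -> T) (L a b : R) : (0 <= L)%R ->
  (forall x y, (mdist (gamma x) (gamma y) <= L * `|x - y|)%R) -> (a <= b)%R ->
  hausdorff1 (gamma @` [set` `[a, b]]) <= (L * (b - a))%:E.
Proof.
move=> L0 lip ab; apply: ge_ereal_sup => _ [d /= d0 <-].
have Lab : (0 <= L * (b - a))%R by rewrite mulr_ge0// subr_ge0.
pose n := (Num.trunc (L * (b - a) / d)).+1.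
have n0 : (0 < n%:R :> R)%R by rewrite ltr0n.
pose h := ((b - a) / n%:R)%R.
have h0 : (0 <= h)%R by rewrite divr_ge0 ?subr_ge0// ltW.
have hn : (h * n%:R = b - a)%R by rewrite /h divfK// gt_eqF.
have Lhd : (L * h <= d)%R.
  rewrite /h mulrA ler_pdivrMr// [leRHS]mulrC -ler_pdivrMr//.
  by apply/ltW; exact: truncnS_gt.
pose P k : set R := [set` `[(a + k%:R * h)%R, (a + k.+1%:R * h)%R]].
pose F k := if (k < n)%N then gamma @` P k else set0.
have dF k : diam (F k) <= if (k < n)%N then (L * h)%:E else 0.
  rewrite /F; case: ifP => _; last by rewrite diam0.
  apply: diam_le; first by rewrite mulr_ge0.
  move=> _ _ [x /= + <-] [y /= + <-]; rewrite /P/= !in_itv/= => /andP[x1 x2] /andP[y1 y2].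
  apply: (le_trans (lip x y)); rewrite ler_wpM2l// ler_norml.
  move: x1 x2 y1 y2; rewrite -natr1 mulrDl mul1r => x1 x2 y1 y2.
  by apply/andP; split; lra.
apply: (@le_trans _ _ (\sum_(k <oo) diam (F k))).
  apply: ereal_inf_lbound; exists F => //; split; last first.
    move=> k; apply: (le_trans (dF k)); case: ifP => _; rewrite lee_fin//.
    exact: ltW.
  move=> _ [x /= + <-]; rewrite in_itv/= => /andP[ax xb].
  have key m : (x <= a + m.+1%:R * h)%R -> exists2 k, (k <= m)%N & P k x.
    elim: m => [|m IH] xm.
      by exists 0%N => //; rewrite /P /= in_itv/= mul0r addr0 ax.
    have [xm'|mx] := leP x (a + m.+1%:R * h)%R.
      by have [k km Pk] := IH xm'; exists k => //; exact: leqW.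
    by exists m.+1 => //; rewrite /P /= in_itv/= xm ltW.
  have [|k kn Px] := key n.-1; first by rewrite mulrC hn; lra.
  by exists k => //; rewrite /F ltnS kn; exists x.
rewrite (nneseries_split 0 n); last by move=> k _; exact: diam_ge0.
rewrite add0n [X in _ + X]eseries0 ?adde0; last first.
  by move=> k nk _; rewrite /F ltnNge nk/= diam0.
apply: (@le_trans _ _ (\sum_(0 <= k < n) (L * h)%:E)).
  rewrite big_nat [X in _ <= X]big_nat; apply: lee_sum => k /andP[_ kn].
  by have := dF k; rewrite kn.
by rewrite sumEFin sumr_const_nat subn0 -mulr_natr -mulrA hn.
Qed.

End lipschitz_comparison.

(** * Averages with respect to Hausdorff measure *)

Section averages.
Context {R : realType}.
Local Notation H := (heisenberg R).
Implicit Types (A U : set H) (f : H -> \bar R).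
Local Open Scope ereal_scope.
Import HBNNSimple.

(** A simple function below [f] is supported in a measurable subset of [A], even
    when [A] is not measurable. *)
Lemma average_le A f (c : R) : (0 <= c)%R ->
  (forall x, A x -> 0 <= f x <= c%:E) -> hausdorff1 A < +oo ->
  0 < hausdorff1 A -> average A f <= c%:E.
Proof.
move=> c0 fc Aoo A0; rewrite /average.
suff : \int[hausdorff1_measure]_(x in A) f x <= c%:E * hausdorff1 A.
  move: (hausdorff1 A) Aoo A0 => [r| |]// _; rewrite lte_fin => r0.
  by rewrite inver gt_eqF// => h; rewrite muleC lee_pdivrMr.
rewrite ge0_integralE; last by move=> x /fc /andP[].
apply: ge_ereal_sup => _ [h /= hf <-].
pose U : set _ := h @^-1` [set~ 0%R].
have mU : measurable U by apply: measurable_funPTI; exact: measurableC.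
have UA : U `<=` A.
  move=> x /= hx; apply: contrapT => Ax; apply: hx.
  have := hf x; rewrite patchN ?notin_setE// => hx; apply/eqP.
  by rewrite eq_le fun_ge0 andbT -lee_fin.
pose g := scale_nnsfun (indic_nnsfun R mU) c0.
apply: (@le_trans _ _ (sintegral hausdorff1_measure g)).
  apply: le_sintegral => x /=; rewrite measurable_realfun.mindicE.
  have [|] := boolP (x \in U); rewrite ?inE ?notin_setE => xU.
    rewrite mulr1 -lee_fin (le_trans (hf x))// patchE mem_set; last exact: UA.
    by have /andP[] := fc x (UA _ xU).
  by rewrite mulr0; move: xU => /contrapT ->.
rewrite sintegralrM sintegral_indic//; apply: lee_pmul => //.
exact: le_hausdorff1.
Qed.

(** The constant [c] on the closed set [U] is a simple function below [f]. *)
Lemma average_ge A U f (c h u : R) : (0 <= c)%R -> (0 < h)%R -> (0 <= u)%R ->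
  (forall x, A x -> 0 <= f x) -> U `<=` A -> closed U ->
  (forall x, U x -> c%:E <= f x) -> u%:E <= hausdorff1 U ->
  0 < hausdorff1 A <= h%:E -> (c * u / h)%:E <= average A f.
Proof.
move=> c0 h0 u0 f0 UA cU cf uU /andP[A0 Ah]; rewrite /average.
have mU : measurable (U : set (caratheodory_type (@hausdorff1 R H
  : {outer_measure set H -> \bar R}))) by exact: caratheodory_closed.
suff int_ge : (c * u)%:E <= \int[hausdorff1_measure]_(x in A) f x.
  move: (hausdorff1 A) Ah A0 => [r| |]//; rewrite lee_fin lte_fin => rh r0.
  rewrite inver gt_eqF// [leRHS]muleC EFinM; apply: lee_pmul => //.
  - by rewrite lee_fin mulr_ge0.
  - by rewrite lee_fin invr_ge0 ltW.
  - by rewrite lee_fin lef_pV2 ?posrE.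
rewrite ge0_integralE//.
pose g := scale_nnsfun (indic_nnsfun R mU) c0.
apply: (@le_trans _ _ (sintegral hausdorff1_measure g)).
  rewrite sintegralrM sintegral_indic// EFinM.
  by apply: lee_pmul => //; rewrite lee_fin.
apply: ereal_sup_ubound; exists g => // x /=; rewrite measurable_realfun.mindicE.
have [|] := boolP (x \in U); rewrite ?inE ?notin_setE => xU.
  rewrite mulr1 patchE mem_set; last exact: UA.
  exact: cf.
by rewrite mulr0 erestrict_ge0.
Qed.

End averages.
(** * Glued bumps *)

Section spline.
Context {R : realType}.
Implicit Types (s t u v y : R) (gam : int -> R).

(** The third-order zeros at [0] and [1] make the function glued from multiples
    of [spline] on consecutive cells twice differentiable, whatever the
    multiples; [dspline] and [ddspline] are the derivatives. *)
Definition spline y : R := y ^+ 3 * (1 - y) ^+ 3.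
Definition dspline y : R := 3 * y ^+ 2 * (1 - y) ^+ 2 * (1 - 2 * y).
Definition ddspline y : R := 6 * y * (1 - y) * (1 - 5 * y + 5 * y ^+ 2).

Definition fpart u : R := u - (Num.floor u)%:~R.

Definition glued (P : R -> R) gam u : R := gam (Num.floor u) * P (fpart u).

Lemma fpart_itv u : 0 <= fpart u <= 1.
Proof.
have /andP[h1 /ltW] := floor_itv u; rewrite intrD => h2.
by rewrite /fpart subr_ge0 h1/= lerBlDl.
Qed.

(** Points of different cells are separated by a node, where the spline vanishes
    to third order. *)
Lemma fpart_node u v : Num.floor u != Num.floor v ->
  fpart u <= `|u - v| \/ 1 - fpart u <= `|u - v|.
Proof.
rewrite neq_lt => /orP[] h; rewrite /fpart; [right|left].
- have := ge_floor v; have : (Num.floor u + 1 <= Num.floor v) by rewrite lezD1.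
  rewrite -(ler_int R) intrD => h1 h2; rewrite ler_normr; apply/orP; right; lra.
- have := floorD1_gt v; have : (Num.floor v + 1 <= Num.floor u) by rewrite lezD1.
  rewrite -(ler_int R) => h1 h2; rewrite ler_normr; apply/orP; left; lra.
Qed.

Let mono s t : 0 <= s <= 1 -> 0 <= t <= 1 -> 0 <= s * t <= 1.
Proof.
by move=> /andP[s0 s1] /andP[t0 t1]; rewrite mulr_ge0//= mulr_ile1.
Qed.

Lemma ddspline_node y d : 0 <= y <= 1 -> y <= d \/ 1 - y <= d -> `|ddspline y| <= 6 * d.
Proof.
move=> yy; have /andP[y20 y21] := mono yy yy.
have q : `|1 - 5 * y + 5 * y ^+ 2| <= 1.
  by case/andP: yy => ? ?; rewrite ler_norml; apply/andP; split; nra.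
case/andP: yy => y0 y1; have y6 : 0 <= 6 * y * (1 - y) by rewrite !mulr_ge0//; lra.
rewrite /ddspline normrM (ger0_norm y6).
move=> h; apply: (@le_trans _ _ (6 * y * (1 - y) * 1)).
  by rewrite ler_wpM2l.
by case: h => h; nra.
Qed.

Lemma dspline_node y d : 0 <= y <= 1 -> y <= d \/ 1 - y <= d -> `|dspline y| <= 3 * d ^+ 2.
Proof.
move=> /andP[y0 y1] h; rewrite /dspline normrM.
have h1 : 0 <= 3 * y ^+ 2 * (1 - y) ^+ 2 by rewrite mulr_ge0 ?sqr_ge0// mulr_ge0 ?sqr_ge0.
rewrite (ger0_norm h1); apply: (@le_trans _ _ (3 * y ^+ 2 * (1 - y) ^+ 2 * 1)).
  by rewrite ler_wpM2l// ler_norml; apply/andP; split; lra.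
have a1 : y ^+ 2 <= 1 by rewrite expr_le1.
have a2 : (1 - y) ^+ 2 <= 1 by rewrite expr_le1//; lra.
rewrite mulr1 -mulrA ler_pM2l//; case: h => h.
  have: y ^+ 2 <= d ^+ 2 by rewrite ler_sqr ?nnegrE//; lra.
  by have := sqr_ge0 y; have := sqr_ge0 (1 - y); nra.
have: (1 - y) ^+ 2 <= d ^+ 2 by rewrite ler_sqr ?nnegrE//; lra.
by have := sqr_ge0 y; have := sqr_ge0 (1 - y); nra.
Qed.

Lemma spline_node y d : 0 <= y <= 1 -> y <= d \/ 1 - y <= d -> `|spline y| <= d ^+ 3.
Proof.
move=> /andP[y0 y1] h; have y1' : 0 <= 1 - y by lra.
rewrite /spline ger0_norm ?mulr_ge0 ?exprn_ge0//.
have a1 : y ^+ 3 <= 1 by rewrite expr_le1.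
have a2 : (1 - y) ^+ 3 <= 1 by rewrite expr_le1//; lra.
have a3 := exprn_ge0 3 y0; have a4 := exprn_ge0 3 y1'.
case: h => h.
  have: y ^+ 3 <= d ^+ 3 by rewrite lerXn2r ?nnegrE//; lra.
  by nra.
have: (1 - y) ^+ 3 <= d ^+ 3 by rewrite lerXn2r ?nnegrE//; lra.
by nra.
Qed.

Let cell_monomials s t : 0 <= s <= 1 -> 0 <= t <= 1 ->
  [/\ 0 <= s ^+ 2 <= 1, 0 <= s * t <= 1, 0 <= t ^+ 2 <= 1, 0 <= s ^+ 3 <= 1 &
  [/\ 0 <= s ^+ 2 * t <= 1, 0 <= s * t ^+ 2 <= 1 & 0 <= t ^+ 3 <= 1]].
Proof.
move=> ss tt; have s2 : 0 <= s ^+ 2 <= 1 by rewrite expr2; exact: mono.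
have t2 : 0 <= t ^+ 2 <= 1 by rewrite expr2; exact: mono.
by split; [|exact: mono| |rewrite exprS; exact: mono|split; [exact: mono..|
  rewrite exprS; exact: mono]].
Qed.

(** The quotients of these Taylor remainders by powers of [s - t] are polynomials
    in [s] and [t], bounded on the unit square by the sum of the moduli of their
    coefficients. *)
Lemma ddspline_cell s t : 0 <= s <= 1 -> 0 <= t <= 1 ->
  `|ddspline s - ddspline t| <= 400 * `|s - t|.
Proof.
move=> ss tt; have -> : ddspline s - ddspline t = (6 - 36 * (s + t) +
  60 * (s ^+ 2 + s * t + t ^+ 2) -
  30 * (s ^+ 3 + s ^+ 2 * t + s * t ^+ 2 + t ^+ 3)) * (s - t).
  by rewrite /ddspline; ring.
rewrite normrM ler_wpM2r//.
have [/andP[? ?] /andP[? ?] /andP[? ?] /andP[? ?] [/andP[? ?] /andP[? ?] /andP[? ?]]]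
  := cell_monomials ss tt.
case/andP: ss => ? ?; case/andP: tt => ? ?.
by rewrite ler_norml; apply/andP; split; lra.
Qed.

Lemma dspline_cell s t : 0 <= s <= 1 -> 0 <= t <= 1 ->
  `|dspline s - dspline t - ddspline t * (s - t)| <= 400 * `|s - t| ^+ 2.
Proof.
move=> ss tt; have -> : dspline s - dspline t - ddspline t * (s - t) =
  (3 - 12 * (s + 2 * t) + 15 * (s ^+ 2 + 2 * (s * t) + 3 * t ^+ 2) -
  6 * (s ^+ 3 + 2 * (s ^+ 2 * t) + 3 * (s * t ^+ 2) + 4 * t ^+ 3)) * (s - t) ^+ 2.
  by rewrite /dspline /ddspline; ring.
rewrite normrM normrX ler_wpM2r ?exprn_ge0//.
have [/andP[? ?] /andP[? ?] /andP[? ?] /andP[? ?] [/andP[? ?] /andP[? ?] /andP[? ?]]]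
  := cell_monomials ss tt.
case/andP: ss => ? ?; case/andP: tt => ? ?.
by rewrite ler_norml; apply/andP; split; lra.
Qed.

Lemma spline_cell s t : 0 <= s <= 1 -> 0 <= t <= 1 ->
  `|spline s - spline t - dspline t * (s - t) - 2^-1 * ddspline t * (s - t) ^+ 2|
    <= 400 * `|s - t| ^+ 3.
Proof.
move=> ss tt.
have -> : spline s - spline t - dspline t * (s - t) - 2^-1 * ddspline t * (s - t) ^+ 2 =
  (1 - 3 * (s + 3 * t) + 3 * (s ^+ 2 + 3 * (s * t) + 6 * t ^+ 2) -
  (s ^+ 3 + 3 * (s ^+ 2 * t) + 6 * (s * t ^+ 2) + 10 * t ^+ 3)) * (s - t) ^+ 3.
  by rewrite /spline /dspline /ddspline; field.
rewrite normrM normrX ler_wpM2r ?exprn_ge0//.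
have [/andP[? ?] /andP[? ?] /andP[? ?] /andP[? ?] [/andP[? ?] /andP[? ?] /andP[? ?]]]
  := cell_monomials ss tt.
case/andP: ss => ? ?; case/andP: tt => ? ?.
by rewrite ler_norml; apply/andP; split; lra.
Qed.

(** The third difference with step [1/4] is about [-84/4096] at the left end of
    the cell and stays away from [0] near it. *)
Lemma third_difference_spline y : 0 <= y <= 100^-1 ->
  spline (y + 3 / 4) - 3 * spline (y + 2 / 4) + 3 * spline (y + 1 / 4) - spline y <= - 100^-1.
Proof.
move=> /andP[y0 y1]; rewrite /spline.
have y2 : y ^+ 2 <= 100^-1 * y by rewrite expr2 ler_wpM2r.
have y20 := sqr_ge0 y.
have y3 : y ^+ 3 <= 100^-1 * y ^+ 2 by rewrite exprS ler_wpM2r.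
have y30 := exprn_ge0 3 y0.
rewrite [leLHS](_ : _ = - (21 / 1024) + 27 / 256 * y + 45 / 64 * y ^+ 2 -
  15 / 8 * y ^+ 3); last by field.
lra.
Qed.

End spline.
(** In the Taylor estimates for glued functions, points of one cell are covered
    by the polynomial case; for points of different cells each term is small
    by itself, because both points are near nodes. *)
Section glued.
Context {R : realType}.
Variables (gam : int -> R) (a : R).
Hypothesis gam_le : forall m, `|gam m| <= a.
Implicit Types (u v x y : R).

Let a0 : 0 <= a. Proof. exact: le_trans (gam_le 0). Qed.

Let glued_node (P : R -> R) (C : R) i u v : 0 <= C ->
  (forall y d, 0 <= y <= 1 -> y <= d \/ 1 - y <= d -> `|P y| <= C * d ^+ i) ->
  Num.floor u != Num.floor v -> `|glued P gam u| <= C * a * `|u - v| ^+ i.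
Proof.
move=> C0 nodeP uv; rewrite /glued normrM mulrAC mulrC ler_pM//.
exact: nodeP (fpart_itv u) (fpart_node uv).
Qed.

Let glued_le (P : R -> R) (C : R) i u : 0 <= C ->
  (forall y d, 0 <= y <= 1 -> y <= d \/ 1 - y <= d -> `|P y| <= C * d ^+ i) ->
  `|glued P gam u| <= C * a.
Proof.
move=> C0 nodeP; rewrite /glued normrM mulrC ler_pM//.
have /andP[y0 y1] := fpart_itv u.
by have := nodeP _ 1 (fpart_itv u) (or_introl y1); rewrite expr1n mulr1.
Qed.

Let node2 y d : 0 <= y <= 1 -> y <= d \/ 1 - y <= d -> `|ddspline y| <= 6 * d ^+ 1.
Proof. by rewrite expr1; exact: ddspline_node. Qed.

Let node0 y d : 0 <= y <= 1 -> y <= d \/ 1 - y <= d -> `|spline y| <= 1 * d ^+ 3.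
Proof. by rewrite mul1r; exact: spline_node. Qed.

Lemma glued_dspline_le u : `|glued dspline gam u| <= 3 * a.
Proof. by apply: (glued_le _ _ (@dspline_node R)). Qed.

Lemma glued_spline_le u : `|glued spline gam u| <= a.
Proof. by rewrite -[leRHS]mul1r; apply: (glued_le _ _ node0). Qed.

Let fpartB u v : Num.floor u = Num.floor v -> fpart u - fpart v = u - v.
Proof. by rewrite /fpart => ->; ring. Qed.

Lemma glued_ddspline_lip u v :
  `|glued ddspline gam u - glued ddspline gam v| <= 400 * a * `|u - v|.
Proof.
have [uv|uv] := eqVneq (Num.floor u) (Num.floor v).
  rewrite /glued uv -mulrBr normrM -(fpartB uv) [_ * a]mulrC -mulrA.
  by rewrite ler_pM// ddspline_cell// fpart_itv.
have := glued_node (ler0n R 6) node2 uv.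
have := glued_node (ler0n R 6) node2 (_ : Num.floor v != Num.floor u).
rewrite eq_sym => /(_ uv); rewrite distrC !expr1 => h1 h2.
apply: (le_trans (ler_normB _ _)).
by have := mulr_ge0 a0 (normr_ge0 (u - v)); move: h1 h2; lra.
Qed.

Lemma glued_dspline_taylor u v :
  `|glued dspline gam u - glued dspline gam v - glued ddspline gam v * (u - v)|
    <= 400 * a * `|u - v| ^+ 2.
Proof.
have [uv|uv] := eqVneq (Num.floor u) (Num.floor v).
  rewrite /glued uv -(fpartB uv) -[gam _ * _ * _]mulrA -!mulrBr normrM.
  by rewrite [400 * a]mulrC -[a * 400 * _]mulrA ler_pM// dspline_cell// fpart_itv.
have vu : Num.floor v != Num.floor u by rewrite eq_sym.
have h1 := glued_node (ler0n R 3) (@dspline_node R) uv.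
have h2 := glued_node (ler0n R 3) (@dspline_node R) vu.
have h3 := glued_node (ler0n R 6) node2 vu.
rewrite [`|v - u|]distrC ?expr1 in h2 h3.
have h4 : `|glued ddspline gam v * (u - v)| <= 6 * a * `|u - v| ^+ 2.
  by rewrite normrM expr2 mulrA ler_wpM2r.
apply: (le_trans (ler_normB _ _)); apply: (le_trans (lerD (ler_normB _ _) (lexx _))).
by have := mulr_ge0 a0 (sqr_ge0 `|u - v|); move: h1 h2 h4; lra.
Qed.

Lemma glued_spline_taylor u v :
  `|glued spline gam u - glued spline gam v - glued dspline gam v * (u - v)
     - 2^-1 * glued ddspline gam v * (u - v) ^+ 2| <= 400 * a * `|u - v| ^+ 3.
Proof.
have [uv|uv] := eqVneq (Num.floor u) (Num.floor v).
  rewrite /glued uv -(fpartB uv) [2^-1 * _]mulrCA -![gam _ * _ * _]mulrA -!mulrBr.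
  by rewrite normrM [400 * a]mulrC -[a * 400 * _]mulrA ler_pM// spline_cell// fpart_itv.
have vu : Num.floor v != Num.floor u by rewrite eq_sym.
have h1 := glued_node ler01 node0 uv.
have h2 := glued_node ler01 node0 vu.
have h3 := glued_node (ler0n R 3) (@dspline_node R) vu.
have h4 := glued_node (ler0n R 6) node2 vu.
rewrite [`|v - u|]distrC ?expr1 in h2 h3 h4.
have h5 : `|glued dspline gam v * (u - v)| <= 3 * a * `|u - v| ^+ 3.
  by rewrite normrM exprSr mulrA ler_wpM2r.
have h6 : `|2^-1 * glued ddspline gam v * (u - v) ^+ 2| <= 3 * a * `|u - v| ^+ 3.
  rewrite normrM normrX normrM [`|2^-1|]ger0_norm// [`|u - v| ^+ 3]exprS [leRHS]mulrA.
  rewrite ler_wpM2r ?exprn_ge0//.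
  by rewrite ler_pdivrMl//; move: h4; lra.
apply: (le_trans (ler_normB _ _)); apply: (le_trans (lerD (ler_normB _ _) (lexx _))).
apply: (le_trans (lerD (lerD (ler_normB _ _) (lexx _)) (lexx _))).
by have := mulr_ge0 a0 (exprn_ge0 3 (normr_ge0 (u - v))); move: h1 h2 h5 h6; lra.
Qed.

End glued.

(** * The oscillating series *)

Section series.
Context {R : realType}.
Variables (B : R) (c : nat -> int -> R).
Hypothesis B4 : 4 <= B.
Hypothesis c_le : forall k m, `|c k m| <= k.+1%:R^-1.
Implicit Types (x y r : R) (k n N : nat).

(** Generation [k] of the primitive, of the function and of its slope: the
    amplitudes differ by powers of the cell length [B ^ - k]. *)
Definition prim_term k x : R := glued spline (c k) (B ^+ k * x) / (B ^+ k) ^+ 2.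
Definition profile_term k x : R := glued dspline (c k) (B ^+ k * x) / B ^+ k.
Definition slope_term k x : R := glued ddspline (c k) (B ^+ k * x).

Definition slope n x : R := \sum_(0 <= k < n) slope_term k x.
Definition profile x : R := limn (series (profile_term ^~ x)).
Definition prim x : R := limn (series (prim_term ^~ x)).

Let B0 : 0 < B. Proof. by move: B4; lra. Qed.
Let Bk0 k : 0 < B ^+ k. Proof. exact: exprn_gt0. Qed.
Let a_le1 k : k.+1%:R^-1 <= 1 :> R.
Proof. by rewrite invf_le1// ler1n. Qed.

Lemma profile_term_taylor k x y :
  `|profile_term k x - profile_term k y - slope_term k y * (x - y)|
    <= 400 * k.+1%:R^-1 * B ^+ k * `|x - y| ^+ 2.
Proof.
have := glued_dspline_taylor (c_le k) (B ^+ k * x) (B ^+ k * y).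
rewrite -mulrBr normrM (gtr0_norm (Bk0 k)) exprMn => h.
rewrite (_ : _ - _ = (glued dspline (c k) (B ^+ k * x) - glued dspline (c k) (B ^+ k * y) -
  glued ddspline (c k) (B ^+ k * y) * (B ^+ k * (x - y))) / B ^+ k); last first.
  by rewrite /profile_term /slope_term; field; exact: lt0r_neq0.
rewrite normrM normfV (gtr0_norm (Bk0 k)) ler_pdivrMr//.
by apply: (le_trans h); rewrite le_eqVlt; apply/orP; left; apply/eqP; ring.
Qed.

Lemma prim_term_taylor k x y :
  `|prim_term k x - prim_term k y - profile_term k y * (x - y)
     - 2^-1 * slope_term k y * (x - y) ^+ 2|
    <= 400 * k.+1%:R^-1 * B ^+ k * `|x - y| ^+ 3.
Proof.
have := glued_spline_taylor (c_le k) (B ^+ k * x) (B ^+ k * y).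
rewrite -mulrBr normrM (gtr0_norm (Bk0 k)) !exprMn => h.
rewrite (_ : _ - _ = (glued spline (c k) (B ^+ k * x) - glued spline (c k) (B ^+ k * y) -
  glued dspline (c k) (B ^+ k * y) * (B ^+ k * (x - y)) -
  2^-1 * glued ddspline (c k) (B ^+ k * y) * ((B ^+ k) ^+ 2 * (x - y) ^+ 2))
     / (B ^+ k) ^+ 2); last first.
  by rewrite /prim_term /profile_term /slope_term; field; exact: lt0r_neq0.
rewrite normrM normfV (gtr0_norm (exprn_gt0 2 (Bk0 k))) ler_pdivrMr ?exprn_gt0//.
by apply: (le_trans h); rewrite le_eqVlt; apply/orP; left; apply/eqP; ring.
Qed.

Lemma profile_term_le k x : `|profile_term k x| <= 3 * (k.+1%:R^-1 * (B ^+ k)^-1).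
Proof.
rewrite normrM normfV (gtr0_norm (Bk0 k)) mulrA ler_wpM2r//.
  by rewrite invr_ge0 ltW.
exact: glued_dspline_le.
Qed.

Lemma prim_term_le k x : `|prim_term k x| <= k.+1%:R^-1 * (B ^+ k)^-1 ^+ 2.
Proof.
rewrite normrM normfV (gtr0_norm (exprn_gt0 2 (Bk0 k))) exprVn ler_wpM2r//.
  by rewrite invr_ge0 sqr_ge0.
exact: glued_spline_le.
Qed.

Let BV_le : B^-1 <= 2^-1.
Proof. by rewrite lef_pV2 ?posrE// (le_trans _ B4)// ler_nat. Qed.

Let geo k : (B ^+ k)^-1 <= 2^-1 ^+ k :> R.
Proof. by rewrite -exprVn lerXn2r ?nnegrE ?invr_ge0// ltW. Qed.

Lemma cvg_profile x : series (profile_term ^~ x) @ \oo --> profile x.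
Proof.
apply: normed_cvg; apply: (@series_le_cvg _ _ (geometric 3 2^-1)) => //.
- by move=> n; exact: normr_ge0.
- by move=> n; rewrite mulr_ge0// exprn_ge0.
- move=> n; rewrite /geometric/=; apply: (le_trans (profile_term_le _ _)).
  by rewrite ler_wpM2l// (le_trans _ (geo n))// ler_piMl// invr_ge0 ltW.
- by apply: is_cvg_geometric_series; rewrite ger0_norm//; lra.
Qed.

Lemma cvg_prim x : series (prim_term ^~ x) @ \oo --> prim x.
Proof.
apply: normed_cvg; apply: (@series_le_cvg _ _ (geometric 3 2^-1)) => //.
- by move=> n; exact: normr_ge0.
- by move=> n; rewrite mulr_ge0// exprn_ge0.
- move=> n; rewrite /geometric/=; apply: (le_trans (prim_term_le _ _)).
  have gn := geo n; have gn0 : 0 <= (B ^+ n)^-1 by rewrite invr_ge0 ltW.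
  have g1 : (B ^+ n)^-1 <= 1.
    by rewrite (le_trans gn)// exprn_ile1//; lra.
  apply: (@le_trans _ _ (1 * (B ^+ n)^-1)); first by rewrite ler_pM// ?sqr_ge0// expr2 ler_piMl.
  by rewrite mul1r (le_trans gn)// ler_peMl ?exprn_ge0// ler1n.
- by apply: is_cvg_geometric_series; rewrite ger0_norm//; lra.
Qed.

(** The geometric growth makes the last term dominate. *)
Lemma sum_head n : \sum_(0 <= k < n) k.+1%:R^-1 * B ^+ k <= 4 * n.+1%:R^-1 * B ^+ n / B.
Proof.
elim: n => [|n IH]; first by rewrite big_geq// !mulr_ge0// ?invr_ge0// ltW.
rewrite big_nat_recr//=; apply: (le_trans (lerD IH (lexx _))).
have a2 : n.+1%:R^-1 <= 2 * n.+2%:R^-1 :> R.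
  rewrite ler_pdivlMr// mulrC ler_pdivrMr// -natrM ler_nat.
  by rewrite mul2n -addnn addSnnS leq_addl.
have -> : 4 * n.+2%:R^-1 * B ^+ n.+1 / B = 4 * n.+2%:R^-1 * B ^+ n.
  by rewrite exprSr mulrA mulfK// gt_eqF.
have -> : 4 * n.+1%:R^-1 * B ^+ n / B + n.+1%:R^-1 * B ^+ n =
  (n.+1%:R^-1 * B ^+ n) * (4 / B + 1) by ring.
apply: (@le_trans _ _ (2 * n.+2%:R^-1 * B ^+ n * 2)); last first.
  by rewrite le_eqVlt; apply/orP; left; apply/eqP; ring.
apply: ler_pM.
- by rewrite mulr_ge0// ltW.
- by rewrite addr_ge0// divr_ge0// ltW.
- by rewrite ler_wpM2r// ltW.
- have : 4 / B <= 1 by rewrite ler_pdivrMr// mul1r.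
  lra.
Qed.

Let sum_geo (q : R) M : 0 <= q <= 2^-1 -> \sum_(0 <= i < M) q ^+ i <= 2.
Proof.
move=> /andP[q0 q2]; suff : \sum_(0 <= i < M) q ^+ i + 2 * q ^+ M <= 2.
  by have := exprn_ge0 M q0; lra.
elim: M => [|M IH]; first by rewrite big_geq// expr0; lra.
rewrite big_nat_recr//= exprS.
by have := exprn_ge0 M q0; move: IH; nra.
Qed.

(** The geometric decay makes the first term dominate. *)
Lemma sum_tail (q : R) n N : 0 <= q <= 2^-1 ->
  \sum_(n <= k < N) k.+1%:R^-1 * q ^+ k <= 2 * (n.+1%:R^-1 * q ^+ n).
Proof.
move=> q2; have q0 : 0 <= q by case/andP: q2.
rewrite -{1}(add0n n) big_addn.
apply: (@le_trans _ _ (\sum_(0 <= i < N - n) n.+1%:R^-1 * q ^+ n * q ^+ i)).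
  apply: ler_sum => i _; rewrite addnC exprD mulrA ler_wpM2r ?exprn_ge0//.
  rewrite ler_wpM2r ?exprn_ge0// lef_pV2 ?posrE//.
  by rewrite ler_nat ltnS leq_addr.
rewrite -mulr_sumr mulrC ler_wpM2r ?mulr_ge0 ?exprn_ge0//.
exact: sum_geo.
Qed.

End series.
Section norm_lim.
Context {R : realType}.

Lemma norm_lim_le (u : nat -> R) (l M : R) n : u @ \oo --> l ->
  (forall N, (n <= N)%N -> `|u N| <= M) -> `|l| <= M.
Proof.
move=> ul uM; have nul : `|u N| @[N --> \oo] --> `|l| by exact: cvg_norm.
rewrite -(cvg_lim _ nul)//; apply: limr_le; first by apply/cvg_ex; eexists; exact: nul.
by exists n.
Qed.

End norm_lim.

Section series_estimates.
Context {R : realType}.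
Variables (B : R) (c : nat -> int -> R).
Hypothesis B4 : 4 <= B.
Hypothesis c_le : forall k m, `|c k m| <= k.+1%:R^-1.
Implicit Types (x y r : R) (k n N : nat).

Local Notation profile := (profile B c).
Local Notation prim := (prim B c).
Local Notation slope := (slope B c).
Local Notation profile_term := (profile_term B c).
Local Notation prim_term := (prim_term B c).
Local Notation slope_term := (slope_term B c).
Local Notation head n := (\sum_(0 <= k < n) k.+1%:R^-1 * B ^+ k).

Let B0 : 0 < B. Proof. by move: B4; lra. Qed.
Let Bk0 k : 0 < B ^+ k. Proof. exact: exprn_gt0. Qed.
Let BVk0 k : 0 <= (B ^+ k)^-1. Proof. by rewrite invr_ge0 ltW. Qed.

Let BV_itv : 0 <= B^-1 <= 2^-1.
Proof.
by rewrite invr_ge0 ltW//= lef_pV2 ?posrE// (le_trans _ B4)// ler_nat.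
Qed.

Let BV2_itv : 0 <= B^-1 ^+ 2 <= 2^-1.
Proof.
have /andP[h1 h2] := BV_itv; rewrite sqr_ge0/=.
by rewrite expr2; nra.
Qed.

Let sqrV k : (B^-1 ^+ 2) ^+ k = (B ^+ k)^-1 ^+ 2.
Proof. by rewrite -exprM mulnC exprM; congr (_ ^+ 2); rewrite exprVn. Qed.

(** The generations below [n] are Taylor expanded, the others are bounded. *)
Lemma profile_taylor n x y :
  `|profile x - profile y - slope n y * (x - y)| <=
    400 * head n * `|x - y| ^+ 2 + 12 * (n.+1%:R^-1 * (B ^+ n)^-1).
Proof.
apply: (@norm_lim_le _ (fun N => series (profile_term ^~ x) N - series (profile_term ^~ y) N
   - slope n y * (x - y)) _ _ n) => [|N nN].
  by apply: cvgB; [apply: cvgB; exact: cvg_profile|exact: cvg_cst].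
rewrite /series/= !(big_cat_nat (leq0n n) nN)/= /slope mulr_suml.
rewrite (_ : _ - _ = \sum_(0 <= k < n)
    (profile_term k x - profile_term k y - slope_term k y * (x - y)) +
  \sum_(n <= k < N) (profile_term k x - profile_term k y)); last by rewrite !sumrB; ring.
apply: (le_trans (ler_normD _ _)); apply: lerD.
  apply: (le_trans (ler_norm_sum _ _ _)); rewrite mulr_sumr mulr_suml.
  apply: ler_sum => k _; rewrite [400 * _]mulrA; exact: profile_term_taylor.
apply: (le_trans (ler_norm_sum _ _ _)).
apply: (@le_trans _ _ (6 * \sum_(n <= k < N) k.+1%:R^-1 * B^-1 ^+ k)).
  rewrite mulr_sumr; apply: ler_sum => k _; apply: (le_trans (ler_normB _ _)).
  have := profile_term_le B4 c_le k x; have := profile_term_le B4 c_le k y.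
  by rewrite exprVn; move: (_ / _) => e; lra.
have := sum_tail n N BV_itv; rewrite exprVn.
by move: (\sum_(_ <= _ < _) _) (_ / _) => s e; lra.
Qed.

(** The first-order coefficient is the full series [profile y], so the tail of
    that series appears as an error of its own. *)
Lemma prim_taylor n x y :
  `|prim x - prim y - profile y * (x - y) - 2^-1 * slope n y * (x - y) ^+ 2| <=
    400 * head n * `|x - y| ^+ 3 + 4 * (n.+1%:R^-1 * (B ^+ n)^-1 ^+ 2)
    + 6 * (n.+1%:R^-1 * (B ^+ n)^-1) * `|x - y|.
Proof.
apply: (@norm_lim_le _ (fun N => series (prim_term ^~ x) N - series (prim_term ^~ y) N
   - series (profile_term ^~ y) N * (x - y) - 2^-1 * slope n y * (x - y) ^+ 2) _ _ n) => [|N nN].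
  apply: cvgB; [apply: cvgB; [apply: cvgB; exact: cvg_prim|]|exact: cvg_cst].
  by apply: cvgMl; exact: cvg_profile.
rewrite /series/= !(big_cat_nat (leq0n n) nN)/= /slope.
rewrite (_ : _ - _ = \sum_(0 <= k < n)
    (prim_term k x - prim_term k y - profile_term k y * (x - y)
     - 2^-1 * slope_term k y * (x - y) ^+ 2) +
  \sum_(n <= k < N) (prim_term k x - prim_term k y) -
  (\sum_(n <= k < N) profile_term k y) * (x - y)); last first.
  by rewrite !sumrB -!mulr_suml -!mulr_sumr; ring.
apply: (le_trans (ler_normB _ _)); apply: lerD.
  apply: (le_trans (ler_normD _ _)); apply: lerD.
    apply: (le_trans (ler_norm_sum _ _ _)); rewrite mulr_sumr mulr_suml.
    apply: ler_sum => k _; rewrite [400 * _]mulrA; exact: prim_term_taylor.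
  apply: (le_trans (ler_norm_sum _ _ _)).
  apply: (@le_trans _ _ (2 * \sum_(n <= k < N) k.+1%:R^-1 * (B^-1 ^+ 2) ^+ k)).
    rewrite mulr_sumr; apply: ler_sum => k _; apply: (le_trans (ler_normB _ _)).
    have := prim_term_le B4 c_le k x; have := prim_term_le B4 c_le k y.
    by rewrite sqrV; move: (k.+1%:R^-1 * _ ^+ 2) => e; lra.
  have := sum_tail n N BV2_itv; rewrite sqrV.
  by move: (\sum_(_ <= _ < _) _) (n.+1%:R^-1 * _ ^+ 2) => s e; lra.
rewrite normrM ler_wpM2r//; apply: (le_trans (ler_norm_sum _ _ _)).
apply: (@le_trans _ _ (3 * \sum_(n <= k < N) k.+1%:R^-1 * B^-1 ^+ k)).
  rewrite mulr_sumr; apply: ler_sum => k _.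
  by have := profile_term_le B4 c_le k y; rewrite exprVn.
have := sum_tail n N BV_itv; rewrite exprVn.
by move: (\sum_(_ <= _ < _) _) (_ / _) => s e; lra.
Qed.

End series_estimates.

Section modulus.
Context {R : realType}.

(** The logarithm expresses the rate [1 / (n + 1)] at the scale [B ^ - n] without
    reference to the base. The primitive [G] is known only through the second
    estimate, which takes the place of [G' = f]. *)
Definition tangent_modulus (f G : R -> R) (K : R) := forall x0 r : R, 0 < r ->
  exists2 sigma : R, `|sigma| <= K & forall x, `|x - x0| <= r ->
    `|f x - f x0 - sigma * (x - x0)| <= K * r / (1 + `|ln r|) /\
    `|G x - G x0 - f x0 * (x - x0) - 2^-1 * sigma * (x - x0) ^+ 2|
      <= K * r ^+ 2 / (1 + `|ln r|).

Variables (B : R) (c : nat -> int -> R).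
Hypothesis B4 : 4 <= B.
Hypothesis c_le : forall k m, `|c k m| <= k.+1%:R^-1.
Hypothesis slope_le : forall n x, `|slope B c n x| <= 3.

Let B0 : 0 < B. Proof. by move: B4; lra. Qed.
Let Bk0 k : 0 < B ^+ k. Proof. exact: exprn_gt0. Qed.
Let BVk0 k : 0 <= (B ^+ k)^-1. Proof. by rewrite invr_ge0 ltW. Qed.

Let scale_exists (r : R) : 0 < r <= 1 ->
  exists n, r <= (B ^+ n)^-1 /\ (B ^+ n)^-1 <= B * r.
Proof.
move=> /andP[r0 r1].
have ex : exists n, (B ^+ n.+1)^-1 < r.
  exists (Num.truncn r^-1); rewrite invf_plt ?posrE//.
  apply: lt_le_trans (truncnS_gt _) _; apply: (@le_trans _ _ (2 ^+ (Num.truncn r^-1).+1)).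
    by rewrite -natrX ler_nat ltnW// ltn_expl.
  by rewrite lerXn2r ?nnegrE//; move: B4; lra.
exists (ex_minn ex); case: ex_minnP => n nr nmin; split.
  case: n nmin {nr} => [|n] nmin; first by rewrite expr0 invr1.
  by rewrite leNgt; apply/negP => /nmin; rewrite ltnn.
by move/ltW: nr; rewrite exprS invfM ler_pdivrMl.
Qed.

(** At scale [r <= 1] the slope is that of the partial sum up to the generation
    [n] with [B ^ - n] comparable to [r]. The factor [B ^ 2] pays for replacing
    [(B ^ - n) ^ 2] by [r ^ 2], and [1 + ln B] for replacing [n + 1] by
    [1 + |ln r|]. *)
Lemma profile_tangent_modulus :
  tangent_modulus (profile B c) (prim B c) (200 * B ^+ 2 * (1 + ln B)).
Proof.
move=> x0 r r0.
have B1 : 1 <= B by apply: le_trans B4; rewrite ler1n.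
have lB0 : 0 <= ln B by rewrite ln_ge0.
have B2 : 16 <= B ^+ 2 by move: B4; nra.
have BB : B <= B ^+ 2 by rewrite expr2 ler_peMl// ltW.
set L := 1 + ln B; have L1 : 1 <= L by rewrite /L; lra.
set M := 1 + `|ln r|.
have M1 : 1 <= M by rewrite /M; have := normr_ge0 (ln r); lra.
have M0 : 0 < M by lra.
have big (u : R) : u <= 200 * B ^+ 2 -> 0 <= u -> u <= 200 * B ^+ 2 * L.
  by move=> u1 u0; rewrite (le_trans u1)// ler_peMr//; lra.
have [r1|r1] := leP r 1; last first.
  (* All terms are bounded at large scales, and the slope [0] will do. *)
  exists (slope B c 0 x0) => [|x xr].
    by rewrite (le_trans (slope_le _ _))// big//; lra.
  have h1 := profile_taylor B4 c_le 0 x x0; have h2 := prim_taylor B4 c_le 0 x x0.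
  rewrite big_geq// mulr0 !mul0r !expr0 !invr1 !mulr1 ?expr1n add0r in h1 h2.
  have Mr : M <= r.
    rewrite /M ger0_norm; last by rewrite ln_ge0// ltW.
    by have := @le_ln1Dx R (r - 1); rewrite addrCA subrr addr0; lra.
  have K12 : 12 <= 200 * B ^+ 2 * L by apply: big; lra.
  have K0 : 0 <= 200 * B ^+ 2 * L by lra.
  split; rewrite ler_pdivlMr//.
    apply: (le_trans (ler_wpM2r (ltW M0) h1)).
    by apply: ler_pM => //; lra.
  apply: (le_trans (ler_wpM2r (ltW M0) h2)).
  apply: (@le_trans _ _ (12 * r * r)); first by apply: ler_pM => //; lra.
  by rewrite -mulrA -[r * r]expr2 ler_wpM2r// sqr_ge0.
have r01 : 0 < r <= 1 by rewrite r0.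
have [n [rn nr]] := scale_exists r01.
exists (slope B c n x0) => [|x xr].
  by rewrite (le_trans (slope_le _ _))// big//; lra.
have an : n.+1%:R^-1 <= L / M.
  rewrite ler_pdivlMr// mulrC ler_pdivrMr//.
  have : ln r^-1 <= ln B * n.+1%:R.
    rewrite mulr_natr -lnXn// ler_ln ?posrE ?invr_gt0// invf_ple ?posrE//.
    by rewrite exprS invfM ler_pdivrMl.
  rewrite /M ler0_norm ?ln_le0// lnV ?posrE//.
  have : 1 <= n.+1%:R :> R by rewrite ler1n.
  by rewrite /L; lra.
have Xr : B ^+ n * r <= 1 by rewrite -ler_pdivlMl// mulr1.
have hd : (\sum_(0 <= k < n) k.+1%:R^-1 * B ^+ k) <= n.+1%:R^-1 * B ^+ n.
  apply: (le_trans (sum_head B4 n)); rewrite ler_pdivrMr// -mulrA mulrC ler_wpM2l//.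
  by rewrite mulr_ge0// ltW.
have hd0 : 0 <= \sum_(0 <= k < n) k.+1%:R^-1 * B ^+ k.
  by rewrite sumr_ge0// => k _; rewrite mulr_ge0// ltW.
have al0 : 0 <= n.+1%:R^-1 :> R by [].
have h1 := profile_taylor B4 c_le n x x0; have h2 := prim_taylor B4 c_le n x x0.
have d0 := normr_ge0 (x - x0).
have Y0 := BVk0 n; have X0 := ltW (Bk0 n).
move: (\sum_(_ <= k < _) _) hd hd0 h1 h2 => S hd hd0 h1 h2.
move: (n.+1%:R^-1) al0 an hd h1 h2 => al al0 an hd h1 h2.
set d := `|x - x0| in xr d0 h1 h2 *.
move: (B ^+ n)^-1 Y0 nr h1 h2 {rn} => Y Y0 nr h1 h2.
move: (B ^+ n) X0 Xr hd => X X0 Xr hd.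
have Sr : S * r <= al.
  apply: (le_trans (ler_wpM2r (ltW r0) hd)).
  by rewrite -mulrA -[leRHS]mulr1 ler_wpM2l.
have d2 : d ^+ 2 <= r ^+ 2 by rewrite lerXn2r ?nnegrE// ltW.
have d3 : d ^+ 3 <= r ^+ 3 by rewrite lerXn2r ?nnegrE// ltW.
have key (e : R) : 0 <= e -> 200 * B ^+ 2 * (al * e) <= 200 * B ^+ 2 * L * e / M.
  move=> e0; rewrite (_ : _ / M = 200 * B ^+ 2 * (L / M * e)); last by ring.
  by apply: ler_wpM2l; [lra|exact: ler_wpM2r].
have aY : al * Y <= al * (B * r) by rewrite ler_wpM2l.
have are : 0 <= al * r by rewrite mulr_ge0// ltW.
have ar2 : 0 <= al * r ^+ 2 by rewrite mulr_ge0// sqr_ge0.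
split.
  apply: (le_trans h1); apply: le_trans (key r (ltW r0)).
  have s1 : S * d ^+ 2 <= al * r.
    apply: (le_trans (ler_wpM2l hd0 d2)).
    by rewrite expr2 mulrA ler_wpM2r// ltW.
  have s2 : 16 * (al * r) <= B ^+ 2 * (al * r) by rewrite ler_wpM2r.
  have s3 : B * (al * r) <= B ^+ 2 * (al * r) by rewrite ler_wpM2r.
  have -> : 200 * B ^+ 2 * (al * r) = 200 * (B ^+ 2 * (al * r)) by ring.
  move: aY s1 s2 s3; have -> : al * (B * r) = B * (al * r) by ring.
  by lra.
apply: (le_trans h2); apply: le_trans (key (r ^+ 2) (sqr_ge0 _)).
have s1 : S * d ^+ 3 <= al * r ^+ 2.
  apply: (le_trans (ler_wpM2l hd0 d3)).
  by rewrite exprS mulrA ler_wpM2r// sqr_ge0.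
have s2 : 16 * (al * r ^+ 2) <= B ^+ 2 * (al * r ^+ 2) by rewrite ler_wpM2r.
have s3 : B * (al * r ^+ 2) <= B ^+ 2 * (al * r ^+ 2) by rewrite ler_wpM2r.
have s4 : al * Y ^+ 2 <= B ^+ 2 * (al * r ^+ 2).
  rewrite [leRHS]mulrCA ler_wpM2l// -exprMn lerXn2r ?nnegrE//.
  by rewrite mulr_ge0// ltW.
have s5 : al * Y * d <= B * (al * r ^+ 2).
  apply: (le_trans (ler_pM _ d0 aY xr)); first exact: mulr_ge0.
  by rewrite le_eqVlt; apply/orP; left; apply/eqP; ring.
have -> : 200 * B ^+ 2 * (al * r ^+ 2) = 200 * (B ^+ 2 * (al * r ^+ 2)) by ring.
by move: s1 s2 s3 s4 s5; lra.
Qed.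

End modulus.
(** * Third differences of the primitive *)

Section third_difference.
Context {R : realType}.

(** A difference operator of order three, so that quadratic polynomials are in
    its kernel. *)
Definition third (F : R -> R) (x h : R) : R :=
  F (x + 3 * h) - 3 * F (x + 2 * h) + 3 * F (x + h) - F x.

Variables (B : R) (c : nat -> int -> R).
Hypothesis B4 : 4 <= B.
Hypothesis c_le : forall k m, `|c k m| <= k.+1%:R^-1.

Let B0 : 0 < B. Proof. by move: B4; lra. Qed.
Let Bk0 k : 0 < B ^+ k. Proof. exact: exprn_gt0. Qed.

(** Only the cubic Taylor remainders at the steps [h], [2 h] and [3 h] survive;
    [54 = 3 + 3 * 2 ^ 3 + 3 ^ 3]. *)
Lemma third_prim_term_low k x h : 0 <= h ->
  `|third (prim_term B c k) x h| <= 54 * (400 * (k.+1%:R^-1 * B ^+ k)) * h ^+ 3.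
Proof.
move=> h0.
have taylor (j : R) : 0 <= j ->
    `|prim_term B c k (x + j * h) - prim_term B c k x - profile_term B c k x * (j * h)
     - 2^-1 * slope_term B c k x * (j * h) ^+ 2|
    <= 400 * (k.+1%:R^-1 * B ^+ k) * h ^+ 3 * j ^+ 3.
  move=> j0; have := prim_term_taylor B4 c_le k (x + j * h) x.
  have -> : x + j * h - x = j * h by ring.
  rewrite [`|j * h|]ger0_norm ?mulr_ge0// => /le_trans; apply.
  by rewrite le_eqVlt; apply/orP; left; apply/eqP; ring.
have := taylor 3 (ler0n _ 3); have := taylor 2 (ler0n _ 2); have := taylor 1 ler01.
rewrite /third mul1r; set F := prim_term B c k; set M := k.+1%:R^-1 * B ^+ k.
move: (F (x + h)) (F (x + 2 * h)) (F (x + 3 * h)) (F x) => F1 F2 F3 F0.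
move: (profile_term B c k x) (slope_term B c k x) => g s.
rewrite -[54 * _ * _]mulrA.
move: (400 * M * h ^+ 3) => e; rewrite !ler_norml => /andP[h1 h2] /andP[h3 h4] /andP[h5 h6].
by apply/andP; split; lra.
Qed.

Lemma third_prim_term_high k x h :
  `|third (prim_term B c k) x h| <= 8 * (k.+1%:R^-1 * (B ^+ k)^-1 ^+ 2).
Proof.
rewrite /third; have e y := prim_term_le B4 c_le k y.
move: (e (x + 3 * h)) (e (x + 2 * h)) (e (x + h)) (e x).
move: (k.+1%:R^-1 * _ ^+ 2) (prim_term B c k (x + 3 * h)) (prim_term B c k (x + 2 * h))
  (prim_term B c k (x + h)) (prim_term B c k x) => e0 F1 F2 F3 F4.
rewrite !ler_norml => /andP[? ?] /andP[? ?] /andP[? ?] /andP[? ?].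
by apply/andP; split; lra.
Qed.

(** The four points stay inside the cell of index [m], so the third difference is
    that of a multiple of [spline]. *)
Lemma third_prim_term_main n (m : int) s : 0 <= s <= 100^-1 ->
  `|c n m| / 100 * (B ^+ n)^-1 ^+ 2 <=
  `|third (prim_term B c n) ((m%:~R + s) / B ^+ n) ((B ^+ n)^-1 / 4)|.
Proof.
move=> s01; have /andP[s0 s1] := s01; have Bn := lt0r_neq0 (Bk0 n).
have val (j : R) : 0 <= j <= 3 / 4 ->
    prim_term B c n ((m%:~R + s) / B ^+ n + (B ^+ n)^-1 * j) =
    c n m * spline (s + j) * (B ^+ n)^-1 ^+ 2.
  move=> /andP[j0 j1]; rewrite /prim_term /glued -[((B ^+ n) ^+ 2)^-1]exprVn; congr (_ * _).
  rewrite (_ : B ^+ n * _ = m%:~R + (s + j)); last by field.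
  have fl : Num.floor (m%:~R + (s + j)) = m.
    apply: floor_def; rewrite intrD; apply/andP; split; first by rewrite lerDl; lra.
    by rewrite ltrD2l; lra.
  by rewrite /fpart fl addrAC subrr add0r.
have -> : third (prim_term B c n) ((m%:~R + s) / B ^+ n) ((B ^+ n)^-1 / 4) =
  c n m * (B ^+ n)^-1 ^+ 2 *
  (spline (s + 3 / 4) - 3 * spline (s + 2 / 4) + 3 * spline (s + 1 / 4) - spline s).
  rewrite /third.
  have -> : 3 * ((B ^+ n)^-1 / 4) = (B ^+ n)^-1 * (3 / 4) by ring.
  have -> : 2 * ((B ^+ n)^-1 / 4) = (B ^+ n)^-1 * (2 / 4) by ring.
  have -> : (B ^+ n)^-1 / 4 = (B ^+ n)^-1 * (1 / 4) by ring.
  have v0 := val 0; rewrite mulr0 !addr0 in v0.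
  by rewrite !val ?v0; [ring|lra..].
have third_spl := third_difference_spline s01.
rewrite normrM normrM (ger0_norm (sqr_ge0 _)) mulrAC.
apply: ler_wpM2l; first by rewrite mulr_ge0 ?sqr_ge0.
by rewrite ler_normr; apply/orP; right; lra.
Qed.

(** The lower generations are smooth and the higher ones are small; both lose a
    factor [B] against generation [n]. *)
Lemma third_prim_ge n (m : int) s : 0 <= s <= 100^-1 ->
  (`|c n m| / 100 - 14 * 100 * n.+1%:R^-1 / B) * (B ^+ n)^-1 ^+ 2 <=
  `|third (prim B c) ((m%:~R + s) / B ^+ n) ((B ^+ n)^-1 / 4)|.
Proof.
move=> s01; have main := third_prim_term_main n m s01.
set x := (m%:~R + s) / B ^+ n in main *; set h := (B ^+ n)^-1 / 4 in main *.
suff err : `|third (prim B c) x h - third (prim_term B c n) x h|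
    <= 14 * 100 * n.+1%:R^-1 / B * (B ^+ n)^-1 ^+ 2.
  rewrite mulrBl lerBlDr (le_trans main)// -lerBlDl (le_trans _ err)//.
  by rewrite [leRHS]distrC lerB_dist.
pose u N := third (fun y => series (prim_term B c ^~ y) N) x h - third (prim_term B c n) x h.
apply: (@norm_lim_le _ u _ _ n.+1) => [|N nN].
  have cv y : series (prim_term B c ^~ y) N @[N --> \oo] --> prim B c y.
    exact: cvg_prim.
  apply: cvgB; last exact: cvg_cst.
  apply: cvgB => //; apply: cvgD; first apply: cvgB => //.
    by apply: cvgMr.
  by apply: cvgMr.
have -> : u N = \sum_(0 <= k < n) third (prim_term B c k) x h +
    \sum_(n.+1 <= k < N) third (prim_term B c k) x h.
  rewrite /u /third /series/= !(big_cat_nat (leq0n n.+1) nN)/= !big_nat_recr//=.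
  by rewrite !(sumrB, big_split)/= -!mulr_sumr; ring.
have al0 : 0 <= n.+1%:R^-1 :> R by [].
have hn : h ^+ 3 = 64^-1 * (B ^+ n)^-1 ^+ 3 by rewrite /h; field; exact: lt0r_neq0.
have h0 : 0 <= h by rewrite divr_ge0// invr_ge0 ltW.
have low : `|\sum_(0 <= k < n) third (prim_term B c k) x h| <=
    25 * 54 * n.+1%:R^-1 / B * (B ^+ n)^-1 ^+ 2.
  apply: (le_trans (ler_norm_sum _ _ _)).
  apply: (le_trans (ler_sum _ (fun k _ => third_prim_term_low k x h0))).
  rewrite -mulr_suml -!mulr_sumr.
  apply: (@le_trans _ _ (54 * (400 * (4 * n.+1%:R^-1 * B ^+ n / B)) * h ^+ 3)).
    apply: ler_wpM2r; first exact: exprn_ge0.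
    do 2![apply: ler_wpM2l; first exact: ler0n].
    exact: sum_head.
  rewrite le_eqVlt; apply/orP; left; apply/eqP; rewrite hn.
  move: (n.+1%:R^-1) => al; field; apply/andP; split; exact: lt0r_neq0.
have high : `|\sum_(n.+1 <= k < N) third (prim_term B c k) x h| <=
    16 * n.+1%:R^-1 / B * (B ^+ n)^-1 ^+ 2.
  apply: (le_trans (ler_norm_sum _ _ _)).
  apply: (le_trans (ler_sum _ (fun k _ => third_prim_term_high k x h))).
  have BV : 0 <= B^-1 <= 4^-1.
    by rewrite invr_ge0 ltW//= lef_pV2 ?posrE.
  have BV2 : 0 <= B^-1 ^+ 2 <= 2^-1 by move: BV => /andP[? ?]; apply/andP; split; nra.
  have := sum_tail n.+1 N BV2.
  have pw k : B^-1 ^+ 2 ^+ k = (B ^+ k)^-1 ^+ 2.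
    by rewrite -exprM mulnC exprM; congr (_ ^+ 2); rewrite exprVn.
  under eq_bigr do rewrite pw.
  rewrite -mulr_sumr pw => tail.
  apply: (le_trans (ler_wpM2l (_ : 0 <= 8) tail)) => //.
  have al2 : n.+2%:R^-1 <= n.+1%:R^-1 :> R by rewrite lef_pV2 ?posrE// ler_nat.
  rewrite [B ^+ n.+1]exprS invfM exprMn.
  have h1 : B^-1 ^+ 2 <= B^-1 by move: BV => /andP[? ?]; rewrite expr2 ler_piMl//; lra.
  apply: (@le_trans _ _ (8 * (2 * (n.+1%:R^-1 * (B^-1 * (B ^+ n)^-1 ^+ 2))))).
    do 2![apply: ler_wpM2l; first exact: ler0n].
    apply: ler_pM => //; first by rewrite mulr_ge0 ?sqr_ge0.
    by apply: ler_wpM2r; first exact: sqr_ge0.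
  by rewrite le_eqVlt; apply/orP; left; apply/eqP; ring.
have e0 : 0 <= n.+1%:R^-1 / B * (B ^+ n)^-1 ^+ 2.
  by rewrite mulr_ge0 ?sqr_ge0// mulr_ge0// invr_ge0 ltW.
apply: (le_trans (ler_normD _ _)); apply: (le_trans (lerD low high)).
by move: e0; rewrite -!mulrA; move: (n.+1%:R^-1 * _) => e; lra.
Qed.

End third_difference.
(** * Coefficients from an imaginary Riesz product *)

Section riesz.
Context {R : realType}.
Variable B : R.
Hypothesis B_large : 10 ^+ 8 <= B.
Implicit Types (x y : R) (k n : nat) (m : int).

(** The left end of the cell of generation [n] that contains [x]. *)
Definition node n x : R := (Num.floor (B ^+ n * x))%:~R / B ^+ n.

(** Real and imaginary part of the product of the [1 + i * w_k] for [k < n], where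
    [w_k] repeats [ddspline / (64 * (k + 1))] on each cell, except that the increment at [x] uses the value of the previous product at
    the node of the cell, so that it is a multiple of [ddspline] there. *)
Fixpoint riesz n x : R * R :=
  if n is k.+1 then
    let z := riesz k x in
    let z0 := riesz k (node k x) in
    let w := ddspline (fpart (B ^+ k * x)) / (64 * k.+1%:R) in
    (z.1 - z0.2 * w, z.2 + z0.1 * w)
  else (1, 0).

Definition coef1 n m : R := - (riesz n (m%:~R / B ^+ n)).2 / (64 * n.+1%:R).
Definition coef2 n m : R := (riesz n (m%:~R / B ^+ n)).1 / (64 * n.+1%:R).

Let B_ge : 400 * 4 * 100 <= B.
Proof.
apply: le_trans B_large; rewrite (_ : 10 ^+ 8 = 10 ^+ 4 * 10 ^+ 4); last by rewrite -exprD.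
lra.
Qed.

Let B4 : 4 <= B.
Proof.
by move: B_ge; lra.
Qed.

Let B0 : 0 < B. Proof. by move: B4; lra. Qed.
Let Bk0 k : 0 < B ^+ k. Proof. exact: exprn_gt0. Qed.

Lemma riesz1E n x : (riesz n x).1 = 1 + slope B coef1 n x.
Proof.
elim: n => [|n IH]; first by rewrite /slope big_geq// addr0.
rewrite /slope big_nat_recr//= addrA -/(slope B coef1 n x) -IH.
by rewrite /slope_term /glued /coef1 -/(node n x); congr (_ + _); ring.
Qed.

Lemma riesz2E n x : (riesz n x).2 = slope B coef2 n x.
Proof.
elim: n => [|n IH]; first by rewrite /slope big_geq.
rewrite /slope big_nat_recr//= -/(slope B coef2 n x) -IH.
by rewrite /slope_term /glued /coef2 -/(node n x); congr (_ + _); ring.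
Qed.

Let norm2 (z : R * R) : R := z.1 ^+ 2 + z.2 ^+ 2.

Let coord_le (z : R * R) : norm2 z <= 3 / 2 -> `|z.1| <= 5 / 4 /\ `|z.2| <= 5 / 4.
Proof.
rewrite /norm2 => h; have h1 := sqr_ge0 z.1; have h2 := sqr_ge0 z.2.
by split; rewrite ler_norml; apply/andP; split; nra.
Qed.

Let coef_le n : (forall x, norm2 (riesz n x) <= 3 / 2) ->
  (forall m, `|coef1 n m| <= n.+1%:R^-1) /\ (forall m, `|coef2 n m| <= n.+1%:R^-1).
Proof.
have key (z : R) : `|z| <= 5 / 4 -> `|z / (64 * n.+1%:R)| <= n.+1%:R^-1.
  move=> hz; rewrite invfM mulrA normrM [`|_^-1|]ger0_norm// ler_piMl//.
  by rewrite normrM [`|64^-1|]ger0_norm// ler_pdivrMr//; lra.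
move=> h; split=> m; have [h1 h2] := coord_le (h (m%:~R / B ^+ n)).
  by rewrite /coef1 key// normrN.
by rewrite key.
Qed.

(** The modulus changes only by second-order terms: the increment is orthogonal
    to the value at the node, and the value varies slowly on a cell. The
    telescoping bound [1 - 1 / (n + 1)] dominates the sum of the squares of the
    [1 / (k + 1)]. *)
Lemma riesz_norm n x :
  `|norm2 (riesz n x) - 1| <= 2^-1 * (1 - n.+1%:R^-1).
Proof.
elim/ltn_ind: n x => -[|n] IH x.
  by rewrite /norm2/= expr0n/= addr0 expr1n subrr normr0 invr1 subrr mulr0.
have le32 k y : (k <= n)%N -> norm2 (riesz k y) <= 3 / 2.
  move=> kn; have := IH k kn y; have : 0 <= k.+1%:R^-1 :> R by [].
  by move: (k.+1%:R^-1) => e; rewrite ler_norml => h /andP[? ?]; lra.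
have c_le k : (k <= n)%N -> (forall m, `|coef1 k m| <= k.+1%:R^-1) /\
    (forall m, `|coef2 k m| <= k.+1%:R^-1).
  by move=> kn; apply: coef_le => y; exact: le32.
set al := n.+1%:R^-1 : R.
have al0 : 0 < al by rewrite invr_gt0.
have near_node : `|x - node n x| <= (B ^+ n)^-1.
  have -> : x - node n x = fpart (B ^+ n * x) / B ^+ n.
    by rewrite /fpart /node; field; exact: lt0r_neq0.
  have /andP[f0 f1] := fpart_itv (B ^+ n * x).
  rewrite ger0_norm; last by rewrite divr_ge0// ltW.
  by rewrite -[leRHS]mul1r ler_wpM2r// invr_ge0 ltW.
have lip (c : nat -> int -> R) : (forall k, (k <= n)%N -> forall m, `|c k m| <= k.+1%:R^-1) ->
    `|slope B c n x - slope B c n (node n x)| <= al / 100.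
  move=> hc; rewrite /slope -sumrB; apply: (le_trans (ler_norm_sum _ _ _)).
  apply: (@le_trans _ _ (400 * (4 * al * B ^+ n / B) * (B ^+ n)^-1)).
    apply: (@le_trans _ _ (400 * (\sum_(0 <= k < n) k.+1%:R^-1 * B ^+ k) * (B ^+ n)^-1)).
      rewrite mulr_sumr mulr_suml big_nat [leRHS]big_nat; apply: ler_sum => k /andP[_ kn].
      apply: (le_trans (glued_ddspline_lip (hc k (ltnW kn)) _ _)).
      rewrite -mulrBr normrM (gtr0_norm (Bk0 k)) !mulrA.
      apply: ler_wpM2l near_node; apply: mulr_ge0; last exact: ltW.
      by apply: mulr_ge0; [exact: ler0n|rewrite invr_ge0 ler0n].
    apply: ler_wpM2r; first by rewrite invr_ge0 ltW.
    by apply: ler_wpM2l; [exact: ler0n|exact: sum_head].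
  rewrite (_ : _ * _ = al * (400 * 4 / B)); last by field; rewrite !lt0r_neq0.
  apply: ler_wpM2l; first exact: ltW.
  by rewrite ler_pdivrMr// [leRHS]mulrC ler_pdivlMr.
have [hp1 hp2] := coord_le (le32 n x (leqnn n)).
have N0 := le32 n (node n x) (leqnn n).
have := lip coef1 (fun k kn => (c_le k kn).1).
have := lip coef2 (fun k kn => (c_le k kn).2).
rewrite -!riesz2E.
have -> : slope B coef1 n x - slope B coef1 n (node n x) =
  (riesz n x).1 - (riesz n (node n x)).1 by rewrite !riesz1E; ring.
have := IH n (ltnSn n) x.
have w_le : `|ddspline (fpart (B ^+ n * x)) / (64 * n.+1%:R)| <= al / 10.
  have /andP[_ f1] := fpart_itv (B ^+ n * x).
  have := ddspline_node (fpart_itv (B ^+ n * x)) (or_introl f1).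
  move: (ddspline _) => w d6; rewrite invfM mulrA normrM [`|_^-1|]ger0_norm// -/al.
  rewrite mulrC; apply: ler_wpM2l; first exact: ltW.
  rewrite normrM [`|64^-1|]ger0_norm// ler_pdivrMr//.
  by apply: (le_trans d6); lra.
rewrite /= -/al.
move: (ddspline _ / _) w_le (riesz n x) hp1 hp2 (riesz n (node n x)) N0.
move=> w w_le [p q] /= hp hq [p0 q0]; rewrite /norm2/= => N0 hN hq0 hp0.
have step : `|(p - q0 * w) ^+ 2 + (q + p0 * w) ^+ 2 - (p ^+ 2 + q ^+ 2)| <= al ^+ 2 / 10.
  rewrite (_ : _ - _ = w ^+ 2 * (p0 ^+ 2 + q0 ^+ 2) +
    2 * w * (p * (q - q0) - q * (p - p0))); last by ring.
  have w2 : w ^+ 2 <= (al / 10) ^+ 2.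
    by rewrite -real_normK ?num_real// lerXn2r ?nnegrE// divr_ge0// ltW.
  have t1 : `|w ^+ 2 * (p0 ^+ 2 + q0 ^+ 2)| <= (al / 10) ^+ 2 * (3 / 2).
    rewrite ger0_norm; last by rewrite mulr_ge0 ?sqr_ge0// addr_ge0 ?sqr_ge0.
    by apply: ler_pM => //; rewrite ?addr_ge0 ?sqr_ge0.
  have t2 : `|p * (q - q0) - q * (p - p0)| <= 5 / 4 * (al / 100) * 2.
    rewrite mulr_natr mulr2n; apply: (le_trans (ler_normB _ _)).
    by rewrite !normrM; apply: lerD; apply: ler_pM.
  have t3 : `|2 * w * (p * (q - q0) - q * (p - p0))| <=
      2 * (al / 10) * (5 / 4 * (al / 100) * 2).
    rewrite normrM; apply: ler_pM => //.
    by rewrite normrM ger0_norm// ler_wpM2l.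
  apply: (le_trans (ler_normD _ _)); apply: (le_trans (lerD t1 t3)).
  by have := sqr_ge0 al; move: (al) => a; lra.
have tele : al ^+ 2 / 4 <= 2^-1 * (al - n.+2%:R^-1).
  rewrite /al -[n.+2%:R]natr1; set t := n.+1%:R.
  have t1 : 1 <= t by rewrite ler1n.
  rewrite -subr_ge0 (_ : _ - _ = (t - 1) / (4 * t ^+ 2 * (t + 1))).
    by rewrite divr_ge0 ?mulr_ge0 ?sqr_ge0//; lra.
  by field; apply/andP; split; lra.
have al2 := sqr_ge0 al.
move: hN step; move: (n.+2%:R^-1) tele => e tele.
rewrite !ler_norml => /andP[? ?] /andP[? ?].
by apply/andP; split; lra.
Qed.

(** Where the modulus is bounded below, one of the two coordinates is large. *)
Lemma riesz_coefficients : exists cu cv : nat -> int -> R,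
  [/\ (forall k m, `|cu k m| <= k.+1%:R^-1), (forall k m, `|cv k m| <= k.+1%:R^-1),
      (forall n x, `|slope B cu n x| <= 3), (forall n x, `|slope B cv n x| <= 3) &
      forall k m, k.+1%:R^-1 / 128 <= `|cu k m| \/ k.+1%:R^-1 / 128 <= `|cv k m|].
Proof.
have le32 k y : norm2 (riesz k y) <= 3 / 2 /\ 2^-1 <= norm2 (riesz k y).
  have := riesz_norm k y; have : 0 <= k.+1%:R^-1 :> R by [].
  by move: (k.+1%:R^-1) => e; rewrite ler_norml => h /andP[? ?]; split; lra.
exists coef1, coef2; split=> [k|k|n x|n x|k m].
- exact: (coef_le (fun y => (le32 k y).1)).1.
- exact: (coef_le (fun y => (le32 k y).1)).2.
- have [+ _] := coord_le (le32 n x).1; rewrite riesz1E !ler_norml => /andP[? ?].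
  by apply/andP; split; lra.
- have [_] := coord_le (le32 n x).1; rewrite riesz2E => h.
  by rewrite (le_trans h)//; lra.
have big (z : R) : 2^-1 <= `|z| -> k.+1%:R^-1 / 128 <= `|z / (64 * k.+1%:R)|.
  move=> hz; rewrite invfM mulrA normrM [`|_^-1|]ger0_norm// mulrC ler_wpM2r//.
  by rewrite normrM [`|64^-1|]ger0_norm// ler_pdivlMr//; lra.
set z := riesz k (m%:~R / B ^+ k).
have [_] := le32 k (m%:~R / B ^+ k); rewrite -/z /norm2 => hz.
have [h1|h1] := leP 2^-1 `|z.1|; first by right; exact: big.
left; rewrite /coef1; apply: big; rewrite normrN leNgt; apply/negP => h2.
have s1 : `|z.1| ^+ 2 < 2^-1 ^+ 2 by rewrite ltrXn2r// ?nnegrE.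
have s2 : `|z.2| ^+ 2 < 2^-1 ^+ 2 by rewrite ltrXn2r// ?nnegrE.
by move: s1 s2; rewrite !real_normK ?num_real// => ? ?; lra.
Qed.

End riesz.
(** * Horizontal graphs in the Heisenberg group *)

Section koranyi_bounds.
Context {R : realType}.
Local Notation H := (heisenberg R).
Implicit Types p x y : H.

Lemma koranyi4 p :
  koranyi p ^+ 4 = ((heis_z p).1 ^+ 2 + (heis_z p).2 ^+ 2) ^+ 2 + 16 * heis_t p ^+ 2.
Proof.
have -> : koranyi p ^+ 4 = (koranyi p ^+ 2) ^+ 2 by rewrite -exprM.
by rewrite sqr_koranyi sqr_enorm /= sqr_enorm; ring.
Qed.

Lemma koranyi_le p (a : R) : 0 <= a -> `|(heis_z p).1| <= a -> `|(heis_z p).2| <= a ->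
  `|heis_t p| <= a ^+ 2 -> koranyi p <= 3 * a.
Proof.
move=> a0 h1 h2 h3; rewrite -(@ler_pXn2r _ 4) ?nnegrE ?koranyi_ge0 ?mulr_ge0// koranyi4.
have s1 : (heis_z p).1 ^+ 2 <= a ^+ 2.
  by rewrite -real_normK ?num_real// lerXn2r ?nnegrE.
have s2 : (heis_z p).2 ^+ 2 <= a ^+ 2.
  by rewrite -real_normK ?num_real// lerXn2r ?nnegrE.
have s3 : heis_t p ^+ 2 <= (a ^+ 2) ^+ 2.
  by rewrite -real_normK ?num_real// lerXn2r ?nnegrE ?sqr_ge0.
have s4 : ((heis_z p).1 ^+ 2 + (heis_z p).2 ^+ 2) ^+ 2 <= (2 * a ^+ 2) ^+ 2.
  have q1 := sqr_ge0 (heis_z p).1; have q2 := sqr_ge0 (heis_z p).2.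
  by apply: lerXn2r; rewrite ?nnegrE; move: s1 s2 q1 q2; lra.
have a4 := exprn_ge0 4 a0.
have -> : (3 * a) ^+ 4 = 81 * a ^+ 4 by ring.
move: s3 s4; have -> : (a ^+ 2) ^+ 2 = a ^+ 4 by ring.
have -> : (2 * a ^+ 2) ^+ 2 = 4 * a ^+ 4 by ring.
by lra.
Qed.

Lemma koranyi_ge1 p : `|(heis_z p).1| <= koranyi p.
Proof.
rewrite -(@ler_pXn2r _ 4) ?nnegrE ?koranyi_ge0// koranyi4.
have -> : `|(heis_z p).1| ^+ 4 = ((heis_z p).1 ^+ 2) ^+ 2.
  by rewrite -[in RHS](real_normK (num_real (heis_z p).1)) -exprM.
have := sqr_ge0 (heis_z p).1; have := sqr_ge0 (heis_z p).2.
have := sqr_ge0 (heis_t p); move: (_ ^+ 2) ((heis_z p).1 ^+ 2) ((heis_z p).2 ^+ 2) => t a b.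
by nra.
Qed.

Lemma koranyi_ge2 p : `|(heis_z p).2| <= koranyi p.
Proof.
rewrite -(@ler_pXn2r _ 4) ?nnegrE ?koranyi_ge0// koranyi4.
have -> : `|(heis_z p).2| ^+ 4 = ((heis_z p).2 ^+ 2) ^+ 2.
  by rewrite -[in RHS](real_normK (num_real (heis_z p).2)) -exprM.
have := sqr_ge0 (heis_z p).1; have := sqr_ge0 (heis_z p).2.
have := sqr_ge0 (heis_t p); move: (_ ^+ 2) ((heis_z p).1 ^+ 2) ((heis_z p).2 ^+ 2) => t a b.
by nra.
Qed.

Lemma koranyi_get p : 4 * `|heis_t p| <= koranyi p ^+ 2.
Proof.
rewrite -(@ler_pXn2r _ 2) ?nnegrE ?sqr_ge0 ?mulr_ge0// -exprM koranyi4.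
rewrite exprMn real_normK ?num_real//.
by have := sqr_ge0 ((heis_z p).1 ^+ 2 + (heis_z p).2 ^+ 2); lra.
Qed.

Lemma heis_divE x y : (y^-1 * x)%g = Heisenberg
  ((heis_z x).1 - (heis_z y).1, (heis_z x).2 - (heis_z y).2)
  (heis_t x - heis_t y - 2^-1 * ((heis_z y).1 * (heis_z x).2 - (heis_z y).2 * (heis_z x).1)).
Proof. by apply: heisP => /=; ring. Qed.

Lemma mdist_ge1 x y : `|(heis_z x).1 - (heis_z y).1| <= mdist x y.
Proof. by have := koranyi_ge1 (y^-1 * x)%g; rewrite heis_divE heis_mdistE heis_divE. Qed.

End koranyi_bounds.

Section horizontal_graph.
Context {R : realType}.
Local Notation H := (heisenberg R).
Variables (f G : R -> R) (K : R).
Hypothesis K1 : 1 <= K.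
Hypothesis tangent : tangent_modulus f G K.
Implicit Types (x y r : R).

(** When [G' = f], this is the horizontal lift of the graph of [f]: the
    contact condition [dt = (x * df - f * dx) / 2] reads
    [dt = d(x * f / 2) - f * dx]. *)
Definition lift x : H := Heisenberg (x, f x) (2^-1 * x * f x - G x).

Definition trace : set H := range lift.

Let K0 : 0 <= K. Proof. by move: K1; lra. Qed.

Let modulus_le r e : 0 <= e -> e / (1 + `|ln r|) <= e.
Proof. by move=> e0; rewrite ler_pdivrMr ?ltr_wpDr// ler_peMr// lerDl. Qed.

Lemma tangent_modulus_lip x y : `|f x - f y| <= 2 * K * `|x - y|.
Proof.
have [->|xy] := eqVneq x y; first by rewrite !subrr normr0 mulr0.
have r0 : 0 < `|x - y| by rewrite normr_gt0 subr_eq0.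
have [s sK /(_ x (lexx _)) [h _]] := tangent y r0.
have h1 : `|f x - f y - s * (x - y)| <= K * `|x - y|.
  by apply: (le_trans h); apply: modulus_le; rewrite mulr_ge0.
have h2 : `|s * (x - y)| <= K * `|x - y| by rewrite normrM ler_wpM2r.
rewrite -[f x - f y](subrK (s * (x - y))).
by apply: (le_trans (ler_normD _ _)); lra.
Qed.

Lemma tangent_modulus_prim x y : `|G x - G y - f y * (x - y)| <= 2 * K * `|x - y| ^+ 2.
Proof.
have [->|xy] := eqVneq x y; first by rewrite !subrr mulr0 subrr normr0 expr0n mulr0.
have r0 : 0 < `|x - y| by rewrite normr_gt0 subr_eq0.
have [s sK /(_ x (lexx _)) [_ h]] := tangent y r0.
have h1 := le_trans h (modulus_le _ (mulr_ge0 K0 (sqr_ge0 _))).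
have h2 : `|2^-1 * s * (x - y) ^+ 2| <= K * `|x - y| ^+ 2.
  rewrite normrM normrX ler_wpM2r ?sqr_ge0// normrM ger0_norm//.
  by move: K0 sK; lra.
rewrite -[G x - G y - _](subrK (2^-1 * s * (x - y) ^+ 2)).
by apply: (le_trans (ler_normD _ _)); lra.
Qed.

(** The vertical coordinate of [(lift y)^-1 * lift x] involves only the
    deviations of [f] and [G] from their values at [y], and is quadratic in
    [x - y]. *)
Lemma lift_lip x y : mdist (lift x) (lift y) <= 9 * K * `|x - y|.
Proof.
rewrite heis_mdistE; have -> : 9 * K * `|x - y| = 3 * (3 * K * `|x - y|) by ring.
have r0 := normr_ge0 (x - y).
have Kr : `|x - y| <= K * `|x - y| by rewrite ler_peMl.
have fl := tangent_modulus_lip x y; have Gl := tangent_modulus_prim x y.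
apply: koranyi_le; rewrite ?heis_divE/=.
- by rewrite !mulr_ge0.
- by lra.
- by lra.
rewrite (_ : _ - _ - _ = 2^-1 * ((x - y) * (f x - f y)) - (G x - G y - f y * (x - y)));
  last by field.
have h1 : `|2^-1 * ((x - y) * (f x - f y))| <= K * `|x - y| ^+ 2.
  rewrite normrM ger0_norm// normrM ler_pdivrMl// expr2.
  by apply: (le_trans (ler_wpM2l r0 fl)); lra.
apply: (le_trans (ler_normB _ _)).
have KK : K * `|x - y| ^+ 2 <= K ^+ 2 * `|x - y| ^+ 2.
  by rewrite ler_wpM2r ?sqr_ge0// expr2 ler_peMr.
have -> : (3 * K * `|x - y|) ^+ 2 = 9 * (K ^+ 2 * `|x - y| ^+ 2) by ring.
have K20 : 0 <= K * `|x - y| ^+ 2 by rewrite mulr_ge0 ?sqr_ge0.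
by lra.
Qed.

Lemma lift_expanding x y : `|x - y| <= mdist (lift x) (lift y).
Proof. exact: (mdist_ge1 (lift x) (lift y)). Qed.

Let L0 : 0 < 9 * K. Proof. by move: K1; lra. Qed.

Lemma lift_continuous : continuous lift.
Proof.
move=> x; apply/cvg_ballP => e e0.
apply/nbhs_ballP; exists (e / (9 * K)) => /=; first by rewrite divr_gt0.
move=> y xy; have {}xy : `|x - y| < e / (9 * K) by exact: xy.
rewrite /= ballEmdist/=.
by apply: le_lt_trans (lift_lip _ _) _; rewrite mulrC -ltr_pdivlMr.
Qed.

(** A point in the closure must be the point of the curve with the same first
    coordinate, since that coordinate is 1-Lipschitz. *)
Lemma closed_trace : closed trace.
Proof.
move=> p clp; exists (heis_z p).1 => //.
apply: mdist_positivity; apply/eqP; rewrite eq_le mdist_ge0 andbT.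
apply/ler_addgt0Pl => e e0; rewrite addr0.
have d0 : 0 < e / (9 * K + 1) by rewrite divr_gt0// ltr_wpDl// ltW.
have /clp[_ [[y _ <-]]] := nbhsx_ballx p _ d0.
rewrite ballEmdist/= metric_sym => yp.
apply: (le_trans (metric_triangle _ (lift y) _)).
have zy : `|(heis_z p).1 - y| <= mdist (lift y) p.
  by rewrite distrC; exact: (mdist_ge1 (lift y) p).
have h1 := le_trans (lift_lip (heis_z p).1 y) (ler_wpM2l (ltW L0) zy).
apply: (le_trans (lerD h1 (lexx _))).
rewrite -{2}[mdist (lift y) p]mul1r -mulrDl mulrC -ler_pdivlMr ?ltW//.
by rewrite ltr_wpDl// ltW.
Qed.

Lemma curve_trace : curve trace.
Proof.
exists setT, lift; split => //.
exact/continuous_subspaceT/lift_continuous.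
Qed.

Lemma hausdorff1_trace_ge (U : set H) a b :
  (forall s, a <= s <= b -> U (lift s)) ->
  (((b - a) / 2)%:E <= hausdorff1 U)%E.
Proof.
move=> hU.
have := @hausdorff1_ge_lipschitz _ _ (fun p : H => (heis_z p).1) U 1 (fun=> 0) a b.
rewrite mulr1; apply => //; first by move=> x y; exact: mdist_ge1.
by move=> s /hU Us; exists 0%N => //; exists (lift s) => //; rewrite addr0.
Qed.

Lemma hausdorff1_trace_le (U : set H) a b : a <= b ->
  (forall p, U p -> exists2 s, a <= s <= b & p = lift s) ->
  (hausdorff1 U <= (9 * K * (b - a))%:E)%E.
Proof.
move=> ab hU.
apply: le_trans (hausdorff1_lipschitz_itv (ltW L0) lift_lip ab).
by apply: le_hausdorff1 => p /hU[s sab ->]; exists s => //=; rewrite in_itv.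
Qed.

Lemma diam_trace : diam trace = +oo%E.
Proof.
apply/eqyP => A A0.
apply: (@le_trans _ _ (mdist (lift A) (lift 0))%:E).
  rewrite lee_fin; apply: le_trans (lift_expanding A 0).
  by rewrite subr0 ler_norm.
by apply: mdist_le_diam; [exists A|exists 0].
Qed.

Lemma regular1_trace : regular1 trace.
Proof.
split; first exact: closed_trace.
exists (18 * K); first by move: K1; lra.
move=> _ r [x _ <-] r0 _; apply/andP; split.
  apply: le_trans (hausdorff1_trace_ge (a := x - r / (9 * K)) (b := x + r / (9 * K)) _).
    rewrite lee_fin; have -> : (x + r / (9 * K) - (x - r / (9 * K))) / 2 = r / (9 * K) by field; move: K1; lra.
    rewrite mulrC; apply: ler_wpM2l; first exact: ltW.
    by rewrite lef_pV2 ?posrE; move: K1; lra.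
  move=> s /andP[s1 s2]; split; first by exists s.
  rewrite /cball/=; apply: (le_trans (lift_lip _ _)).
  by rewrite mulrC -ler_pdivlMr// ler_norml; apply/andP; split; lra.
have -> : 18 * K * r = 9 * K * (x + r - (x - r)) by ring.
apply: hausdorff1_trace_le; first by lra.
move=> _ [[s _ <-]]; rewrite /cball/= => xs; exists s => //.
have := le_trans (lift_expanding x s) xs; rewrite ler_norml => /andP[? ?].
by apply/andP; split; lra.
Qed.

End horizontal_graph.
(** * Upper bound for the stratified coefficients *)

Section beta_hat_bound.
Context {R : realType}.
Local Notation H := (heisenberg R).
Variables (f G : R -> R) (K : R).
Hypothesis K1 : 1 <= K.
Hypothesis tangent : tangent_modulus f G K.
Implicit Types (x y r : R).
Local Notation lift := (lift f G).
Local Notation trace := (trace f G).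

Let K0 : 0 <= K. Proof. by move: K1; lra. Qed.

Definition tangent_line x0 (sigma : R) : set H :=
  [set (lift x0 * Heisenberg z 0)%g | z in line0 (1, sigma)].

Lemma horizontal_tangent_line x0 sigma : horizontal_lines (tangent_line x0 sigma).
Proof.
exists (lift x0), (1, sigma); split => //.
by apply/eqP => -[/eqP]; rewrite oner_eq0.
Qed.

Let foot x0 (sigma : R) x : H :=
  (lift x0 * Heisenberg ((x - x0) * 1, (x - x0) * sigma)%R 0)%g.

Let foot_line x0 sigma x : tangent_line x0 sigma (foot x0 sigma x).
Proof. by exists ((x - x0) * 1, (x - x0) * sigma) => //; exists (x - x0). Qed.

(** Compare [lift x] with the point of the line that has the same first
    coordinate. *)
Lemma dist_tangent_line x0 sigma x (a : R) : 0 <= a ->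
  `|f x - f x0 - sigma * (x - x0)| <= a ->
  `|G x - G x0 - f x0 * (x - x0) - 2^-1 * sigma * (x - x0) ^+ 2| <= a ^+ 2 ->
  (dist_set (lift x) (tangent_line x0 sigma) <= (3 * a)%:E)%E.
Proof.
move=> a0 hf hG; apply: (le_trans (dist_set_le _ (foot_line x0 sigma x))).
rewrite lee_fin heis_mdistE; apply: koranyi_le => //; rewrite heis_divE/=.
- by rewrite (_ : _ - _ = 0) ?normr0//; ring.
- by rewrite (_ : _ - _ = f x - f x0 - sigma * (x - x0)) //; ring.
- rewrite -normrN [X in `|X|](_ : _ = G x - G x0 - f x0 * (x - x0) - 2^-1 * sigma * (x - x0) ^+ 2) //.
  by field.
Qed.

Lemma edist_tangent_line x0 sigma x :
  (edist_plane (heis_z (lift x)) (@heis_z R @` tangent_line x0 sigma) <=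
   `|f x - f x0 - sigma * (x - x0)|%:E)%E.
Proof.
apply: ereal_inf_lbound; exists (heis_z (foot x0 sigma x)).
  by exists (foot x0 sigma x) => //; exact: foot_line.
congr EFin; rewrite /enorm /=.
rewrite (_ : x - (x0 + (x - x0) * 1) = 0); last by ring.
rewrite expr0n/= add0r sqrtr_sqr; congr `|_|; ring.
Qed.

Let average_ge0 (A : set H) (g : H -> \bar R) : (forall p, 0 <= g p)%E -> (0 <= average A g)%E.
Proof.
move=> g0; apply: mule_ge0; first by rewrite inve_ge0; exact: hausdorff1_ge0.
by apply: integral_ge0 => p _; exact: g0.
Qed.

Let pow_le (z : \bar R) (e : R) n : (0 <= z <= e%:E)%E -> (z ^+ n <= (e ^+ n)%:E)%E.
Proof.
case: z => [z| |]//; rewrite ?lee_fin => /andP[z0 ze]; last by [].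
by rewrite -EFin_expe lee_fin lerXn2r// nnegrE (le_trans z0).
Qed.

Lemma beta_hat_ge0 (A : set H) : (0 <= beta_hat A)%E.
Proof. by apply: le_ereal_inf_tmp => _ [V _ <-]; exact: poweR_ge0. Qed.

(** With the modulus [th ^ 2 = (1 + |ln r|)^-1], the planar average is
    [O(th ^ 2)] and the Koranyi average is [O(th)], because the vertical
    deviation enters under a square root. *)
Lemma beta_hat_le (A : set H) x0 r (delta : R) : 0 < r -> 0 < delta ->
  (forall p, A p -> exists2 x, `|x - x0| <= r & p = lift x) ->
  (delta%:E <= diam A)%E -> (0 < hausdorff1 A)%E ->
  (beta_hat A `^ 4 <=
    (((3 * K * r / delta) ^+ 2 + (3 * K * r / delta) ^+ 4) / (1 + `|ln r|) ^+ 2)%:E)%E.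
Proof.
move=> r0 d0 hA dA HA.
have [sigma sK tgt] := tangent x0 r0.
set M := 1 + `|ln r| in tgt *.
have M1 : 1 <= M by rewrite /M lerDl.
have M0 : 0 < M by lra.
set V := tangent_line x0 sigma.
have diam_fin : (diam A <= (18 * K * r)%:E)%E.
  apply: diam_le; first by rewrite !mulr_ge0// ltW.
  move=> p q /hA[x hx ->] /hA[y hy ->].
  apply: (le_trans (lift_lip K1 tangent x y)).
  have xy : `|x - y| <= 2 * r.
    rewrite (_ : x - y = (x - x0) - (y - x0)); last by ring.
    by apply: (le_trans (ler_normB _ _)); lra.
  have -> : 18 * K * r = 9 * K * (2 * r) by ring.
  by rewrite ler_wpM2l// mulr_ge0.
have [dd dE ddelta] : exists2 d : R, diam A = d%:E & delta <= d.
  move: dA diam_fin; case: (diam A) => [d| |]//; rewrite lee_fin => h _.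
  by exists d.
have quot (z : \bar R) (e : R) : (0 <= z <= e%:E)%E -> (0 <= z / diam A <= (e / delta)%:E)%E.
  rewrite dE inver gt_eqF; last exact: lt_le_trans ddelta.
  move=> /andP[z0 ze]; have dd0 : 0 <= dd^-1 by rewrite invr_ge0 (le_trans (ltW d0)).
  rewrite mule_ge0 ?lee_fin//= EFinM; apply: lee_pmul => //.
  by rewrite lee_fin lef_pV2 ?posrE// (lt_le_trans d0).
have HAoo : (hausdorff1 A < +oo)%E.
  apply: (@le_lt_trans _ _ (9 * K * (x0 + r - (x0 - r)))%:E); last exact: ltry.
  apply: (hausdorff1_trace_le K1 tangent); first lra.
  move=> p /hA[x hx ->]; exists x => //.
  by move: hx; rewrite ler_norml => /andP[? ?]; apply/andP; split; lra.
set th := Num.sqrt M^-1.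
have th2 : th ^+ 2 = M^-1 by rewrite sqr_sqrtr// invr_ge0 ltW.
have th0 : 0 <= th by exact: sqrtr_ge0.
have th1 : th <= 1 by rewrite -(sqrtr1 R) ler_sqrt// invf_le1.
have ad : (0 <= avg_dist A V <= (3 * K * r / delta * th)%:E)%E.
  apply/andP; split.
    apply: average_ge0 => x; apply: mule_ge0; first exact: dist_set_ge0.
    by rewrite inve_ge0; exact: diam_ge0.
  apply: average_le => //; first by rewrite !mulr_ge0// ?invr_ge0 ltW.
  move=> p /hA[x xr ->]; rewrite mulrAC; apply: quot.
  rewrite dist_set_ge0/= (_ : 3 * K * r * th = 3 * (K * r * th)); last by ring.
  have [tf tG] := tgt x xr.
  apply: dist_tangent_line; first by rewrite !mulr_ge0// ltW.
    apply: (le_trans tf); rewrite -th2 expr2.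
    apply: ler_wpM2l; first by rewrite mulr_ge0// ltW.
    by rewrite ler_piMl.
  apply: (le_trans tG); rewrite -th2 !exprMn ler_wpM2r ?sqr_ge0//.
  by rewrite ler_wpM2r ?sqr_ge0// expr2 ler_peMr.
have ae : (0 <= avg_edist A V <= (3 * K * r / delta * th ^+ 2)%:E)%E.
  apply/andP; split.
    apply: average_ge0 => x; apply: mule_ge0; last first.
      by rewrite inve_ge0; exact: diam_ge0.
    by apply: le_ereal_inf_tmp => _ [w _ <-]; rewrite lee_fin enorm_ge0.
  apply: average_le => //.
    by rewrite !mulr_ge0// ?invr_ge0; exact: ltW.
  move=> p /hA[x xr ->]; rewrite mulrAC; apply: quot; apply/andP; split.
    by apply: le_ereal_inf_tmp => _ [w _ <-]; rewrite lee_fin enorm_ge0.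
  have [tf _] := tgt x xr.
  apply: (le_trans (edist_tangent_line _ _ _)); rewrite lee_fin.
  apply: (le_trans tf); rewrite th2; apply: ler_wpM2r; first by rewrite invr_ge0 ltW.
  by apply: ler_wpM2r; [exact: ltW|move: K0; lra].
apply: (@le_trans _ _ (((avg_edist A V ^+ 2 + avg_dist A V ^+ 4) `^ 4^-1) `^ 4)%E).
  apply: gt0_ler_poweR => //; rewrite ?in_itv/= ?leey ?andbT ?beta_hat_ge0 ?poweR_ge0//.
  apply: ereal_inf_lbound; exists V => //; exact: horizontal_tangent_line.
rewrite -poweRrM mulVf// poweRe1; last first.
  have /andP[ae0 _] := ae; have /andP[ad0 _] := ad.
  exact: (adde_ge0 (expe_ge0 2 ae0) (expe_ge0 4 ad0)).
apply: (le_trans (leeD (pow_le 2 ae) (pow_le 4 ad))).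
rewrite -EFinD lee_fin; set C := 3 * K * r / delta.
have -> : (C * th ^+ 2) ^+ 2 + (C * th) ^+ 4 = (C ^+ 2 + C ^+ 4) * (th ^+ 2) ^+ 2 by ring.
by rewrite th2 exprVn.
Qed.

End beta_hat_bound.
(** * Carleson packing *)

Section packing.
Context {R : realType} {T : metricType R}.
Implicit Types (A E Q : set T) (s : seq (set T)).
Local Open Scope ereal_scope.

Lemma sum_hausdorff1_disjoint s A : uniq s ->
  (forall Q, Q \in s -> borel Q /\ Q `<=` A) -> trivIset [set Q | Q \in s] id ->
  \sum_(Q <- s) hausdorff1 Q <= hausdorff1 A.
Proof.
elim: s A => [|Q s IH] A; first by rewrite big_nil hausdorff1_ge0.
move=> /= /andP[Qs us] hs tr; rewrite big_cons.
have [bQ QA] := hs Q (mem_head _ _).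
rewrite [leRHS](caratheodory_borel bQ A) setIidr//; apply: leeD => //.
apply: IH => // [P Ps|].
  have Ps' : P \in Q :: s by rewrite inE Ps orbT.
  have [bP PA] := hs P Ps'; split => // x Px; split; first exact: PA.
  move=> Qx; move: Qs; rewrite (tr Q P) ?Ps//=; [exact: mem_head|by exists x].
by move=> P P' Ps P's; apply: tr => /=; rewrite inE ?Ps ?P's orbT.
Qed.

(** Each generation contributes at most a multiple of the measure of the top
    cube, so a summable bound per generation suffices. The generations [j] and
    [- j] share a weight, whence the factor [2]. *)
Lemma packing E (S : dyadic_system E) (Q0 : set T) (F : set T -> \bar R)
    (w : nat -> R) (W : R) :
  (forall k, (0 <= w k)%R) -> (forall n, (\sum_(k < n) w k <= W)%R) ->
  (forall j Q, dy_J S j -> dy_gen S j Q ->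
     F Q <= (w `|j|%N)%:E * hausdorff1 Q) ->
  \esum_(Q in [set Q | dy_cubes S Q /\ Q `<=` Q0]) F Q <=
    (W * 2)%:E * hausdorff1 Q0.
Proof.
move=> w0 wW FQ; apply: ge_ereal_sup => _ [X [finX XQ] <-].
rewrite fsbig_finite//=; set s : seq (set T) := finmap.enum_fset _.
have sX Q : Q \in s -> dy_cubes S Q /\ Q `<=` Q0.
  by rewrite /s in_fset_set// inE => /XQ.
have [jof hj] : {jof : set T -> int & forall Q, dy_cubes S Q ->
    dy_J S (jof Q) /\ dy_gen S (jof Q) Q}.
  apply: (@choice _ _ (fun Q j => dy_cubes S Q -> dy_J S j /\ dy_gen S j Q)) => Q.
  have [[j Jj gj]|nQ] := pselect (dy_cubes S Q); first by exists j.
  by exists 0%R.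
pose k Q := `|jof Q|%N.
pose N := \max_(Q <- s) k Q.
have kN Q : Q \in s -> (k Q < N.+1)%N.
  by move=> Qs; rewrite ltnS /N; apply: (@leq_bigmax_seq _ _ _ k) => //.
have gen_le j : \sum_(Q <- s | jof Q == j) hausdorff1 Q <= hausdorff1 Q0.
  rewrite -big_filter; apply: sum_hausdorff1_disjoint.
  - exact/filter_uniq/finmap.fset_uniq.
  - move=> Q; rewrite mem_filter => /andP[/eqP _ /sX[cQ QQ0]]; split => //.
    by have [Jj gj] := hj Q cQ; exact: dy_borel Jj gj.
  - move=> Q P /=; rewrite !mem_filter => /andP[/eqP jQ /sX[/hj[JQ gQ] _]].
    move=> /andP[/eqP jP /sX[/hj[JP gP] _]].
    by rewrite jQ in JQ gQ; rewrite jP in JP gP; exact: dy_disj JQ _ _ gQ gP.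
have level_le i : \sum_(Q <- s | k Q == i) hausdorff1 Q <= 2%:E * hausdorff1 Q0.
  rewrite (bigID (fun Q => jof Q == Posz i))/= mule_natl mule2n.
  have sub (P P' : pred (set T)) : (forall Q, P Q -> P' Q) ->
      \sum_(Q <- s | P Q) hausdorff1 Q <= \sum_(Q <- s | P' Q) hausdorff1 Q.
    move=> PP'; rewrite big_mkcond [leRHS]big_mkcond; apply: lee_sum => Q _.
    case: ifP => [/PP' ->//|_]; case: ifP => // _; exact: hausdorff1_ge0.
  apply: leeD.
    by apply: le_trans (gen_le (Posz i)); apply: sub => Q /andP[].
  apply: le_trans (gen_le (- Posz i)%R); apply: sub => Q /andP[/eqP <- ].
  by rewrite /k; case: (jof Q) => // n; rewrite eqxx.
apply: (@le_trans _ _ (\sum_(Q <- s) (w (k Q))%:E * hausdorff1 Q)).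
  rewrite big_seq [leRHS]big_seq; apply: lee_sum => Q /sX[/hj[JQ gQ] _].
  exact: FQ JQ gQ.
rewrite (partition_big (fun Q => inord (k Q) : 'I_N.+1) xpredT)//=.
apply: (@le_trans _ _ (\sum_(i < N.+1) (w i)%:E * (2%:E * hausdorff1 Q0))).
  apply: lee_sum => i _.
  rewrite big_seq_cond (eq_bigr (fun Q => (w i)%:E * hausdorff1 Q)); last first.
    by move=> Q /andP[Qs /eqP <-]; rewrite inordK// kN.
  rewrite -ge0_sume_distrr; last by move=> Q _; exact: hausdorff1_ge0.
  apply: lee_pmul; [by rewrite lee_fin| |exact: lexx|].
    by apply: sume_ge0 => Q _; exact: hausdorff1_ge0.
  apply: le_trans (level_le i); rewrite [leRHS]big_seq_cond.
  rewrite (eq_bigl (fun Q => (Q \in s) && (k Q == i))) // => Q.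
  by case Qs : (Q \in s) => //=; rewrite -val_eqE/= inordK// kN.
rewrite -ge0_sume_distrl; last by move=> i _; rewrite lee_fin.
rewrite sumEFin muleA -EFinM; apply: lee_pmul; rewrite ?lee_fin//.
- by rewrite mulr_ge0// sumr_ge0.
- exact: hausdorff1_ge0.
- by rewrite ler_wpM2r.
Qed.

End packing.

Section GLem_beta_hat.
Context {R : realType}.
Local Notation H := (heisenberg R).
Variables (f G : R -> R) (K : R).
Hypothesis K1 : 1 <= K.
Hypothesis tangent : tangent_modulus f G K.
Local Notation lift := (lift f G).
Local Notation trace := (trace f G).

Lemma lnXz (rho : R) (j : int) : 0 < rho -> ln (rho ^ j) = j%:~R * ln rho.
Proof.
move=> rho0; case: j => n.
  by rewrite -exprnP lnXn// mulr_natl.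
rewrite NegzE -exprnN lnV ?posrE ?exprn_gt0// lnXn//.
by rewrite mulrNz mulNr mulr_natl.
Qed.

Lemma sum_inv_squares n : \sum_(k < n) (k.+1%:R ^+ 2)^-1 <= 2 :> R.
Proof.
suff : \sum_(k < n) (k.+1%:R ^+ 2)^-1 <= 2 - 2 / n.+1%:R :> R.
  move=> /le_trans; apply; rewrite gerBl divr_ge0//.
elim: n => [|n IH]; first by rewrite big_ord0 invr1 mulr1 subrr.
rewrite big_ord_recr/=; apply: (le_trans (lerD IH (lexx _))).
rewrite -[n.+2%:R]natr1; set t := n.+1%:R.
have t1 : 1 <= t by rewrite ler1n.
rewrite -subr_ge0 (_ : _ - _ = (t - 1) / (t ^+ 2 * (t + 1))).
  by rewrite divr_ge0 ?mulr_ge0 ?sqr_ge0//; lra.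
by field; apply/andP; split; lra.
Qed.

(** The scale [r] of a cube is geometric in its generation [j], so [1 + |j|] is
    at most a multiple of [1 + |ln r|]. *)
Lemma GLem_beta_hat_trace : GLem beta_hat 4 trace.
Proof.
move=> S lambda lam1; set rho := dy_rho S; set D := dy_D S.
have /andP[rho0 rho1] := dy_rho_itv S; rewrite -/rho in rho0 rho1.
have D1 : 1 < D := dy_D_gt1 S.
have D0 : 0 < D by lra.
pose A0 := (lambda + 1) * D; have A00 : 0 < A0 by rewrite mulr_gt0//; lra.
pose C0 := 3 * K * (A0 * D).
pose l := - ln rho.
have l0 : 0 < l by rewrite oppr_gt0 ln_lt0// rho0.
pose C1 := 1 + `|ln A0| / l + l^-1.
have C10 : 0 < C1.
  by rewrite /C1 !ltr_wpDr// ?invr_ge0 ?divr_ge0 ?(ltW l0).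
pose C := (C0 ^+ 2 + C0 ^+ 4) * C1 ^+ 2.
have C00 : 0 <= C0 ^+ 2 + C0 ^+ 4 by rewrite addr_ge0// ?sqr_ge0// exprn_even_ge0.
have CC0 : 0 <= C by rewrite mulr_ge0 ?sqr_ge0.
exists (C * 2 * 2) => Q0 _.
apply: (@packing _ _ _ S Q0 _ (fun k => C / k.+1%:R ^+ 2) (C * 2)).
- by move=> k; rewrite divr_ge0 ?sqr_ge0.
- by move=> n; rewrite -mulr_sumr ler_wpM2l// sum_inv_squares.
move=> j Q Jj gQ; rewrite muleC [leRHS]muleC; apply: lee_pmul => //.
- exact: hausdorff1_ge0.
- exact: poweR_ge0.
have /andP[dQ1 dQ2] := dy_diam Jj gQ; rewrite -/rho -/D in dQ1 dQ2.
have /andP[mQ1 mQ2] := dy_meas Jj gQ; rewrite -/rho -/D in mQ1 mQ2.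
have rj0 : 0 < rho ^ j by exact: exprz_gt0.
have QE : Q `<=` trace by rewrite (dy_cover Jj) => x Qx; exists Q.
have [_ [x0 _ <-] Qx0] : exists2 p, trace p & Q p.
  have [Q00|/set0P[p Qp]] := eqVneq Q set0; last by exists p => //; exact: QE.
  by move: dQ1; rewrite Q00 diam0 lee_fin leNgt mulr_gt0// invr_gt0.
set r := A0 * rho ^ j; have r0 : 0 < r by rewrite mulr_gt0.
set delta := D^-1 * rho ^ j; have delta0 : 0 < delta by rewrite mulr_gt0// invr_gt0.
have QlQ : Q `<=` dilate lambda trace Q.
  move=> p Qp; split; first exact: QE.
  rewrite dist_set_in//; apply: mule_ge0; last exact: diam_ge0.
  by rewrite lee_fin; lra.
have hA p : dilate lambda trace Q p -> exists2 x, `|x - x0| <= r & p = lift x.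
  move=> [[x _ <-] hx]; exists x => //.
  apply: (le_trans (lift_expanding f G x x0)).
  have lt1 : (dist_set (lift x) Q < (lambda * D * rho ^ j)%:E)%E.
    apply: (le_lt_trans hx).
    apply: (@le_lt_trans _ _ ((lambda - 1)%:E * (D * rho ^ j)%:E)%E).
      by apply: lee_pmul => //; [rewrite lee_fin; lra|exact: diam_ge0].
    rewrite -EFinM lte_fin -mulrA ltr_pM2r ?mulr_gt0//; lra.
  have [q Qq xq] := dist_set_lt lt1.
  apply: (le_trans (metric_triangle _ q _)).
  have : mdist q (lift x0) <= D * rho ^ j.
    by rewrite -lee_fin; apply: le_trans dQ2; exact: mdist_le_diam.
  by move: xq; rewrite /r /A0 => xq h; rewrite mulrDl mul1r mulrDl; lra.
have h := @beta_hat_le _ f G K K1 tangent _ x0 r delta r0 delta0 hA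
  (le_trans dQ1 (le_diam QlQ)) (lt_le_trans (lt_le_trans _ mQ1) (le_hausdorff1 QlQ)).
apply: (le_trans (h _)); first by rewrite lte_fin.
rewrite lee_fin.
have -> : 3 * K * r / delta = C0.
  by rewrite /C0 /r /delta; field; rewrite !lt0r_neq0.
suff key : (1 + `|ln r|)^-1 <= C1 / (`|j|%N).+1%:R.
  rewrite /C -mulrA -expr_div_n; apply: ler_wpM2l => //; rewrite -exprVn.
  by apply: lerXn2r; rewrite ?nnegrE ?invr_ge0 ?addr_ge0// divr_ge0// ltW.
rewrite ler_pdivlMr// ler_pdivrMl ?ltr_wpDr//.
have -> : (`|j|%N).+1%:R = 1 + `|j%:~R| :> R.
  by rewrite -natr1 addrC natr_absz intr_norm.
have lr : ln r = ln A0 - j%:~R * l by rewrite lnM ?posrE// lnXz// /l mulrN opprK.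
have jl : `|j%:~R| * l <= `|ln r| + `|ln A0|.
  rewrite -(gtr0_norm l0) -normrM (_ : j%:~R * l = ln A0 - ln r); last by rewrite lr; ring.
  by rewrite [leRHS]addrC; exact: ler_normB.
have jl' : `|j%:~R| <= `|ln r| / l + `|ln A0| / l by rewrite -mulrDl ler_pdivlMr.
have h1 : 0 <= `|ln A0| / l by rewrite divr_ge0// ltW.
have h2 : 0 <= l^-1 by rewrite invr_ge0 ltW.
have h3 := normr_ge0 (ln r).
rewrite /C1; have := mulr_ge0 h1 h3; have := mulr_ge0 h2 h3.
by lra.
Qed.

End GLem_beta_hat.
(** * The dyadic system of parameter intervals *)

Section dyadic.
Context {R : realType}.
Local Notation H := (heisenberg R).
Variables (f G : R -> R) (K : R) (b : nat).
Hypothesis K1 : 1 <= K.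
Hypothesis tangent : tangent_modulus f G K.
Hypothesis b2 : (2 <= b)%N.
Implicit Types (x y r : R) (i j n m : int).
Local Notation lift := (lift f G).
Local Notation trace := (trace f G).

Let K0 : 0 <= K. Proof. by move: K1; lra. Qed.

Definition mesh j : R := b%:R^-1 ^ j.

(** Integer parts make the cells of one generation disjoint and exhaustive by
    construction. *)
Definition cell j n : set H := [set lift x | x in [set x | Num.floor (x / mesh j) = n]].

Let bR2 : 2 <= b%:R :> R. Proof. by rewrite ler_nat. Qed.

Let rho_itv : 0 < (b%:R^-1 : R) < 1.
Proof.
have b0 : 0 < b%:R :> R by apply: lt_le_trans bR2.
by rewrite invr_gt0 b0 invf_lt1//; apply: lt_le_trans bR2; rewrite ltr1n.
Qed.

Lemma mesh_gt0 j : 0 < mesh j.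
Proof. by apply: exprz_gt0; case/andP: rho_itv. Qed.

Lemma cellP j n x : cell j n (lift x) <-> n%:~R * mesh j <= x < (n + 1)%:~R * mesh j.
Proof.
have m0 := mesh_gt0 j; split.
  move=> [y /= <- yx]; have <- : y = x by have := congr1 (fun p : H => (heis_z p).1) yx.
  by have := floor_itv (y / mesh j); rewrite ler_pdivlMr// ltr_pdivrMr.
by move=> h; exists x => //=; apply: floor_def; rewrite ler_pdivlMr// ltr_pdivrMr.
Qed.

Lemma cell_trace j n p : cell j n p -> exists2 x,
  n%:~R * mesh j <= x < (n + 1)%:~R * mesh j & p = lift x.
Proof. by move=> Qp; case: (Qp) => x _ px; exists x => //; apply/cellP; rewrite px. Qed.

Lemma cell_ends j n : (n + 1)%:~R * mesh j = n%:~R * mesh j + mesh j.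
Proof. by rewrite intrD mulrDl mul1r. Qed.

Lemma hausdorff1_cell_ge j n : ((mesh j / 4)%:E <= hausdorff1 (cell j n))%E.
Proof.
have m0 := mesh_gt0 j.
apply: le_trans (@hausdorff1_trace_ge _ f G _ (n%:~R * mesh j) (n%:~R * mesh j + mesh j / 2) _).
  by rewrite lee_fin; lra.
by move=> s /andP[s1 s2]; apply/cellP; rewrite s1 cell_ends; lra.
Qed.

Lemma hausdorff1_cell_le j n : (hausdorff1 (cell j n) <= (9 * K * mesh j)%:E)%E.
Proof.
have m0 := mesh_gt0 j.
have -> : mesh j = (n + 1)%:~R * mesh j - n%:~R * mesh j by rewrite cell_ends; ring.
apply: (hausdorff1_trace_le K1 tangent); first by rewrite cell_ends; lra.
by move=> p /cell_trace[x /andP[x1 x2] ->]; exists x => //; rewrite x1 ltW.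
Qed.

Lemma diam_cell_ge j n : ((mesh j / 2)%:E <= diam (cell j n))%E.
Proof.
have m0 := mesh_gt0 j.
apply: (@le_trans _ _ (mdist (lift (n%:~R * mesh j + mesh j / 2)) (lift (n%:~R * mesh j)))%:E).
  rewrite lee_fin; apply: le_trans (lift_expanding f G _ _).
  by rewrite (_ : _ - _ = mesh j / 2) ?ger0_norm//; [lra|ring].
by apply: mdist_le_diam; apply/cellP; rewrite cell_ends; apply/andP; split; lra.
Qed.

Lemma diam_cell_le j n : (diam (cell j n) <= (9 * K * mesh j)%:E)%E.
Proof.
have m0 := mesh_gt0 j.
apply: diam_le; first by rewrite !mulr_ge0// ltW.
move=> p q /cell_trace[x /andP[x1 x2] ->] /cell_trace[y /andP[y1 y2] ->].
apply: (le_trans (lift_lip K1 tangent x y)).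
apply: ler_wpM2l; first by rewrite mulr_ge0.
by rewrite ler_norml; move: x1 x2 y1 y2; rewrite cell_ends => *; apply/andP; split; lra.
Qed.

Lemma closed_coord_ge (a : R) : closed [set p : H | a <= (heis_z p).1].
Proof.
move=> p clp /=; rewrite leNgt; apply/negP => pa.
have d0 : 0 < a - (heis_z p).1 by rewrite subr_gt0.
have [q [/= aq]] := clp _ (nbhsx_ballx p _ d0).
rewrite ballEmdist/= metric_sym => pq.
have := le_lt_trans (mdist_ge1 q p) pq; rewrite ltr_norml => /andP[_]; lra.
Qed.

Lemma closed_coord_le (a : R) : closed [set p : H | (heis_z p).1 <= a].
Proof.
move=> p clp /=; rewrite leNgt; apply/negP => pa.
have d0 : 0 < (heis_z p).1 - a by rewrite subr_gt0.
have [q [/= aq]] := clp _ (nbhsx_ballx p _ d0).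
rewrite ballEmdist/= => pq.
have := le_lt_trans (mdist_ge1 p q) pq; rewrite ltr_norml => /andP[_]; lra.
Qed.

(** A cell is cut out of the closed set [trace] by two closed half-spaces. *)
Lemma borel_cell j n : borel (cell j n).
Proof.
have closed_borel (C : set H) : closed C ->
    measurable (C : set (g_sigma_algebraType (@open H))).
  move=> cC; rewrite -[C]setCK; apply: measurableC.
  by apply: sub_sigma_algebra; exact: closed_openC.
have -> : cell j n = (trace `&` [set p | n%:~R * mesh j <= (heis_z p).1])
    `\` [set p | (n + 1)%:~R * mesh j <= (heis_z p).1].
  apply/seteqP; split => [p /cell_trace[x /andP[x1 x2] ->]|p [[[x _ <-] /= x1] /= x2]].
    by split; [split; [exists x|]|rewrite /= => h; move: x2; rewrite ltNge h].
  by apply/cellP; rewrite x1 ltNge; exact/negP.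
have mT := closed_borel _ (closed_trace K1 tangent).
have m1 := closed_borel _ (@closed_coord_ge (n%:~R * mesh j)).
have m2 := closed_borel _ (@closed_coord_ge ((n + 1)%:~R * mesh j)).
exact: (measurableD (measurableI _ _ mT m1) m2).
Qed.

(** The integer part of [y / k] depends only on that of [y]: cells are nested. *)
Lemma floor_divn (k : nat) y : (0 < k)%N ->
  Num.floor (y / k%:R) = Num.floor ((Num.floor y)%:~R / k%:R : R).
Proof.
move=> k0; have kR : 0 < k%:R :> R by rewrite ltr0n.
apply/esym/floor_def; have := floor_itv (y / k%:R).
rewrite ler_pdivlMr// ltr_pdivrMr// => /andP[h1 h2].
rewrite ler_pdivlMr// ltr_pdivrMr//; apply/andP; split; last first.
  exact: le_lt_trans (ge_floor y) h2.
move: h1; rewrite -[k%:R]/((Posz k)%:~R) -!intrM ler_int => h1.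
by rewrite floor_ge_int.
Qed.

Lemma mesh_add j (k : nat) : mesh (j + k) = mesh j / b%:R ^+ k.
Proof.
have /andP[r0 _] := rho_itv.
by rewrite /mesh expfzDr ?gt_eqF// -exprnP exprVn.
Qed.

Lemma cell_nested i j n m : i <= j -> cell i n `&` cell j m !=set0 ->
  cell j m `<=` cell i n.
Proof.
move=> ij; have [k ->] : exists k : nat, j = i + k.
  by exists `|j - i|%N; rewrite gez0_abs ?subr_ge0//; ring.
have coarse x : x / mesh i = (x / mesh (i + k)) / (b ^ k)%:R.
  have b0 : b%:R != 0 :> R by rewrite pnatr_eq0 -lt0n (leq_trans _ b2).
  rewrite mesh_add natrX; have := expf_neq0 k b0; have := lt0r_neq0 (mesh_gt0 i).
  by move: (b%:R ^+ k) (mesh i) => B M M0 B0; field; rewrite ?M0 ?B0.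
have bk : (0 < b ^ k)%N by rewrite expn_gt0 (leq_trans _ b2).
have fl x : Num.floor (x / mesh i) =
    Num.floor ((Num.floor (x / mesh (i + k)))%:~R / (b ^ k)%:R : R).
  by rewrite coarse floor_divn.
move=> [p [[x /= xn <-] [y /= ym yx]]].
have yx' : y = x by have := congr1 (fun p : H => (heis_z p).1) yx.
move=> _ [z /= zm <-]; exists z => //=.
by rewrite fl zm -ym yx' -fl.
Qed.

(** Points near the complement have parameters near one of the two ends. *)
Lemma cell_boundary j n (eta : R) : 0 < eta ->
  (hausdorff1 [set p | cell j n p /\
     (dist_set p (trace `\` cell j n) <= (eta * mesh j)%:E)%E] <=
   (36 * K * (eta * mesh j))%:E)%E.
Proof.
move=> eta0; have m0 := mesh_gt0 j.
set e := eta * mesh j; have e0 : 0 < e by rewrite mulr_gt0.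
pose I1 : set H := lift @` [set` `[n%:~R * mesh j, n%:~R * mesh j + 2 * e]].
pose I2 : set H := lift @` [set` `[(n + 1)%:~R * mesh j - 2 * e, (n + 1)%:~R * mesh j]].
apply: (@le_trans _ _ (hausdorff1 (I1 `|` I2))).
  apply: le_hausdorff1 => p [/cell_trace[x /andP[x1 x2] ->] hd].
  have lt1 : (dist_set (lift x) (trace `\` cell j n) < (2 * e)%:E)%E.
    by apply: (le_lt_trans hd); rewrite lte_fin; lra.
  have [_ [[y _ <-] Qy] xy] := dist_set_lt lt1.
  have := le_lt_trans (lift_expanding f G x y) xy; rewrite ltr_norml => /andP[h1 h2].
  have [ly|yl] := ltP y (n%:~R * mesh j).
    by left; exists x => //=; rewrite in_itv/=; apply/andP; split; lra.
  have [yr|ry] := ltP y ((n + 1)%:~R * mesh j); first by case: Qy; apply/cellP; rewrite yl.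
  by right; exists x => //=; rewrite in_itv/=; apply/andP; split; lra.
apply: (le_trans (hausdorff1U _ _)).
have -> : 36 * K * e = 9 * K * (2 * e) + 9 * K * (2 * e) by ring.
rewrite EFinD; apply: leeD.
  have -> : 2 * e = n%:~R * mesh j + 2 * e - n%:~R * mesh j by ring.
  apply: (hausdorff1_trace_le K1 tangent); first by lra.
  by move=> p [x /= + <-]; rewrite in_itv/= => h; exists x.
have -> : 2 * e = (n + 1)%:~R * mesh j - ((n + 1)%:~R * mesh j - 2 * e) by ring.
apply: (hausdorff1_trace_le K1 tangent); first by lra.
by move=> p [x /= + <-]; rewrite in_itv/= => h; exists x.
Qed.

Definition cells j : set (set H) := range (cell j).

(** The boundary layers of relative width [eta] have measure at most
    [36 * K * eta * mesh j] and the cell at least [mesh j / 4]. *)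
Let D := 144 * K.
Let D1 : 1 < D. Proof. by move: K1; rewrite /D; lra. Qed.
Let D0 : 0 < D. Proof. by move: K1; rewrite /D; lra. Qed.
Let DV4 : D^-1 <= 4^-1. Proof. by rewrite lef_pV2 ?posrE//; move: K1; rewrite /D; lra. Qed.

Definition cell_system : dyadic_system trace.
Proof.
refine (@DyadicSystem _ _ trace b%:R^-1 D setT cells rho_itv D1 _ _ _ _ _ _ _ _ _).
- by left; split; first exact: diam_trace.
- by move=> j _ _ [n _ <-]; exact: borel_cell.
- move=> j _ _ _ [n _ <-] [m _ <-] [_ [[x /= xn <-] [y /= ym yx]]].
  have yx' : y = x by have := congr1 (fun p : H => (heis_z p).1) yx.
  by rewrite -xn -ym yx'.
- move=> j _; apply/seteqP; split => [_ [x _ <-]|_ [_ [n _ <-] [x _ <-]]]; last by exists x.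
  by exists (cell j (Num.floor (x / mesh j))); [exists (Num.floor (x / mesh j))|exists x].
- move=> i j _ _ _ _ [n _ <-] [m _ <-] h.
  have [ij|/ltW ji] := leP i j; first by right; exact: cell_nested h.
  by left; apply: cell_nested ji _; rewrite setIC.
- move=> j _ _ [n _ <-]; rewrite -/(mesh j); apply/andP; split.
    apply: le_trans (diam_cell_ge j n); rewrite lee_fin mulrC.
    by apply: ler_wpM2l; [exact/ltW/mesh_gt0|apply: (le_trans DV4); lra].
  apply: (le_trans (diam_cell_le j n)); rewrite lee_fin.
  by apply: ler_wpM2r; [exact/ltW/mesh_gt0|move: K0; rewrite /D; lra].
- move=> j _ _ [n _ <-]; rewrite -/(mesh j); apply/andP; split.
    apply: le_trans (hausdorff1_cell_ge j n); rewrite lee_fin mulrC.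
    by apply: ler_wpM2l; [exact/ltW/mesh_gt0|].
  apply: (le_trans (hausdorff1_cell_le j n)); rewrite lee_fin.
  by apply: ler_wpM2r; [exact/ltW/mesh_gt0|move: K0; rewrite /D; lra].
- move=> j _ _ [n _ <-]; rewrite -/(mesh j); have m0 := mesh_gt0 j.
  exists (lift (n%:~R * mesh j + mesh j / 2)); first by eexists.
  move=> p [hx [x _ px]]; move: hx; rewrite -px /cball/= => hx {px}.
  have := le_trans (lift_expanding f G _ _) hx.
  have : D^-1 * mesh j <= mesh j / 4 by rewrite mulrC; apply: ler_wpM2l => //; exact: ltW.
  rewrite ler_norml => h1 /andP[h2 h3]; apply/cellP; rewrite cell_ends.
  by apply/andP; split; lra.
- move=> j _ eta _ [n _ <-] eta0; rewrite -/(mesh j).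
  have [eta1|eta1] := leP eta 1; last first.
    apply: (@le_trans _ _ (1 * hausdorff1 (cell j n))%E).
      by rewrite mul1e; apply: le_hausdorff1 => p [].
    apply: lee_pmul => //; first exact: hausdorff1_ge0.
    rewrite lee_fin -[leLHS]mul1r; apply: ler_pM => //; first exact: ltW.
    by rewrite -(powRr0 eta); apply: ler_powR; rewrite ?invr_ge0 ltW.
  apply: (le_trans (cell_boundary j n eta0)).
  apply: (@le_trans _ _ ((D * eta) * (mesh j / 4))%:E).
    by rewrite lee_fin le_eqVlt; apply/orP; left; apply/eqP; rewrite /D; field.
  rewrite EFinM; apply: lee_pmul => //; rewrite ?lee_fin.
  + by rewrite mulr_ge0// ltW.
  + by rewrite divr_ge0// ltW// mesh_gt0.
  + apply: ler_wpM2l; first exact: ltW.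
    apply: ger1_powR; first by rewrite eta0.
    by apply: (le_trans DV4); lra.
  + exact: hausdorff1_cell_ge.
Defined.

End dyadic.
(** * Vertical oscillation forces distance from horizontal lines *)

Section lower_bound.
Context {R : realType}.
Local Notation H := (heisenberg R).
Variables (f G : R -> R) (K : R) (b : nat).
Hypothesis K1 : 1 <= K.
Hypothesis tangent : tangent_modulus f G K.
Hypothesis b2 : (2 <= b)%N.
Local Notation lift := (lift f G).
Local Notation trace := (trace f G).
Local Notation cell := (cell f G b).
Local Notation mesh := (@mesh R b).

Let K0 : 0 <= K. Proof. by move: K1; lra. Qed.

(** The value of [x * y / 2 - t] at the point over [x] of the horizontal line
    through [(X, Y, T)] with slope [sigma]; this quantity is [G x] on the curve. *)
Definition line_prim (X Y T sigma x : R) : R :=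
  2^-1 * (Y + sigma * (x - X)) * x - T - 2^-1 * (X * (Y + sigma * (x - X)) - Y * x).

(** In the coordinates given by the curve, a horizontal line of slope [sigma]
    is the graph of a quadratic polynomial, and leaving the line by [theta] in
    the Koranyi distance changes the height over that graph by
    [O(theta ^+ 2)] only. *)
Lemma height_over_line (X Y T v1 v2 s x theta : R) : v1 != 0 ->
  mdist (lift x) (Heisenberg (X, Y) T * Heisenberg (s * v1, s * v2)%R 0)%g < theta ->
  `|G x - line_prim X Y T (v2 / v1) x| <=
    (3 / 4 + 2^-1 * `|v2 / v1|) * theta ^+ 2.
Proof.
move=> v10; set p := (Heisenberg _ _ * _)%g; move=> hp; set sigma := v2 / v1.
set u := (p^-1 * lift x)%g.
have uth : koranyi u < theta by exact: hp.
have th0 : 0 <= theta by apply: le_trans (koranyi_ge0 u) (ltW uth).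
have th2 : koranyi u ^+ 2 <= theta ^+ 2.
  by apply: lerXn2r; rewrite ?nnegrE ?koranyi_ge0// ltW.
have h1 := le_trans (koranyi_ge1 u) (ltW uth).
have h2 := le_trans (koranyi_ge2 u) (ltW uth).
have h3 := le_trans (koranyi_get u) th2.
have -> : G x - line_prim X Y T sigma x =
    2^-1 * ((heis_z u).1 * (heis_z u).2) - 2^-1 * sigma * (heis_z u).1 ^+ 2 - heis_t u.
  by rewrite /u heis_divE /line_prim /sigma /=; field.
have m1 : `|2^-1 * ((heis_z u).1 * (heis_z u).2)| <= 2^-1 * theta ^+ 2.
  by rewrite normrM ger0_norm// ler_wpM2l// normrM expr2 ler_pM.
have m2 : `|2^-1 * sigma * (heis_z u).1 ^+ 2| <= 2^-1 * `|sigma| * theta ^+ 2.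
  rewrite normrM normrX [`|2^-1 * _|]normrM [`|2^-1|]ger0_norm//.
  apply: ler_wpM2l; first by rewrite mulr_ge0.
  by apply: lerXn2r; rewrite ?nnegrE.
apply: (le_trans (ler_normB _ _)); apply: (le_trans (lerD (ler_normB _ _) (lexx _))).
by lra.
Qed.

(** Four equally spaced points near a horizontal line: the slope of the line is
    controlled by the first and the last of them, and the third difference
    removes the quadratic polynomial. *)
Lemma third_near_line (V : set H) t h theta : horizontal_lines V ->
  0 < theta -> theta <= h / 2 ->
  (forall i, (i < 4)%N -> (dist_set (lift (t + i%:R * h)) V < theta%:E)%E) ->
  `|third G t h| <= 20 * K * theta ^+ 2.
Proof.
move=> [[[X Y] T] [[v1 v2] [v0 ->]]] th0 thh hV.
have h0 : 0 < h by lra.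
have pt i : (i < 4)%N -> exists s,
    mdist (lift (t + i%:R * h)) (Heisenberg (X, Y) T * Heisenberg (s * v1, s * v2)%R 0)%g < theta.
  by move=> /hV/dist_set_lt[_ [_ [s _ <-] <-] d]; exists s.
have [s0 d0] := pt 0%N isT; have [s1 d1] := pt 1%N isT.
have [s2 d2] := pt 2%N isT; have [s3 d3] := pt 3%N isT.
have x0 := le_lt_trans (mdist_ge1 _ _) d0; have x3 := le_lt_trans (mdist_ge1 _ _) d3.
have y0 := le_lt_trans (koranyi_ge2 _) d0; have y3 := le_lt_trans (koranyi_ge2 _) d3.
rewrite heis_divE /= in y0 y3; rewrite /= in x0 x3.
rewrite mul0r addr0 in d0 x0 y0; rewrite mul1r in d1.
have fl := tangent_modulus_lip K1 tangent (t + 3 * h) t.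
rewrite addrAC subrr add0r (ger0_norm (_ : 0 <= 3 * h)) in fl; last by rewrite mulr_ge0// ltW.
have ds1 : 2 * h <= (s3 - s0) * v1.
  by move: x0 x3; rewrite !ltr_norml => /andP[? ?] /andP[? ?]; lra.
have ds2 : `|(s3 - s0) * v2| <= 7 * K * h.
  have Kh : h <= K * h by rewrite ler_peMl// ltW.
  move: y0 y3 fl; rewrite !ltr_norml !ler_norml => /andP[? ?] /andP[? ?] /andP[? ?].
  by apply/andP; split; lra.
have v10 : v1 != 0.
  by apply/eqP => v10; move: ds1; rewrite v10 mulr0; lra.
have ds0 : s3 - s0 != 0.
  by apply/eqP => e; move: ds1; rewrite e mul0r; lra.
set sigma := v2 / v1.
have sK : `|sigma| <= 7 / 2 * K.
  have -> : sigma = ((s3 - s0) * v2) / ((s3 - s0) * v1).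
    by rewrite /sigma; field; rewrite v10 ds0.
  rewrite normrM normfV (gtr0_norm (_ : 0 < (s3 - s0) * v1)); last by lra.
  rewrite ler_pdivrMr; last by lra.
  apply: (le_trans ds2).
  have -> : 7 * K * h = 7 / 2 * K * (2 * h) by field.
  by apply: ler_wpM2l => //; rewrite mulr_ge0.
have q0 := height_over_line v10 d0; have q1 := height_over_line v10 d1.
have q2 := height_over_line v10 d2; have q3 := height_over_line v10 d3.
rewrite -/sigma in q0 q1 q2 q3.
set q := line_prim X Y T sigma in q0 q1 q2 q3.
have -> : third G t h = (G (t + 3 * h) - q (t + 3 * h)) - 3 * (G (t + 2 * h) - q (t + 2 * h))
    + 3 * (G (t + h) - q (t + h)) - (G t - q t).
  by rewrite /third /q /line_prim; field.
have e : (3 / 4 + 2^-1 * `|sigma|) * theta ^+ 2 <= 5 / 2 * K * theta ^+ 2.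
  apply: ler_wpM2r; first exact: sqr_ge0.
  by move: K1 sK; lra.
move: (G _ - q _) (G _ - q _) (G _ - q _) (G _ - q _) q0 q1 q2 q3 => a3 a2 a1 a0.
move=> /le_trans/(_ e) + /le_trans/(_ e) + /le_trans/(_ e) + /le_trans/(_ e).
have -> : 20 * K * theta ^+ 2 = 8 * (5 / 2 * K * theta ^+ 2) by field.
move: (5 / 2 * K * theta ^+ 2) => w.
rewrite !ler_norml => /andP[? ?] /andP[? ?] /andP[? ?] /andP[? ?].
by apply/andP; split; lra.
Qed.

(** In units of the mesh, a bound for the diameter and for the measure of a
    doubled cell. *)
Let Delta := 9 * 21 * K ^+ 2.
Let Delta_gt0 : 0 < Delta.
Proof.
rewrite /Delta; apply: mulr_gt0; first by apply: mulr_gt0; exact: ltr0Sn.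
by apply: exprn_gt0; move: K1; lra.
Qed.

(** The average distance is at least [theta / Delta] times the proportion
    [(1 / 800) / Delta] of far points, where [theta ^ 2 = a / (21 * K)] in units
    of the mesh; the constant is the square of this product divided by [a]. *)
Definition beta_const : R := ((8 * 100 * Delta ^+ 2) ^+ 2 * (21 * K))^-1.

Lemma beta_const_gt0 : 0 < beta_const.
Proof.
have k0 : 0 < K by move: K1; lra.
rewrite invr_gt0; apply: mulr_gt0; last by apply: mulr_gt0 k0; exact: ltr0Sn.
apply: exprn_gt0; apply: mulr_gt0; first by apply: mulr_gt0; exact: ltr0Sn.
by apply/exprn_gt0/Delta_gt0.
Qed.

Lemma dilate_cell (j m : int) p : dilate 2 trace (cell j m) p ->
  exists2 x, m%:~R * mesh j - 10 * K * mesh j <= x <=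
    m%:~R * mesh j + (1 + 10 * K) * mesh j & p = lift x.
Proof.
have m0 : 0 < mesh j := mesh_gt0 b2 j.
move=> [[x _ <-] hx]; exists x => //.
have lt1 : (dist_set (lift x) (cell j m) < (10 * K * mesh j)%:E)%E.
  apply: (le_lt_trans hx); rewrite (_ : 2 - 1 = 1) ?mul1e; last by ring.
  apply: (le_lt_trans (diam_cell_le K1 tangent b2 j m)); rewrite lte_fin ltr_pM2r//.
  by move: K1; lra.
have [_ /(cell_trace b2)[y /andP[y1 y2] ->] xy] := dist_set_lt lt1.
have := le_lt_trans (lift_expanding f G x y) xy.
rewrite cell_ends in y2; rewrite ltr_norml => /andP[? ?].
by apply/andP; split; lra.
Qed.

(** Among four points at distance [mesh / 4] one is far from the line. Moving
    the four points along an interval of length [mesh / 100], four translates of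
    the projection of the set of far points cover that interval, so the far
    points have measure at least [mesh / 800]. *)
Lemma beta_cell_ge (n : nat) (m : int) (a : R) : 0 < a <= 10^-1 ->
  (forall s, 0 <= s <= 100^-1 -> a * mesh n ^+ 2 <=
     `|third G ((m%:~R + s) * mesh n) (mesh n / 4)|) ->
  ((beta_const * a)%:E <= beta (dilate 2 trace (cell n m)) `^ 2)%E.
Proof.
move=> /andP[a0 a1] osc; set rho := mesh n; have rho0 : 0 < rho := mesh_gt0 b2 n.
set A := dilate _ _ _; pose theta := rho * Num.sqrt (a / (21 * K)).
have k0 : 0 < K by move: K1; lra.
have D0 := Delta_gt0.
have aK0 : 0 < a / (21 * K) by rewrite divr_gt0// mulr_gt0.
have th0 : 0 < theta by rewrite mulr_gt0// sqrtr_gt0.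
have th2 : theta ^+ 2 = rho ^+ 2 * (a / (21 * K)).
  by rewrite exprMn sqr_sqrtr// ltW.
have thh : theta <= (rho / 4) / 2.
  rewrite -(@ler_pXn2r _ 2) ?nnegrE ?(ltW th0) ?divr_ge0 ?(ltW rho0)// th2.
  rewrite (_ : (rho / 4 / 2) ^+ 2 = rho ^+ 2 * 64^-1); last by field.
  apply: ler_wpM2l; first exact: sqr_ge0.
  by rewrite ler_pdivrMr ?mulr_gt0//; move: K1; lra.
have diamA : (diam A <= (Delta * rho)%:E)%E.
  apply: diam_le; first by rewrite mulr_ge0// ltW.
  move=> p q /dilate_cell[x /andP[x1 x2] ->] /dilate_cell[y /andP[y1 y2] ->].
  apply: (le_trans (lift_lip K1 tangent x y)).
  rewrite (_ : Delta * rho = 9 * K * (21 * K * rho)); last by rewrite /Delta; ring.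
  apply: ler_wpM2l; first by rewrite mulr_ge0.
  have Kr : rho <= K * rho by rewrite ler_peMl// ltW.
  by move: x1 x2 y1 y2; rewrite ler_norml -/rho => *; apply/andP; split; lra.
have HA : (hausdorff1 A <= (Delta * rho)%:E)%E.
  apply: (@le_trans _ _ (9 * K * ((m%:~R * rho + (1 + 10 * K) * rho) -
      (m%:~R * rho - 10 * K * rho)))%:E).
    apply: (hausdorff1_trace_le K1 tangent); last exact: dilate_cell.
    have : 0 <= K * rho by rewrite mulr_ge0// ltW.
    by lra.
  rewrite lee_fin (_ : Delta * rho = 9 * K * (21 * K * rho)); last by rewrite /Delta; ring.
  apply: ler_wpM2l; first by rewrite mulr_ge0.
  have Kr : rho <= K * rho by rewrite ler_peMl// ltW.
  by lra.
have cellA : cell n m `<=` A.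
  move=> p Qp; split; first by case: Qp => x _ <-; exists x.
  rewrite dist_set_in//; apply: mule_ge0; last exact: diam_ge0.
  by rewrite lee_fin; lra.
have HA0 : (0 < hausdorff1 A)%E.
  apply: lt_le_trans (le_hausdorff1 cellA).
  by apply: lt_le_trans (hausdorff1_cell_ge f G b2 n m); rewrite lte_fin divr_gt0.
have diamA0 : (0 < diam A)%E.
  apply: lt_le_trans (le_diam cellA).
  by apply: lt_le_trans (diam_cell_ge f G b2 n m); rewrite lte_fin divr_gt0.
have dist_ge V : horizontal_lines V ->
    ((theta / (Delta * rho) * (rho / (8 * 100)) / (Delta * rho))%:E <= avg_dist A V)%E.
  move=> HV; pose U := [set p | theta%:E <= dist_set p V]%E `&`
    (trace `&` ([set p : H | m%:~R * rho <= (heis_z p).1] `&`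
      [set p : H | (heis_z p).1 <= m%:~R * rho + 9 / 10 * rho])).
  have Delta_rho : 0 < Delta * rho by exact: mulr_gt0.
  apply: (@average_ge _ _ U) => //.
  - exact/ltW/divr_gt0.
  - by apply: divr_ge0; [exact: ltW|apply: mulr_ge0; exact: ler0n].
  - move=> p _; apply: mule_ge0; first exact: dist_set_ge0.
    by rewrite inve_ge0; exact: diam_ge0.
  - apply: subset_trans cellA => p [_ [[x _ <-] [/= x1 x2]]].
    by apply/(cellP f G b2); rewrite -/rho x1 cell_ends -/rho; lra.
  - apply: closedI; first exact: closed_dist_set_ge.
    apply: closedI; first exact: closed_trace K1 tangent.
    apply: closedI; [exact: (@closed_coord_ge _ (m%:~R * rho))|].
    exact: (@closed_coord_le _ (m%:~R * rho + 9 / 10 * rho)).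
  - move=> p [/= hp _].
    move: diamA diamA0; case: (diam A) => [d| |]//; rewrite lee_fin lte_fin => dD d0.
    rewrite inver gt_eqF// EFinM; apply: lee_pmul => //.
    + by rewrite lee_fin ltW.
    + by rewrite lee_fin invr_ge0 ltW.
    + by rewrite lee_fin lef_pV2 ?posrE.
  - have := @hausdorff1_ge_lipschitz _ _ (fun p : H => (heis_z p).1) U 4
      (fun i => i%:R * (rho / 4)) (m%:~R * rho) (m%:~R * rho + rho / 100).
    rewrite (_ : (_ - _) / _ = rho / (8 * 100)); last by field.
    apply => //; first by move=> x y; exact: mdist_ge1.
    move=> t /andP[t1 t2]; apply: contrapT => none.
    have all_near i : (i < 4)%N -> (dist_set (lift (t + i%:R * (rho / 4))) V < theta%:E)%E.
      move=> i4; rewrite ltNge; apply/negP => far; apply: none; exists i => //.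
      exists (lift (t + i%:R * (rho / 4))) => //; split => //; split; first by eexists.
      have i3 : 0 <= i%:R * (rho / 4) <= 3 * (rho / 4).
        by rewrite mulr_ge0 ?divr_ge0 ?(ltW rho0)//= ler_wpM2r ?divr_ge0 ?(ltW rho0)// ler_nat.
      by case/andP: i3 => i0 i3; split => /=; lra.
    have up := third_near_line HV th0 thh all_near.
    have := osc ((t - m%:~R * rho) / rho).
    rewrite -/rho (_ : (m%:~R + _) * rho = t); last by field; exact: lt0r_neq0.
    have s01 : 0 <= (t - m%:~R * rho) / rho <= 100^-1.
      by rewrite ler_pdivlMr// ler_pdivrMr// mul0r; apply/andP; split; lra.
    move=> /(_ s01) /le_trans /(_ up); rewrite th2.
    rewrite (_ : 20 * K * _ = a * rho ^+ 2 * (20 / 21)); last by field; exact: lt0r_neq0.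
    have : 0 < a * rho ^+ 2 by rewrite mulr_gt0// exprn_gt0.
    by lra.
  - by rewrite HA0.
set c := theta / (Delta * rho) * (rho / (8 * 100)) / (Delta * rho) in dist_ge.
have c0 : 0 <= c.
  rewrite /c !mulr_ge0 ?invr_ge0 ?mulr_ge0 ?(ltW th0) ?(ltW D0) ?(ltW rho0)//.
have c2 : beta_const * a = c ^+ 2.
  have -> : c = theta / rho / (8 * 100 * Delta ^+ 2).
    by rewrite /c; field; rewrite (lt0r_neq0 D0) (lt0r_neq0 rho0).
  rewrite expr_div_n [(theta / rho) ^+ 2]expr_div_n th2 /beta_const.
  by field; rewrite (lt0r_neq0 D0) (lt0r_neq0 rho0) (lt0r_neq0 k0).
rewrite c2 -powR_mulrn// -poweR_EFin.
have beta_ge : (c%:E <= beta A)%E.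
  by apply: le_ereal_inf_tmp => _ [V HV <-]; exact: dist_ge.
apply: gt0_ler_poweR => //; rewrite in_itv/= leey andbT ?lee_fin//.
by apply: le_trans beta_ge; rewrite lee_fin.
Qed.

End lower_bound.
(** * Divergence of the sum of the coefficients *)

Section divergence.
Context {R : realType}.
Local Notation H := (heisenberg R).
Variables (f G : R -> R) (K : R) (b : nat).
Hypothesis K1 : 1 <= K.
Hypothesis tangent : tangent_modulus f G K.
Hypothesis b2 : (2 <= b)%N.
Local Notation trace := (trace f G).
Local Notation cell := (cell f G b).
Local Notation mesh := (@mesh R b).

Lemma mesh_nat (n : nat) : mesh n = (b%:R ^+ n)^-1.
Proof. by rewrite /mesh -exprnP exprVn. Qed.

Lemma mesh_lt (n n' : nat) : (n < n')%N -> mesh n' < mesh n.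
Proof.
move=> nn'; have b0 : 0 < b%:R :> R by rewrite ltr0n (leq_trans _ b2).
rewrite !mesh_nat ltf_pV2 ?posrE ?exprn_gt0// ltr_eXn2l//.
by rewrite ltr1n.
Qed.

(** The ends of the interval are determined by the set, and the mesh by the ends. *)
Lemma cell_inj (n n' : nat) (m m' : int) : cell n m = cell n' m' -> (n, m) = (n', m').
Proof.
have left_end (i j : nat) (k l : int) : cell i k = cell j l -> l%:~R * mesh j <= k%:~R * mesh i.
  move=> e; have : cell i k (lift f G (k%:~R * mesh i)).
    by apply/(cellP f G b2); rewrite lexx cell_ends ltrDl; exact: mesh_gt0.
  by rewrite e => /(cellP f G b2)/andP[].
have mesh_le (i j : nat) (k l : int) : cell i k = cell j l -> (i <= j)%N.
  move=> e; rewrite leqNgt; apply/negP => ji.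
  have ends : k%:~R * mesh i = l%:~R * mesh j.
    by apply/eqP; rewrite eq_le (left_end _ _ _ _ (esym e)) (left_end _ _ _ _ e).
  have : cell j l (lift f G (l%:~R * mesh j + mesh i)).
    apply/(cellP f G b2); rewrite cell_ends lerDl ltrD2l mesh_lt// andbT.
    exact/ltW/(mesh_gt0 b2).
  by rewrite -e => /(cellP f G b2); rewrite cell_ends ends ltxx andbF.
move=> e; have nn : n = n'.
  by apply/eqP; rewrite eqn_leq (mesh_le _ _ _ _ e) (mesh_le _ _ _ _ (esym e)).
rewrite -nn in e *; congr (_, _).
have : m%:~R * mesh n = m'%:~R * mesh n.
  by apply/eqP; rewrite eq_le (left_end _ _ _ _ (esym e)) (left_end _ _ _ _ e).
by move=> /(mulIf (lt0r_neq0 (mesh_gt0 b2 n)))/eqP; rewrite eqr_int => /eqP.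
Qed.

Lemma cell_sub_unit (n m : nat) : (m < b ^ n)%N -> cell n m `<=` cell 0 0.
Proof.
move=> mb p /(cell_trace b2)[x /andP[x1 x2] ->]; apply/(cellP f G b2).
have m0 : 0 < mesh n := mesh_gt0 b2 n.
have -> : mesh 0 = 1 by rewrite /mesh expr0z.
rewrite mul0r add0r mul1r; apply/andP; split.
  by apply: le_trans x1; apply: mulr_ge0 => //; exact: ltW.
apply: (lt_le_trans x2).
have b0 : 0 < b%:R ^+ n :> R by rewrite exprn_gt0// ltr0n (leq_trans _ b2).
rewrite mesh_nat ler_pdivrMr// mul1r -natrX.
have -> : (Posz m + 1)%:~R = m.+1%:R :> R by rewrite intrD -pmulrn natr1.
by rewrite ler_nat.
Qed.

(** Cells of different index are different sets, so a finite double sum over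
    indices is part of the Carleson sum over the subcells of the unit cell. *)
Lemma GLem_beta_sum : GLem beta 2 trace -> exists M : R, forall (a : nat -> nat -> R) N,
  (forall n m, 0 <= a n m /\
     ((a n m)%:E <= beta (dilate 2 trace (cell n m)) `^ 2)%E) ->
  \sum_(n < N) \sum_(m < b ^ n) a n m * (mesh n / 4) <= M.
Proof.
move=> /(_ (cell_system K1 tangent b2) 2) [|C hC]; first by rewrite ltr1n.
have /hC {}hC : dy_cubes (cell_system K1 tangent b2) (cell 0 0).
  by exists 0 => //; exists 0.
exists (`|C| * (9 * K * mesh 0)) => a N ha.
rewrite -lee_fin; set F := fun Q : set H => (beta (dilate 2 trace Q) `^ 2 * hausdorff1 Q)%E in hC.
have F0 Q : (0 <= F Q)%E.
  by apply: mule_ge0; [exact: poweR_ge0|exact: hausdorff1_ge0].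
pose P : set (nat * nat) := `I_N `*`` (fun n => `I_(b ^ n)).
pose e (k : nat * nat) : set H := cell k.1 k.2.
have subP : e @` P `<=` [set Q | dy_cubes (cell_system K1 tangent b2) Q /\ Q `<=` cell 0 0].
  move=> _ [[n m] [/= nN mb] <-]; split; last exact: cell_sub_unit.
  by exists (Posz n) => //; exists (Posz m).
apply: (@le_trans _ _ (\esum_(Q in e @` P) F Q)%E); last first.
  apply: (@le_trans _ _ (`|C|%:E * hausdorff1 (cell 0 0))%E).
    apply: (@le_trans _ _ (C%:E * hausdorff1 (cell 0 0))%E).
      apply: le_trans hC; apply: ereal_sup_le => _ [X [finX XP] <-].
      by exists X => //; split => //; exact: subset_trans subP.
    by apply: lee_wpmul2r; [exact: hausdorff1_ge0|rewrite lee_fin ler_norm].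
  rewrite EFinM; apply: lee_wpmul2l; first by rewrite lee_fin.
  exact: hausdorff1_cell_le.
have -> : (\esum_(Q in e @` P) F Q = \esum_(k in P) F (e k))%E.
  apply: esum_image => -[n m] [n' m'] _ _ /cell_inj[-> mm'].
  by congr (_, _); move: mm' => [].
rewrite -(@esum_esum _ _ _ `I_N (fun n => `I_(b ^ n)) (fun n m => F (cell n m)))//.
rewrite esum_fset//; last by move=> i _; apply: esum_ge0.
rewrite -fsbig_ord -sumEFin; apply: lee_sum => n _.
rewrite esum_fset// -fsbig_ord -sumEFin; apply: lee_sum => m _.
have [a0 ab] := ha n m; rewrite EFinM; apply: lee_pmul => //; rewrite ?lee_fin//.
  by rewrite divr_ge0//; exact/ltW/(mesh_gt0 b2).
exact: hausdorff1_cell_ge.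
Qed.

End divergence.

Lemma harmonic_sum_unbounded {R : realType} (M : R) :
  exists N, M < \sum_(n < N) n.+1%:R^-1.
Proof.
apply: contrapT => h; apply: (@dvg_harmonic R); apply: nondecreasing_is_cvgn.
  by apply/nondecreasing_seqP => n; rewrite /series/= big_nat_recr//= lerDl /harmonic/=.
exists M => _ [N _ <-]; rewrite leNgt; apply/negP => MN; apply: h; exists N.
by rewrite /series/= big_mkord in MN.
Qed.

Theorem theorem1p4 (R : realType) :
  exists Gamma : set (heisenberg R),
    [/\ regular1 Gamma, curve Gamma,
        ~ GLem beta 2 Gamma & GLem beta_hat 4 Gamma].
Proof.
(* The base has to exceed [1400 * 25600], so that the neighbouring generations
   take at most half of the third difference of a large generation. *)
have [b b_large] : exists b : nat, 10 ^+ 8 <= b%:R :> R.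
  by exists (Num.truncn (10 ^+ 8 : R)).+1; exact/ltW/truncnS_gt.
set B := b%:R in b_large.
have B_ge : 14 * 100 * (256 * 100) <= B.
  apply: le_trans b_large; rewrite (_ : 10 ^+ 8 = 10 ^+ 4 * 10 ^+ 4); last by rewrite -exprD.
  lra.
have B4 : 4 <= B by lra.
have b2 : (2 <= b)%N by rewrite -(ler_nat R); move: B4; rewrite /B; lra.
have [cu [cv [cu_le cv_le su sv big]]] := riesz_coefficients b_large.
have Tu := profile_tangent_modulus B4 cu_le su.
have Tv := profile_tangent_modulus B4 cv_le sv.
set K := 200 * B ^+ 2 * (1 + ln B) in Tu Tv.
have K1 : 1 <= K.
  have lB : 0 <= ln B by rewrite ln_ge0//; lra.
  have B21 : 1 <= B ^+ 2 by rewrite expr_ge1//; lra.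
  rewrite /K -[leLHS]mulr1; apply: ler_pM => //; lra.
pose kappa := beta_const K / (256 * 100).
have kappa0 : 0 < kappa by rewrite divr_gt0// beta_const_gt0.
(* A large coefficient makes the corresponding cell bad. *)
have bad (c : nat -> int -> R) (c_le : forall k m, `|c k m| <= k.+1%:R^-1)
    (T : tangent_modulus (profile B c) (prim B c) K) (n : nat) (m : int) :
    n.+1%:R^-1 / 128 <= `|c n m| ->
    ((kappa * n.+1%:R^-1)%:E <= beta (dilate 2 (trace (profile B c) (prim B c))
        (cell (profile B c) (prim B c) b n m)) `^ 2)%E.
  move=> cbig; have al0 : 0 < n.+1%:R^-1 :> R by [].
  have al1 : n.+1%:R^-1 <= 1 :> R by rewrite invf_le1// ler1n.
  have -> : kappa * n.+1%:R^-1 = beta_const K * (n.+1%:R^-1 / (256 * 100)).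
    by rewrite /kappa mulrAC mulrA.
  have e0 : 0 < 256 * 100 :> R by apply: mulr_gt0; exact: ltr0Sn.
  apply: (beta_cell_ge K1 T b2).
    rewrite divr_gt0//= ler_pdivrMr//; apply: (le_trans al1); lra.
  move=> s s01; rewrite mesh_nat; apply: le_trans (third_prim_ge B4 c_le n m s01).
  apply: ler_wpM2r; first exact: sqr_ge0.
  have small : 14 * 100 * n.+1%:R^-1 / B <= n.+1%:R^-1 / (256 * 100).
    rewrite [_ * n.+1%:R^-1]mulrC -mulrA; apply: ler_wpM2l; first exact: ltW.
    rewrite ler_pdivrMr; last by lra.
    by rewrite [leRHS]mulrC ler_pdivlMr.
  apply: le_trans (lerB (lexx _) small).
  by move: (`|c n m|) (n.+1%:R^-1) cbig => d al cbig; lra.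
pose w (c : nat -> int -> R) (n m : nat) : R :=
  if n.+1%:R^-1 / 128 <= `|c n m| then kappa * n.+1%:R^-1 else 0.
have hw (c : nat -> int -> R) (c_le : forall k m, `|c k m| <= k.+1%:R^-1)
    (T : tangent_modulus (profile B c) (prim B c) K) (n m : nat) : 0 <= w c n m /\
    ((w c n m)%:E <= beta (dilate 2 (trace (profile B c) (prim B c))
        (cell (profile B c) (prim B c) b n m)) `^ 2)%E.
  rewrite /w; case: ifP => [h|_]; last by split => //; exact: poweR_ge0.
  by split; [rewrite mulr_ge0// ltW|exact: bad].
(* At least one of the two curves violates the condition for [beta]: otherwise
   the two Carleson bounds together bound the harmonic series. *)
have [nu|gu] := pselect (~ GLem beta 2 (trace (profile B cu) (prim B cu))).
  exists (trace (profile B cu) (prim B cu)); split => //.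
  - exact: regular1_trace K1 Tu.
  - exact: curve_trace K1 Tu.
  - exact: GLem_beta_hat_trace K1 Tu.
exists (trace (profile B cv) (prim B cv)); split.
- exact: regular1_trace K1 Tv.
- exact: curve_trace K1 Tv.
- move=> /(GLem_beta_sum K1 Tv b2)[Mv hMv].
  have [Mu hMu] := GLem_beta_sum K1 Tu b2 (contrapT gu).
  have [N hN] := harmonic_sum_unbounded ((Mu + Mv) / (kappa / 4)).
  have hu := hMu (w cu) N (hw cu cu_le Tu); have hv := hMv (w cv) N (hw cv cv_le Tv).
  have := lerD hu hv; rewrite -big_split/= leNgt => /negP; apply.
  have k40 : 0 < kappa / 4 by rewrite divr_gt0.
  move: hN; rewrite ltr_pdivrMr// => hN; apply: (lt_le_trans hN).
  rewrite mulr_suml; apply: ler_sum => n _; rewrite -big_split/=.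
  apply: (@le_trans _ _ (\sum_(m < b ^ n) kappa * n.+1%:R^-1 * (mesh b n / 4))).
    rewrite sumr_const card_ord -[_ *+ (b ^ n)]mulr_natr natrX mesh_nat -/B.
    have Bn0 : B ^+ n != 0 by apply/expf_neq0/lt0r_neq0; lra.
    rewrite le_eqVlt; apply/orP; left; apply/eqP.
    by move: (n.+1%:R^-1) => al; field.
  apply: ler_sum => m _; rewrite -mulrDl; apply: ler_wpM2r.
    by rewrite divr_ge0//; exact/ltW/(mesh_gt0 b2).
  have kal : 0 <= kappa * n.+1%:R^-1 by rewrite mulr_ge0// ltW.
  rewrite /w; case: (big n m) => ->; case: ifP => _; rewrite ?addr0 ?add0r//.
    by rewrite lerDl.
  by rewrite lerDl.
- exact: GLem_beta_hat_trace K1 Tv.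
Qed.
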